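(* Let $a:[0,\infty)\to[0,\infty)$ be a non-increasing function with $\int_0^\infty a(s)\,\mathrm{d}s<\infty$ which is $\delta$-Hölder continuous in a neighborhood of $0$ for some $\delta>0$. Then the trawl process $$X(t)=\iint_{[0,\infty)\times(-\infty,t]}\mathbf{1}\bigl(0\le x\le a(t-s)\bigr)\,\Lambda(\mathrm{d}x,\mathrm{d}s),\qquad t\in\mathbb{R},$$ has a càdlàg modification.
   Context: The function $a$ is $\delta$-Hölder continuous in a neighborhood of $0$ if there exist $C>0$ and $t_0>0$ such that $|a(t)-a(s)|\le C|t-s|^\delta$ for all $s,t\in[0,t_0]$. $\lambda$ is a Lévy measure on $(0,\infty)$ (i.e. $\int_{(0,\infty)}(1\wedge z^2)\lambda(\mathrm{d}z)<\infty$), $m\in\mathbb{R}$, and $\mu$ is a Poisson random measure on $[0,\infty)\times\mathbb{R}\times(0,\infty)$ with intensity $\nu(\mathrm{d}x,\mathrm{d}u,\mathrm{d}z)=\mathrm{d}x\,\mathrm{d}u\,\lambda(\mathrm{d}z)$. $\Lambda$ is the infinitely divisible independently scattered random measure $$\Lambda(\mathrm{d}x,\mathrm{d}u)=m\,\mathrm{d}x\,\mathrm{d}u+\int_{(0,1]}z(\mu-\nu)(\mathrm{d}x,\mathrm{d}u,\mathrm{d}z)+\int_{(1,\infty)}z\,\mu(\mathrm{d}x,\mathrm{d}u,\mathrm{d}z).$$ Integrals with respect to $\Lambda$ are in the sense of Rajput and Rosiński (limits in probability of integrals of simple functions). A modification of $X$ is a process $Y$ with $\mathbf{P}(X(t)=Y(t))=1$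 for every $t$; càdlàg means paths are right-continuous with left limits. *)

(* Defs.v *)
From HB Require Import structures.
From mathcomp Require Import all_boot all_order all_algebra.
From mathcomp Require Import all_classical all_reals all_analysis.
From mathcomp Require Import measurable_realfun.

Set Implicit Arguments.
Unset Strict Implicit.
Unset Printing Implicit Defensive.

Import Order.TTheory GRing.Theory Num.Theory.
Import numFieldNormedType.Exports.
Import HBSimple.

Local Open Scope classical_set_scope.
Local Open Scope ring_scope.

Section trawl_assumptions.
Context {R : realType}.
Implicit Types (a : R -> R) (lambda : {measure set (measurableTypeR R) -> \bar R}).

(* A function on [0, oo) is a total function whose values on (-oo, 0) are
   irrelevant. *)
Definition nonincreasing_on_nneg a :=
  forall s t, 0 <= s -> s <= t -> a t <= a s.

Definition holder_near0 (delta : R) a :=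
  exists C t0 : R, [/\ 0 < C, 0 < t0 &
    forall s t, 0 <= s <= t0 -> 0 <= t <= t0 ->
      `|a t - a s| <= C * `|t - s| `^ delta].

(* A measure on (0, oo) is a measure on R that vanishes on (-oo, 0]. *)
Definition levy_measure lambda :=
  lambda `]-oo, 0%R]%classic = 0%E /\
  (\int[lambda]_(z in `]0%R, +oo[) (Num.min 1 (z ^+ 2))%:E < +oo)%E.

Definition cadlag (f : R -> R) :=
  forall t, f x @[x --> t^'+] --> f t /\ cvg (f x @[x --> t^'-]).

End trawl_assumptions.

Section random_measures.
Context {d : measure_display} {Omega : measurableType d} {R : realType}.
Variable P : probability Omega R.

Definition cvg_in_prob {I : Type} (F : set_system I)
    (Z : I -> Omega -> R) (Y : Omega -> R) :=
  forall e : R, 0 < e ->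
    P [set w | e <= `|Z i w - Y w|] @[i --> F] --> 0%E.

(* Taking some of the [B i] to be the full set gives the product rule for
   subfamilies. *)
Definition mutually_independent (n : nat) (Z : 'I_n -> Omega -> \bar R) :=
  forall B : 'I_n -> set (\bar R), (forall i, measurable (B i)) ->
    P [set w | forall i, B i (Z i w)] = (\prod_(i < n) P (Z i @^-1` B i))%E.

(* Poisson random measure on the measurable subset [E] of [T], with intensity
   [nu]. [poisson_prob r k] does not depend on [k] and, unlike [poisson_pmf],
   is the Dirac mass at 0 when r = 0. *)
Definition poisson_random_measure {d' : measure_display}
    {T : measurableType d'} (E : set T) (nu : set T -> \bar R)
    (mu : R.-ker Omega ~> T) :=
  [/\ forall B, measurable B -> B `<=` E -> (nu B < +oo)%E ->
        forall k : nat, P [set w | mu w B = k%:R%:E] =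
          poisson_prob (fine (nu B)) k [set k],
      forall B, measurable B -> B `<=` E -> nu B = +oo%E ->
        P [set w | mu w B = +oo%E] = 1%E
    & forall (n : nat) (B : 'I_n -> set T),
        (forall i, measurable (B i)) -> (forall i, B i `<=` E) ->
        trivIset setT B ->
        mutually_independent (fun i w => mu w (B i))].

Local Notation mR := (measurableTypeR R).
Implicit Types (lambda : {measure set mR -> \bar R})
  (mu : R.-ker Omega ~> (mR * mR * mR)%type)
  (Lambda : set (mR * mR) -> {RV P >-> mR}).

Definition leb2 : set (mR * mR) -> \bar R :=
  (@lebesgue_measure R \x @lebesgue_measure R)%E.

Definition half_plane : set (mR * mR) := `[0%R, +oo[%classic `*` setT.

Definition marked_half_plane : set (mR * mR * mR) :=
  half_plane `*` `]0%R, +oo[%classic.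

Definition intensity lambda : set (mR * mR * mR) -> \bar R :=
  (leb2 \x lambda)%E.

(* The delta-ring of sets on which an independently scattered random measure on
   [half_plane] with Lebesgue control measure is defined. *)
Definition finite_area (A : set (mR * mR)) :=
  [/\ measurable A, A `<=` half_plane & (leb2 A < +oo)%E].

(* Integral of z over A x (0, 1] against mu - nu: the limit in probability of
   the integrals over A x (eps, 1], where nu has finite mass. *)
Definition is_compensated_integral lambda mu (A : set (mR * mR))
    (Y : {RV P >-> mR}) :=
  cvg_in_prob (0 : R)^'+
    (fun eps w =>
       fine (\int[mu w]_(y in A `*` `]eps, 1%R]%classic) (y.2)%:E)
       - fine (\int[intensity lambda]_(y in A `*` `]eps, 1%R]%classic) (y.2)%:E))
    Y.

Definition is_levy_basis (m : R) lambda mu Lambda :=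
  forall A, finite_area A ->
    exists2 Y : {RV P >-> mR}, is_compensated_integral lambda mu A Y &
      {ae P, forall w, Lambda A w =
         m * fine (leb2 A) + Y w
         + fine (\int[mu w]_(y in A `*` `]1%R, +oo[%classic) (y.2)%:E)}.

Definition simple_integral Lambda (A : set (mR * mR))
    (f : {sfun (mR * mR)%type >-> mR}) (w : Omega) : R :=
  \sum_(r \in range f) r * Lambda (A `&` f @^-1` [set r]) w.

(* Rajput-Rosinski integral of [f] over [D] with respect to [Lambda]; it is
   determined up to almost sure equality. Convergence Lambda-a.e. is taken as
   Lebesgue-a.e., the control measure of Lambda being a multiple of Lebesgue
   measure. *)
Definition is_integral Lambda (D : set (mR * mR)) (f : mR * mR -> R)
    (Y : {RV P >-> mR}) :=
  exists f_ : nat -> {sfun (mR * mR)%type >-> mR},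
    [/\ measurable_fun D f,
        forall n, finite_area (f_ n @^-1` [set~ 0]),
        {ae (@lebesgue_measure R \x @lebesgue_measure R)%E,
           forall y, D y -> f_ n y @[n --> \oo] --> f y},
        forall A, measurable A -> A `<=` D ->
          exists Z : {RV P >-> mR},
            cvg_in_prob \oo (fun n => simple_integral Lambda A (f_ n)) Z
      & cvg_in_prob \oo (fun n => simple_integral Lambda D (f_ n)) Y].

Definition trawl_process Lambda (a : R -> R) (X : R -> {RV P >-> mR}) :=
  forall t : R,
    is_integral Lambda (`[0%R, +oo[%classic `*` `]-oo, t]%classic)
      (\1_[set y | 0 <= y.1 <= a (t - y.2)]) (X t).

Definition modification (X Y : R -> {RV P >-> mR}) :=
  forall t : R, P [set w | X t w = Y t w] = 1%E.

End random_measures.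

(* Main.v *)
Require Import Defs.
From HB Require Import structures.
From mathcomp Require Import finmap.
From mathcomp Require Import all_boot all_order all_algebra.
From mathcomp Require Import all_classical all_reals all_analysis.
From mathcomp Require Import measurable_realfun.
From mathcomp Require Import zify ring lra.

Import Order.TTheory GRing.Theory Num.Theory.
Import numFieldNormedType.Exports.
Import HBSimple.

(** The integrand of X t is the indicator of the trawl set
    A_t = {(x, s) : s <= t, 0 <= x <= a (t - s)}, whose area is finite, and
    almost surely X t = Lambda A_t ([trawl_process_Lambda]). For t in a unit
    interval [K, K + 1] the set A_t is a difference of two sets I_t and O_t of
    finite area that increase with t: as a is bounded by a 0, everything that
    enters after the time K lies in [0, a 0] x ]K, t], so I_t can be the union of
    A_K and this rectangle, and O_t is the part of I_t that has left by the time
    t. So it is enough to find a cadlag version of t |-> Lambda B_t when B is a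
    nondecreasing family of sets of finite area, right-continuous up to null sets
    ([nondecreasing_family_path]), and to glue the versions at the integers. The
    family I is right-continuous; for O the set gained in a right limit meets
    each line with fixed x in at most one point, because a is non-increasing
    ([outflow_right_null]).

    By the Levy-Ito decomposition Lambda B_t is the sum of a drift, of the
    jumps above 1 and of a limit in probability of compensated jump sums
    truncated at eps. The drift, the big jumps and the truncated jump sums are
    differences of monotone right-continuous functions of t. For the limit eps
    -> 0 to be uniform in t one needs a maximal inequality for the jumps in
    ]a, b] ([maximal_path]). Over disjoint sets compensated jump sums are
    independent and centred, so Ottaviani's inequality bounds the maximum over
    every grid of times by a multiple of the area times the integral of z ^ 2
    over ]a, b], and right-continuity extends this to all times. The
    Borel-Cantelli lemma gives uniform convergence along suitable truncation
    levels ([levy_path]). The Poisson hypothesis speaks of masses only; it is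
    transferred to jump sums by Riemann sums over thin slabs of marks
    ([mark_riemann], [maximal_jumps]).

    That the integral of an indicator is the value of Lambda has to be proved
    for every admissible sequence f_ n of simple functions. Simple integrals over
    a set of finite area are small in probability as soon as the integrals of
    f ^ 2 and |f| are ([Lambda_small], [discrepancy_small]). Where f_ n
    converges with a uniform bound this settles the matter; the rest of the
    domain is treated by a gliding hump, which relies on the convergence of the
    simple integrals over every measurable subset ([integral_indicator]). *)

Set Implicit Arguments.
Unset Strict Implicit.
Unset Printing Implicit Defensive.

Local Open Scope classical_set_scope.
Local Open Scope ring_scope.

(** * Masses of a Poisson random measure *)

Section poisson_moments.
Context {R : realType}.
Implicit Types (r : R) (k : nat).

Lemma poisson_prob_succ r k : 0 <= r ->
  (k.+1%:R%:E * poisson_prob r k.+1 [set k.+1] =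
   r%:E * poisson_prob r k [set k])%E.
Proof.
move=> r_ge0; have [->|r_neq0] := eqVneq r 0.
  rewrite mul0e /poisson_prob ltxx /= diracE memNset ?mule0//=.
have r0 : 0 < r by rewrite lt_neqAle eq_sym r_neq0.
rewrite /poisson_prob r0 !esum_set1 ?lee_fin ?poisson_pmf_ge0//.
rewrite -!EFinM /poisson_pmf r0; congr EFin.
rewrite factS natrM invfM exprS !mulrA; congr (_ * _ * _).
by field.
Qed.

Lemma poisson_prob_total r : (\sum_(k <oo) poisson_prob r k [set k] = 1)%E.
Proof.
have -> : (1 = poisson_prob r 0 (\bigcup_k [set k]))%E.
  rewrite -[LHS](probability_setT (poisson_prob r 0)); congr (poisson_prob _ _ _).
  by apply/seteqP; split=> // k _; exists k.
rewrite measure_bigcup//; last by move=> i j _ _ [x [/= -> ->]].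
by apply: eq_eseriesl => k; rewrite in_setT.
Qed.

Lemma poisson_prob_mean r : 0 <= r ->
  (\sum_(k <oo) k%:R%:E * poisson_prob r k [set k] = r%:E)%E.
Proof.
move=> r0; rewrite nneseries_recl//; last first.
  by move=> k _; rewrite mule_ge0.
rewrite mul0e add0e -(@nneseries_addn _ _ 1)//; last first.
  by move=> k; rewrite mule_ge0.
under eq_eseriesr do rewrite addn1 poisson_prob_succ//.
by rewrite nneseriesZl// poisson_prob_total mule1.
Qed.

Lemma poisson_prob_sqr r : 0 <= r ->
  (\sum_(k <oo) (k%:R ^+ 2)%:E * poisson_prob r k [set k] = (r + r ^+ 2)%:E)%E.
Proof.
move=> r0; rewrite nneseries_recl//; last first.
  by move=> k _; rewrite mule_ge0.
rewrite expr0n/= mul0e add0e -(@nneseries_addn _ _ 1)//; last first.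
  by move=> k; rewrite mule_ge0.
under eq_eseriesr.
  move=> k _; rewrite addn1 expr2 EFinM -muleA poisson_prob_succ// muleCA.
  rewrite -natr1 EFinD ge0_muleDl// mul1e; over.
rewrite nneseriesZl//; last by move=> k _; rewrite adde_ge0// mule_ge0.
rewrite nneseriesD//; last by move=> k _; rewrite mule_ge0.
by rewrite poisson_prob_mean// poisson_prob_total -EFinD -EFinM mulrDr mulr1 addrC.
Qed.

End poisson_moments.

Section poisson_law.
Context {d : measure_display} {Omega : measurableType d} {R : realType}.
Variables (P : probability Omega R) (Z : Omega -> \bar R) (r : R).
Hypothesis mZ : measurable_fun setT Z.
Hypothesis r0 : 0 <= r.
Hypothesis Zlaw : forall k : nat,
  P [set w | Z w = k%:R%:E] = poisson_prob r k [set k].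

Let F k := [set w | Z w = k%:R%:E].

Let mF k : measurable (F k).
Proof.
rewrite (_ : F k = Z @^-1` [set k%:R%:E])//.
by rewrite -[_ @^-1` _]setTI; exact: mZ.
Qed.

Let tF : trivIset setT F.
Proof.
move=> i j _ _ [w []]; rewrite /F /= => -> [] /eqP; rewrite eqr_nat => /eqP.
exact.
Qed.

Let PF : P (~` \bigcup_k F k) = 0%E.
Proof.
rewrite probability_setC; last exact: bigcupT_measurable.
rewrite measure_bigcup//.
rewrite (_ : (\sum_(_ <oo | _) _)%E = 1%E) ?subee//.
rewrite -(poisson_prob_total r).
rewrite (eq_eseriesr (fun k _ => Zlaw k)).
by apply: eq_eseriesl => k; rewrite in_setT.
Qed.

Lemma poisson_law_nat : {ae P, forall w, exists k : nat, Z w = k%:R%:E}.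
Proof.
exists (~` \bigcup_k F k); split => //.
  by apply: measurableC; exact: bigcupT_measurable.
by move=> w /= Zw [k _ Fk]; apply: Zw; exists k.
Qed.

(** The law charges only the natural numbers, so the integral splits over the
    events Z = k up to a null set. *)
Lemma poisson_law_integral (g : R -> R) : measurable_fun setT g ->
  (forall x, 0 <= g x) ->
  (\int[P]_w (g (fine (Z w)))%:E =
   \sum_(k <oo) (g k%:R)%:E * poisson_prob r k [set k])%E.
Proof.
move=> mg g0.
have mgZ : measurable_fun setT (fun w => (g (fine (Z w)))%:E).
  apply/measurable_EFinP; apply: measurableT_comp => //.
  exact: measurableT_comp.
have mUF : measurable (~` \bigcup_k F k).
  by apply: measurableC; exact: bigcupT_measurable.
have gZ0 w : setT w -> (0%R <= (g (fine (Z w)))%:E)%E by rewrite lee_fin.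
rewrite (@ge0_negligible_integral _ _ _ P setT (~` \bigcup_k F k))//.
have mgU : measurable_fun (\bigcup_k F k) (fun w => (g (fine (Z w)))%:E).
  exact: measurable_funTS.
rewrite setTD setCK ge0_integral_bigcup//; last by move=> w _; rewrite lee_fin.
apply: eq_eseriesr => k _.
transitivity (\int[P]_(w in F k) cst (g k%:R)%:E w)%E.
  by apply: eq_integral => w; rewrite inE => ->.
by rewrite integral_cst// -(Zlaw k).
Qed.

Lemma poisson_law_mean : (\int[P]_w (fine (Z w))%:E = r%:E)%E.
Proof.
transitivity (\int[P]_w (`|fine (Z w)|)%:E)%E.
  apply: ae_eq_integral => //.
  - by apply/measurable_EFinP; exact: measurableT_comp.
  - by apply/measurable_EFinP; apply: measurableT_comp => //; exact: measurableT_comp.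
  - by move: poisson_law_nat; apply: filterS => w [k ->] _ /=; rewrite ger0_norm.
rewrite (@poisson_law_integral (fun x => `|x|))//.
by rewrite -[RHS]poisson_prob_mean//; apply: eq_eseriesr => k _; rewrite ger0_norm.
Qed.

Lemma poisson_law_sqr : (\int[P]_w (fine (Z w) ^+ 2)%:E = (r + r ^+ 2)%:E)%E.
Proof.
rewrite (@poisson_law_integral (fun x => x ^+ 2))//; last by move=> x; exact: sqr_ge0.
exact: poisson_prob_sqr.
Qed.

Lemma poisson_law_neq0 : (P [set w | Z w != 0%R%:E] <= r%:E)%E.
Proof.
have -> : [set w | Z w != 0%R%:E] = ~` F 0%N.
  by apply/seteqP; split => w /= /eqP.
rewrite probability_setC// Zlaw /poisson_prob; case: ifPn => [rp|].
  rewrite esum_set1 ?lee_fin ?poisson_pmf_ge0// /poisson_pmf rp.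
  rewrite expr0 fact0 invr1 !mul1r.
  by rewrite lerBlDr addrC -lerBlDr; exact: expR_ge1Dx.
by move=> _; rewrite diracE mem_set//= subee.
Qed.

End poisson_law.

Section prm_moments.
Context {d d' : measure_display} {Omega : measurableType d}
  {T : measurableType d'} {R : realType}.
Variables (P : probability Omega R) (E : set T).
Variables (nu : {measure set T -> \bar R}) (mu : R.-ker Omega ~> T).
Hypothesis Hmu : poisson_random_measure P E nu mu.

(** The sets whose mass has a Poisson law with finite parameter. *)
Definition thin (B : set T) := [/\ measurable B, B `<=` E & (nu B < +oo)%E].

Definition mass (B : set T) (w : Omega) : R := fine (mu w B).

Lemma measurable_mass B : measurable B -> measurable_fun setT (mass B).
Proof. by move=> mB; apply: measurableT_comp => //; exact: measurable_kernel. Qed.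

Lemma thinU A B : thin A -> thin B -> thin (A `|` B).
Proof.
move=> [mA AE nA] [mB BE nB]; split; first exact: measurableU.
  by rewrite subUset.
by rewrite (le_lt_trans (measureU2 _ _ _))// lte_add_pinfty.
Qed.

Lemma thin_fin B : thin B -> nu B \is a fin_num.
Proof. by move=> [? ? ?]; rewrite ge0_fin_numE. Qed.

Lemma prm_nat B : thin B -> {ae P, forall w, exists k : nat, mu w B = k%:R%:E}.
Proof.
move=> [mB BE nB]; apply: (@poisson_law_nat _ _ _ P _ (fine (nu B))).
  exact: measurable_kernel.
by move=> k; case: Hmu => + _ _; apply.
Qed.

Lemma prm_finite B : thin B -> {ae P, forall w, (mu w B < +oo)%E}.
Proof.
by move=> /prm_nat; apply: filterS => w [k ->]; rewrite ltry.
Qed.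

Lemma prm_mean B : thin B -> (\int[P]_w (mass B w)%:E = nu B)%E.
Proof.
move=> tB; have [mB BE nB] := tB; rewrite (@poisson_law_mean _ _ _ P _ (fine (nu B))).
- by rewrite fineK// thin_fin.
- exact: measurable_kernel.
- exact: fine_ge0.
- by move=> k; case: Hmu => + _ _; apply.
Qed.

Lemma prm_sqr B : thin B ->
  (\int[P]_w (mass B w ^+ 2)%:E = (fine (nu B) + fine (nu B) ^+ 2)%:E)%E.
Proof.
move=> [mB BE nB]; apply: poisson_law_sqr.
- exact: measurable_kernel.
- exact: fine_ge0.
- by move=> k; case: Hmu => + _ _; apply.
Qed.

Lemma prm_neq0 B : thin B -> (P [set w | mu w B != 0%R%:E] <= nu B)%E.
Proof.
move=> tB; have [mB BE nB] := tB.
rewrite -(fineK (thin_fin tB)); apply: poisson_law_neq0.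
- exact: measurable_kernel.
- exact: fine_ge0.
- by move=> k; case: Hmu => + _ _; apply.
Qed.

Lemma mass_ge0 B w : 0 <= mass B w.
Proof. exact: fine_ge0. Qed.

Lemma integrable_mass B : thin B -> P.-integrable setT (EFin \o mass B).
Proof.
move=> tB; have [mB BE nB] := tB; apply/integrableP; split.
  by apply/measurable_EFinP; exact: measurable_mass.
rewrite (eq_integral (fun w => (mass B w)%:E)) ?prm_mean//.
by move=> w _ /=; rewrite ger0_norm// mass_ge0.
Qed.

Lemma integrable_mass_sqr B : thin B ->
  P.-integrable setT (EFin \o (fun w => mass B w ^+ 2)).
Proof.
move=> tB; have [mB BE nB] := tB; apply/integrableP; split.
  apply/measurable_EFinP; apply: measurable_funX; exact: measurable_mass.
rewrite (eq_integral (fun w => (mass B w ^+ 2)%:E)) ?prm_sqr ?ltry//.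
by move=> w _ /=; rewrite ger0_norm// sqr_ge0.
Qed.

Lemma integrable_massM A B : thin A -> thin B ->
  P.-integrable setT (EFin \o (fun w => mass A w * mass B w)).
Proof.
move=> tA tB; have [mA AE nA] := tA; have [mB BE nB] := tB.
apply: (@le_integrable _ _ _ P setT _ _
  (EFin \o (fun w => mass A w ^+ 2 + mass B w ^+ 2))) => //.
- apply/measurable_EFinP.
  by apply: measurable_funM; exact: measurable_mass.
- move=> w _ /=; rewrite lee_fin !ger0_norm ?addr_ge0 ?sqr_ge0 ?mulr_ge0 ?mass_ge0//.
  by have := sqr_ge0 (mass A w - mass B w); have := mass_ge0 A w;
    have := mass_ge0 B w; nra.
- rewrite (_ : _ \o _ = (EFin \o (fun w => mass A w ^+ 2)) \+
    (EFin \o (fun w => mass B w ^+ 2))) //.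
  by apply: integrableD => //; exact: integrable_mass_sqr.
Qed.

(** Polarization: the masses of A, of B and of their union have Poisson laws, so
    that the three second moments are known, and the mixed moment is determined
    by them. *)
Lemma prm_covariance A B : thin A -> thin B -> A `&` B = set0 ->
  \int[P]_w (mass A w * mass B w) = fine (nu A) * fine (nu B).
Proof.
move=> tA tB AB0; have [mA AE nA] := tA; have [mB BE nB] := tB.
have tU := thinU tA tB.
have iA := integrable_mass_sqr tA; have iB := integrable_mass_sqr tB.
have iU := integrable_mass_sqr tU; have iAB := integrable_massM tA tB.
have iAB2 : P.-integrable setT (EFin \o (fun w => 2 * (mass A w * mass B w))).
  exact: (integrableZl measurableT 2 iAB).
have : \int[P]_w (mass (A `|` B) w ^+ 2) =
    \int[P]_w ((mass A w ^+ 2 + mass B w ^+ 2) + 2 * (mass A w * mass B w)).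
  congr fine; apply: ae_eq_integral => //.
  - by case/integrableP : iU.
  - apply/measurable_EFinP; apply: measurable_funD; last by case/integrableP : iAB2 => /measurable_EFinP.
    apply: measurable_funD.
      by case/integrableP : iA => /measurable_EFinP.
    by case/integrableP : iB => /measurable_EFinP.
  - move: (prm_finite tA) (prm_finite tB).
    apply: filterS2 => w fA fB _; congr EFin.
    rewrite /mass measureU// fineD ?ge0_fin_numE//; ring.
rewrite RintegralD//; last first.
  rewrite (_ : _ \o _ = (EFin \o (fun w => mass A w ^+ 2)) \+
    (EFin \o (fun w => mass B w ^+ 2)))//.
  exact: integrableD.
rewrite RintegralD// RintegralZl// /Rintegral !prm_sqr//= measureU//.
rewrite fineD ?thin_fin//.
move=> h.
nra.
Qed.

End prm_moments.

(** * Ottaviani's inequality for centred Poisson masses *)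

Section real_integrable.
Context {d : measure_display} {Omega : measurableType d} {R : realType}.
Variable P : {measure set Omega -> \bar R}.

Lemma Rintegral_sum (I : Type) (s : seq I) (f : I -> Omega -> R) :
  (forall i, P.-integrable setT (EFin \o f i)) ->
  P.-integrable setT (EFin \o (fun w => \sum_(i <- s) f i w)) /\
  \int[P]_w (\sum_(i <- s) f i w) = \sum_(i <- s) \int[P]_w f i w.
Proof.
move=> fi; elim: s => [|i s [IH1 IH2]].
  rewrite (_ : (fun w => _) = cst 0); last by apply/funext => w; rewrite big_nil.
  split; first exact: integrable0.
  by rewrite /Rintegral integral0 big_nil.
rewrite (_ : (fun w => _) = (fun w => f i w + \sum_(i <- s) f i w)); last first.
  by apply/funext => w; rewrite big_cons.
split; last by rewrite RintegralD// IH2 big_cons.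
exact: (integrableD measurableT (fi i) IH1).
Qed.

End real_integrable.

Section measurable_level_sets.
Context {d : measure_display} {T : measurableType d} {R : realType}.
Implicit Types (f : T -> R) (a : R).

Lemma measurable_level_ge f a : measurable_fun setT f ->
  measurable [set w | a <= f w].
Proof.
move=> mf; rewrite (_ : [set w | _] = setT `&` f @^-1` `[a, +oo[%classic).
  exact: mf.
by rewrite setTI; apply/seteqP; split => w /=; rewrite in_itv/= andbT.
Qed.

Lemma measurable_level_gt f a : measurable_fun setT f ->
  measurable [set w | a < f w].
Proof.
move=> mf; rewrite (_ : [set w | _] = setT `&` f @^-1` `]a, +oo[%classic).
  exact: mf.
by rewrite setTI; apply/seteqP; split => w /=; rewrite in_itv/= andbT.
Qed.

Lemma measurable_level_lt f a : measurable_fun setT f ->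
  measurable [set w | f w < a].
Proof.
move=> mf; rewrite (_ : [set w | _] = setT `&` f @^-1` `]-oo, a[%classic).
  exact: mf.
by rewrite setTI; apply/seteqP; split => w /=; rewrite in_itv/=.
Qed.

Lemma measurable_first_passage (S : nat -> T -> R) a k :
  (forall j, (j <= k)%N -> measurable_fun setT (S j)) ->
  measurable ([set w | a <= `|S k w|] `&`
    \bigcap_(j in `I_k) [set w | `|S j w| < a]).
Proof.
move=> mS; apply: measurableI.
  by apply: measurable_level_ge; apply: measurableT_comp => //; exact: mS.
apply: fin_bigcap_measurable; first exact: finite_II.
move=> j /= jk; apply: measurable_level_lt.
by apply: measurableT_comp => //; apply: mS; exact: ltnW.
Qed.

Lemma markov_ge (m : {measure set T -> \bar R}) f a : 0 < a ->
  measurable_fun setT f -> (forall w, 0 <= f w) ->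
  (a%:E * m [set w | (a <= f w)%R] <= \int[m]_w (f w)%:E)%E.
Proof.
move=> a0 mf f0.
have mA := measurable_level_ge a mf.
rewrite -integral_cst//.
apply: (@le_trans _ _ (\int[m]_(w in [set w | (a <= f w)%R]) (f w)%:E)%E).
  apply: ge0_le_integral => //.
  - by move=> w _; rewrite lee_fin ltW.
  - by apply/measurable_EFinP; exact: measurable_funTS.
apply: ge0_subset_integral => //; first exact/measurable_EFinP.
by move=> w _; rewrite lee_fin.
Qed.

End measurable_level_sets.

Section independence.
Context {d : measure_display} {Omega : measurableType d} {R : realType}.
Variable P : probability Omega R.

(** As functions of A both sides are finite measures, and they agree on a
    pi-system that generates the sigma-algebra. *)
Lemma independent_sigma_algebra (G : set (set Omega)) (C : set Omega) :
  G `<=` measurable -> setI_closed G -> G setT -> measurable C ->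
  (forall A, G A -> P (A `&` C) = (P A * P C)%E) ->
  forall A, <<s G >> A -> P (A `&` C) = (P A * P C)%E.
Proof.
move=> Gm GI GT mC GC A sA.
have PC : P C \is a fin_num by exact: fin_num_measure.
pose c := NngNum (fine_ge0 (measure_ge0 P C)).
rewrite -[LHS]/(mrestr P mC A).
transitivity (mscale c P A).
  apply: (@g_sigma_algebra_measure_unique _ _ _ G Gm (fun=> setT)) => //.
  - by apply/seteqP; split => // x _; exists 0%N.
  - by move=> B GB; rewrite /= /mrestr /mscale/= /c/= fineK// muleC -GC.
  - by move=> _; rewrite /= /mrestr setTI ltey_eq PC.
by rewrite /mscale/= /c/= fineK// muleC.
Qed.

Context {n : nat}.
Variable Z : 'I_n -> Omega -> \bar R.
Hypothesis mZ : forall i, measurable_fun setT (Z i).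
Hypothesis Zindep : mutually_independent P Z.

Definition cylinder (Q : pred 'I_n) : set (set Omega) :=
  [set A | exists2 B : 'I_n -> set (\bar R), (forall i, measurable (B i)) &
    A = [set w | forall i, Q i -> B i (Z i w)]].

Lemma measurable_cylinder Q : cylinder Q `<=` measurable.
Proof.
move=> _ [B mB ->].
rewrite (_ : [set w | _] = \bigcap_(i in [set` Q]) (Z i @^-1` B i)); last first.
  by apply/seteqP; split.
apply: fin_bigcap_measurable; first exact: finite_finset.
by move=> i _; rewrite -[_ @^-1` _]setTI; exact: mZ.
Qed.

Lemma setI_cylinder Q : setI_closed (cylinder Q).
Proof.
move=> _ _ [A mA ->] [B mB ->]; exists (fun i => A i `&` B i).
  by move=> i; exact: measurableI.
apply/seteqP; split => w /=.
  by move=> [h1 h2] i Qi; split; [exact: h1|exact: h2].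
by move=> h; split => i Qi; have [] := h i Qi.
Qed.

Lemma cylinderT Q : cylinder Q setT.
Proof. by exists (fun=> setT) => //; apply/seteqP; split. Qed.

Lemma cylinder_preimage (Q : pred 'I_n) i B : Q i -> measurable B ->
  cylinder Q (Z i @^-1` B).
Proof.
move=> Qi mB; exists (fun j => if j == i then B else setT).
  by move=> j; case: ifP.
apply/seteqP; split => w /=.
  by move=> Bi j Qj; case: eqP => [->|].
by move=> /(_ i Qi); rewrite eqxx.
Qed.

Lemma probability_cylinder (Q : pred 'I_n) (B : 'I_n -> set (\bar R)) :
  (forall i, measurable (B i)) ->
  P [set w | forall i, Q i -> B i (Z i w)] =
    (\prod_(i < n | Q i) P (Z i @^-1` B i))%E.
Proof.
move=> mB; pose B' i := if Q i then B i else setT.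
rewrite (_ : [set w | _] = [set w | forall i, B' i (Z i w)]); last first.
  apply/seteqP; split => w /= h i; first by rewrite /B'; case: ifPn => // /h.
  by move=> Qi; have := h i; rewrite /B' Qi.
rewrite Zindep; last by move=> i; rewrite /B'; case: ifP.
rewrite (bigID Q)/= [X in (_ * X)%E]big1 ?mule1; last first.
  by move=> i /negbTE Qi; rewrite /B' Qi preimage_setT probability_setT.
by apply: eq_bigr => i Qi; rewrite /B' Qi.
Qed.

(** The product rule for cylinders extends in two steps, first to arbitrary
    events in the coordinates outside Q, then to arbitrary events in those of
    Q. *)
Lemma cylinder_independent Q A B :
  <<s cylinder Q >> A -> <<s cylinder (predC Q) >> B ->
  P (A `&` B) = (P A * P B)%E.
Proof.
move=> sA sB.
have mA : measurable A.
  by apply: (smallest_sub (@sigma_algebra_measurable _ Omega)) sA;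
    exact: measurable_cylinder.
rewrite setIC muleC.
apply: (independent_sigma_algebra (@measurable_cylinder (predC Q))) => //.
- exact: setI_cylinder.
- exact: cylinderT.
move=> C cC; rewrite setIC muleC.
have mC := measurable_cylinder cC.
apply: (independent_sigma_algebra (@measurable_cylinder Q)) => //.
- exact: setI_cylinder.
- exact: cylinderT.
move=> D [BD mBD ->]; case: cC => BC mBC ->.
rewrite !probability_cylinder//.
pose B' i := if Q i then BD i else BC i.
have mB' i : measurable (B' i) by rewrite /B'; case: ifP.
rewrite (_ : _ `&` _ = [set w | forall i, B' i (Z i w)]); last first.
  apply/seteqP; split => w /=.
    by move=> [h1 h2] i; rewrite /B'; case: ifPn => [/h1//|/h2].
  move=> h; split => i Qi; have := h i; rewrite /B'; first by rewrite Qi.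
  by rewrite (negbTE Qi).
rewrite Zindep// (bigID Q)/=; congr (_ * _)%E; apply: eq_bigr => i Qi.
  by rewrite /B' Qi.
by rewrite /B' (negbTE Qi).
Qed.

End independence.

Section maximal_inequality.
Context {d d' : measure_display} {Omega : measurableType d}
  {T : measurableType d'} {R : realType}.
Variables (P : probability Omega R) (E : set T).
Variables (nu : {measure set T -> \bar R}) (mu : R.-ker Omega ~> T).
Hypothesis Hmu : poisson_random_measure P E nu mu.
Variables (n : nat) (D : 'I_n -> set T).
Hypothesis tD : forall i, thin E nu (D i).
Hypothesis trivD : trivIset setT D.

Definition centred_mass (i : 'I_n) (w : Omega) : R :=
  mass mu (D i) w - fine (nu (D i)).

Local Notation X := centred_mass.

Let mD i : measurable (D i). Proof. by case: (tD i). Qed.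

Lemma centred_massM i j :
  P.-integrable setT (EFin \o (fun w => X i w * X j w)) /\
  \int[P]_w (X i w * X j w) = if i == j then fine (nu (D i)) else 0.
Proof.
have iN i' := integrable_mass Hmu (tD i').
have iNN : P.-integrable setT (EFin \o (fun w => mass mu (D i) w * mass mu (D j) w)).
  exact: (integrable_massM Hmu).
pose a k := fine (nu (D k)).
have iC r : P.-integrable setT (EFin \o cst r) by exact: finite_measure_integrable_cst.
have iZ (r : R) k : P.-integrable setT (EFin \o (fun w => r * mass mu (D k) w)).
  exact: (integrableZl measurableT r (iN k)).
have e : (fun w => X i w * X j w) = (fun w => (mass mu (D i) w * mass mu (D j) w
    + cst (a i * a j) w) - (a j * mass mu (D i) w + a i * mass mu (D j) w)).
  by apply/funext => w; rewrite /X /centred_mass -/(a i) -/(a j) /=; ring.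
have i1 := integrableD measurableT iNN (iC (a i * a j)).
have i2 := integrableD measurableT (iZ (a j) i) (iZ (a i) j).
rewrite e; split; first exact: (integrableB measurableT i1 i2).
have Ec : \int[P]_w (cst (a i * a j) w) = a i * a j.
  transitivity (fine ((a i * a j)%:E * P setT)%E); last by rewrite probability_setT mule1.
  by rewrite -integral_cst.
rewrite RintegralB// RintegralD// RintegralD// Ec !RintegralZl//.
have Em k : \int[P]_w (mass mu (D k) w) = a k by rewrite /Rintegral (prm_mean Hmu).
rewrite !Em.
case: eqVneq => [<-|ij].
  rewrite (_ : \int[P]_w _ = a i + a i ^+ 2); first by rewrite /a; ring.
  rewrite /Rintegral -[RHS]/(fine (a i + a i ^+ 2)%:E) -(prm_sqr Hmu (tD i)).
  by congr fine; apply: eq_integral => w _; rewrite expr2.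
rewrite (prm_covariance Hmu) ?/a//; first by ring.
by move/trivIsetP : trivD; apply.
Qed.

Lemma centred_mass_chebyshev (c : 'I_n -> R) (e : R) : 0 < e ->
  (P [set w | (e <= `|\sum_i c i * X i w|)%R] <=
   ((\sum_i c i ^+ 2 * fine (nu (D i))) / e ^+ 2)%:E)%E.
Proof.
move=> e0; pose f w := (\sum_i c i * X i w).
have mX i : measurable_fun setT (X i).
  by apply: measurable_funB => //; exact: measurable_mass.
have mf : measurable_fun setT f.
  by apply: measurable_sum => i; apply: measurable_funM.
have f2 : (fun w => f w ^+ 2) = (fun w => \sum_i \sum_j c i * c j * (X i w * X j w)).
  apply/funext => w; rewrite /f expr2 big_distrlr/=.
  by apply: eq_bigr => i _; apply: eq_bigr => j _; ring.
have iZ i j : P.-integrable setT (EFin \o (fun w => c i * c j * (X i w * X j w))).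
  exact: (integrableZl measurableT (c i * c j) (proj1 (centred_massM i j))).
have [i2 I2] : P.-integrable setT (EFin \o (fun w => f w ^+ 2)) /\
    \int[P]_w (f w ^+ 2) = \sum_i c i ^+ 2 * fine (nu (D i)).
  have h i := @Rintegral_sum _ _ _ P 'I_n (index_enum 'I_n) _ (iZ i).
  have [h1 h2] := @Rintegral_sum _ _ _ P 'I_n (index_enum 'I_n) _ (fun i => proj1 (h i)).
  rewrite f2; split => //; rewrite h2; apply: eq_bigr => i _.
  rewrite (proj2 (h i)) (bigD1 i)//= big1 ?addr0; last first.
    move=> j ji; have [iM eM] := centred_massM i j.
    by rewrite RintegralZl// eM eq_sym (negbTE ji) mulr0.
  by have [iM eM] := centred_massM i i; rewrite RintegralZl// eM eqxx expr2.
have -> : [set w | e <= `|\sum_i c i * X i w|] = [set w | e ^+ 2 <= f w ^+ 2].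
  apply/seteqP; split => w /=; rewrite -/(f w) -[f w ^+ 2]real_normK ?num_real//.
    by move=> h; rewrite lerXn2r ?nnegrE// ltW.
  by rewrite ler_pXn2r ?nnegrE// ltW.
have e2 : 0 < e ^+ 2 by rewrite exprn_gt0.
have IE : (\int[P]_w (f w ^+ 2)%:E)%E = (\sum_i c i ^+ 2 * fine (nu (D i)))%:E.
  by rewrite -I2 /Rintegral fineK//; exact: (integrable_fin_num measurableT i2).
have := markov_ge P e2 (measurable_funX 2 mf) (fun w => sqr_ge0 (f w)).
by rewrite IE -lee_pdivlMl// -EFinM mulrC.
Qed.

Definition partial_sum (c : 'I_n -> R) (k : nat) (w : Omega) : R :=
  \sum_(i < n | (i < k)%N) c i * X i w.

Local Notation Z := (fun i w => mu w (D i)).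

Let mZ i : measurable_fun setT (Z i).
Proof. exact: measurable_kernel. Qed.

Let indepZ : mutually_independent P Z.
Proof. by case: Hmu => _ _; apply => // i; case: (tD i). Qed.

(** A sum over S is measurable for the sigma-algebra of the coordinates in any Q
    that contains S: this separates the past of a partial sum from the
    remaining terms. *)
Lemma measurable_partial_sum_cylinder (Q : pred 'I_n) (c : 'I_n -> R) (S : pred 'I_n) :
  (forall i, S i -> Q i) ->
  measurable_fun (setT : set (g_sigma_algebraType (cylinder Z Q)))
    (fun w => \sum_(i < n | S i) c i * X i w : R).
Proof.
move=> SQ; rewrite (_ : (fun w => _) =
    (fun w => \sum_(i < n) if S i then c i * X i w else 0)); last first.
  by apply/funext => w; rewrite big_mkcond.
apply: measurable_sum => i; have [Si|_] := boolP (S i); last exact: measurable_cst.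
apply: measurable_funM => //; apply: measurable_funB => //.
apply: (@measurableT_comp _ _ _ _ _ _ (@fine R)) => //.
move=> _ B mB; rewrite setTI; apply: sub_sigma_algebra.
by apply: cylinder_preimage => //; exact: SQ.
Qed.

(** Let k be the first index at which the partial sum reaches 2 e. The sum of
    the remaining terms is independent of that event and, by Chebyshev, smaller
    than e with probability at least 1/2; in that case the total sum is at least
    e, an event to which Chebyshev applies once more. *)
Lemma ottaviani_inequality (c : 'I_n -> R) (e : R) : 0 < e ->
  (P [set w | exists2 k, (k <= n)%N & (2 * e <= `|partial_sum c k w|)%R] <=
   (2 * (\sum_i c i ^+ 2 * fine (nu (D i))) / e ^+ 2)%:E)%E.
Proof.
move=> e0; set V := \sum_i _.
have mX i : measurable_fun setT (X i).
  by apply: measurable_funB => //; exact: measurable_mass.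
have mSum (Q : pred 'I_n) : measurable_fun setT (fun w => \sum_(i < n | Q i) c i * X i w).
  rewrite (_ : (fun w => _) =
      (fun w => \sum_(i < n) if Q i then c i * X i w else 0)); last first.
    by apply/funext => w; rewrite big_mkcond.
  apply: measurable_sum => i; have [_|_] := boolP (Q i); last exact: measurable_cst.
  exact: measurable_funM.
have mS k : measurable_fun setT (partial_sum c k) by exact: mSum.
pose first k := [set w | 2 * e <= `|partial_sum c k w|] `&`
  \bigcap_(j in `I_k) [set w | `|partial_sum c j w| < 2 * e].
pose rest k := [set w | `|\sum_(i < n | ~~ (i < k)%N) c i * X i w| < e].
have mfirst k : measurable (first k).
  by apply: measurable_first_passage => j _.
have mrest k : measurable (rest k).
  by apply: measurable_level_lt; apply: measurableT_comp => //; exact: mSum.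
have firstE : [set w | exists2 k, (k <= n)%N & 2 * e <= `|partial_sum c k w|] =
    \big[setU/set0]_(k < n.+1) first k.
  rewrite -(bigcup_mkord n.+1 first); apply/seteqP; split => w /=; last first.
    by move=> [k /= kn [h _]]; exists k.
  move=> [k kn kw]; have exk : exists k, 2 * e <= `|partial_sum c k w| by exists k.
  have [j jw jmin] := ex_minnP exk.
  exists j => /=; first by rewrite ltnS (leq_trans (jmin _ kw)).
  split => // i /= ij; rewrite ltNge; apply/negP => /jmin.
  by rewrite leqNgt ij.
rewrite firstE.
(* If e ^+ 2 <= 2 * V the right-hand side is at least 1. *)
have [Vbig|Vsmall] := leP (e ^+ 2) (2 * V).
  apply: (le_trans (probability_le1 _ _)); first exact: bigsetU_measurable.
  by rewrite lee_fin ler_pdivlMr ?exprn_gt0// mul1r.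
pose Q k : pred 'I_n := fun i => (i < k)%N.
have sfirst k : <<s cylinder Z (Q k) >> (first k).
  apply: (@measurable_first_passage _ (g_sigma_algebraType (cylinder Z (Q k)))) => j jk.
  by apply: measurable_partial_sum_cylinder => i /leq_trans; apply.
have srest k : <<s cylinder Z (predC (Q k)) >> (rest k).
  apply: (@measurable_level_lt _ (g_sigma_algebraType (cylinder Z (predC (Q k))))).
  by apply: measurableT_comp => //; exact: measurable_partial_sum_cylinder.
have rest_half k : (2^-1%:E <= P (rest k))%E.
  rewrite -[rest k]setCK probability_setC; last exact: measurableC.
  have : (P (~` rest k) <= 2^-1%:E)%E.
    pose c' (i : 'I_n) : R := if (i < k)%N then 0 else c i.
    have restE : ~` rest k = [set w | e <= `|\sum_i c' i * X i w|].
      have c'E w : \sum_i c' i * X i w = \sum_(i < n | ~~ (i < k)%N) c i * X i w.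
        rewrite [RHS]big_mkcond; apply: eq_bigr => i _; rewrite /c'.
        by case: ifP; rewrite ?mul0r.
      apply/seteqP; split => w /=; rewrite /rest/= c'E => h.
        by rewrite leNgt; apply/negP.
      by apply/negP; rewrite -leNgt.
    rewrite restE.
    apply: (le_trans (centred_mass_chebyshev _ e0)).
    rewrite lee_fin ler_pdivrMr ?exprn_gt0//.
    rewrite ler_pdivlMl//; apply: le_trans (ltW Vsmall).
    rewrite ler_pM2l// /V; apply: ler_sum => i _; rewrite /c'; case: ifP => // _.
    by rewrite expr0n/= mul0r mulr_ge0 ?sqr_ge0// fine_ge0.
  have : P (~` rest k) \is a fin_num by apply: fin_num_measure; exact: measurableC.
  by case: (P (~` rest k)) => // r _; rewrite -EFinB !lee_fin; lra.
have tfirst : trivIset setT first.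
  move=> i j _ _ [w [[/= i1 i2] [/= j1 j2]]].
  case: (ltngtP i j) => // ij.
    by have := j2 i ij; rewrite /= ltNge i1.
  by have := i2 j ij; rewrite /= ltNge j1.
have indep k : (2^-1%:E * P (first k) <= P (first k `&` rest k))%E.
  rewrite (cylinder_independent mZ indepZ (sfirst k) (srest k)) muleC.
  by rewrite lee_wpmul2l.
rewrite measure_bigsetU//.
have : (2^-1%:E * \sum_(k < n.+1) P (first k) <= (V / e ^+ 2)%:E)%E.
  rewrite ge0_sume_distrr//.
  apply: (@le_trans _ _ (\sum_(k < n.+1) P (first k `&` rest k))%E).
    by apply: lee_sum => k _; exact: indep.
  rewrite -(measure_bigsetU P (F := fun k => first k `&` rest k)); last 2 first.
  - by move=> k; exact: measurableI.
  - exact: trivIset_setIr.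
  apply: le_trans (centred_mass_chebyshev c e0).
  apply: le_measure; rewrite ?inE.
  - by apply: bigsetU_measurable => k _; exact: measurableI.
  - by apply: measurable_level_ge; apply: measurableT_comp => //; exact: mSum.
  rewrite -(bigcup_mkord n.+1 (fun k => first k `&` rest k)) => w [k /= _ [[+ _]]].
  rewrite /rest/= => hA hB.
  rewrite (bigID (fun i : 'I_n => (i < k)%N))/= -/(partial_sum c k w).
  move: hA hB; set A := partial_sum _ _ _; set B := \sum_(i < n | _) _ => hA hB.
  by have := ler_normB (A + B) B; rewrite addrK; lra.
by rewrite lee_pdivrMl// -EFinM mulrA.
Qed.

End maximal_inequality.

(** * Integrals of the marks, and Levy measures *)

Lemma le_measureS {d} {T : measurableType d} {R : realType}
    (m : {measure set T -> \bar R}) (A B : set T) :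
  measurable A -> measurable B -> A `<=` B -> (m A <= m B)%E.
Proof. by move=> mA mB AB; apply: le_measure; rewrite ?inE. Qed.

(** Product measures want sigma-finiteness as a structure; here it comes as a
    proof. *)
Definition sigma_finite_copy {d} {T : measurableType d} {R : realType}
    (m : {measure set T -> \bar R}) (sf : sigma_finite setT m) : set T -> \bar R := m.

Section sigma_finite_copy.
Context {d} {T : measurableType d} {R : realType}
  (m : {measure set T -> \bar R}) (sf : sigma_finite setT m).
HB.instance Definition _ := Measure.copy (sigma_finite_copy sf) m.
HB.instance Definition _ :=
  @Measure_isSigmaFinite.Build d T R (sigma_finite_copy sf) sf.
End sigma_finite_copy.

Section marks.
Context {d : measure_display} {X : measurableType d} {R : realType}.
Local Notation mR := (measurableTypeR R).
Implicit Types (kappa : {measure set (X * mR) -> \bar R}) (B : set (X * mR)).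

Definition mark (kappa : set (X * mR) -> \bar R) B : \bar R :=
  (\int[kappa]_(y in B) (y.2)%:E)%E.

Definition marked B := measurable B /\ forall y, B y -> 0 <= y.2.

Lemma measurable_mark_fun B : measurable_fun B (fun y : X * mR => (y.2 : R)%:E).
Proof.
apply/measurable_EFinP; apply: measurable_funTS; exact: measurable_snd.
Qed.

Lemma mark_ge0 kappa B : marked B -> (0 <= mark kappa B)%E.
Proof. by move=> [_ B0]; apply: integral_ge0 => y /B0; rewrite lee_fin. Qed.

Lemma mark_setU kappa A B : marked A -> marked B -> A `&` B = set0 ->
  (mark kappa (A `|` B) = mark kappa A + mark kappa B)%E.
Proof.
move=> [mA A0] [mB B0] AB0; rewrite /mark ge0_integral_setU//.
- exact: measurable_mark_fun.
- by move=> y [/A0|/B0]; rewrite lee_fin.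
- by rewrite disj_set2E AB0.
Qed.

Lemma le_mark kappa A B : marked B -> measurable A -> A `<=` B ->
  (mark kappa A <= mark kappa B)%E.
Proof.
move=> [mB B0] mA AB; apply: ge0_subset_integral => //.
exact: measurable_mark_fun.
Qed.

Lemma mark_le kappa B (c : R) : marked B -> 0 <= c ->
  (forall y, B y -> y.2 <= c) -> (mark kappa B <= c%:E * kappa B)%E.
Proof.
move=> [mB B0] c0 Bc; rewrite -integral_cst//; apply: ge0_le_integral => //.
exact: measurable_mark_fun.
Qed.

Lemma mark_ge kappa B (c : R) : marked B -> 0 <= c ->
  (forall y, B y -> c <= y.2) -> (c%:E * kappa B <= mark kappa B)%E.
Proof.
move=> [mB B0] c0 Bc; rewrite -integral_cst//; apply: ge0_le_integral => //.
exact: measurable_mark_fun.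
Qed.

Lemma mark_null kappa B : measurable B -> kappa B = 0%E -> mark kappa B = 0%E.
Proof.
by move=> mB B0; apply: null_set_integral => //; exact: measurable_mark_fun.
Qed.

Lemma measurable_mark {d' : measure_display} {Omega : measurableType d'}
    (mu : R.-ker Omega ~> (X * mR)%type) B : marked B ->
  measurable_fun setT (fun w => mark (mu w) B).
Proof.
move=> [mB B0].
rewrite (_ : (fun w => _) = (fun w => \int[mu w]_y
    ((fun y : X * mR => (y.2 : R)%:E) \_ B) y)%E); last first.
  by apply/funext => w; exact: integral_mkcond.
apply: measurable_fun_integral_kernel.
- by move=> U mU; exact: measurable_kernel.
- by move=> y; rewrite patchE; case: ifPn => //; rewrite inE lee_fin; exact: B0.
- apply/(measurable_restrictT _ mB); exact: measurable_mark_fun.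
Qed.

Definition slab (A : set X) (a b : R) : set (X * mR) := A `*` `]a, b]%classic.

Definition big_slab (A : set X) (a : R) : set (X * mR) := A `*` `]a, +oo[%classic.

Lemma measurable_slab A a b : measurable A -> measurable (slab A a b).
Proof. by move=> mA; exact: measurableX. Qed.

Lemma measurable_big_slab A a : measurable A -> measurable (big_slab A a).
Proof. by move=> mA; exact: measurableX. Qed.

Lemma marked_slab (A : set X) (a b : R) : measurable A -> 0 <= a ->
  marked (slab A a b).
Proof.
move=> mA a0; split; first exact: measurable_slab.
by move=> y [_ /=]; rewrite in_itv/= => /andP[ay _]; rewrite (le_trans a0)// ltW.
Qed.

Lemma marked_big_slab (A : set X) (a : R) : measurable A -> 0 <= a ->
  marked (big_slab A a).
Proof.
move=> mA a0; split; first exact: measurableX.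
by move=> y [_ /=]; rewrite in_itv/= andbT => ay; rewrite (le_trans a0)// ltW.
Qed.

Lemma mark_slab_finite kappa (A : set X) (a b : R) : measurable A -> 0 <= a ->
  (kappa (slab A a b) < +oo)%E ->
  (mark kappa (slab A a b) < +oo)%E.
Proof.
move=> mA a0 fin; have [b0|b0] := leP 0 b; last first.
  rewrite /slab set_itv_ge ?bnd_simp -?leNgt ?(le_trans (ltW b0))//.
  by rewrite setX0 /mark integral_set0.
apply: (le_lt_trans (mark_le _ (marked_slab b mA a0) b0 _)).
  by move=> y [_ /=]; rewrite in_itv/= => /andP[].
by rewrite lte_mul_pinfty.
Qed.

Lemma slab_split (A : set X) (a b c : R) : a <= b -> b <= c ->
  slab A a c = slab A a b `|` slab A b c /\ slab A a b `&` slab A b c = set0.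
Proof.
move=> ab bc.
have sE u v y : slab A u v y <-> A y.1 /\ u < y.2 <= v by rewrite /slab /= in_itv.
split; apply/seteqP; split => // y.
- move=> /sE[Ay /andP[ay yc]]; have [yb|yb] := leP y.2 b.
    by left; apply/sE; rewrite ay yb.
  by right; apply/sE; rewrite yb yc.
- move=> [/sE|/sE] [Ay /andP[ay yb]]; apply/sE; split => //.
    by rewrite ay (le_trans yb).
  by rewrite yb (le_lt_trans ab).
- move=> [/sE[_ /andP[_ yb]] /sE[_ /andP[yb']]].
  by rewrite ltNge yb in yb'.
Qed.

(** On each of the n slabs of width h the mark exceeds the left end by at most
    h. Integrals of the mark are thereby approximated by weighted sums of
    masses, whose joint law is known. *)
Lemma mark_riemann kappa (A : set X) (a h : R) (n : nat) : measurable A ->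
  0 <= a -> 0 <= h -> (kappa (slab A a (a + h * n%:R)) < +oo)%E ->
  let Z l := slab A (a + h * l%:R) (a + h * l.+1%:R) in
  let W k := slab A a (a + h * k%:R) in
  0 <= fine (mark kappa (W n)) - \sum_(l < n) (a + h * l%:R) * fine (kappa (Z l)) /\
  fine (mark kappa (W n)) - \sum_(l < n) (a + h * l%:R) * fine (kappa (Z l))
    <= h * fine (kappa (W n)).
Proof.
move=> mA a0 h0 fin Z W.
have mW k : measurable (W k) by exact: measurable_slab.
have mZ k : measurable (Z k) by exact: measurable_slab.
have al0 l : 0 <= a + h * l%:R by rewrite addr_ge0// mulr_ge0.
have WS k : W k.+1 = W k `|` Z k /\ W k `&` Z k = set0.
  apply: slab_split; first by rewrite lerDl mulr_ge0.
  by rewrite lerD2l ler_wpM2l// ler_nat.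
have mkW k : marked (W k) by exact: marked_slab.
have mkZ k : marked (Z k) by exact: marked_slab.
have WW k l : (k <= l)%N -> W k `<=` W l.
  move=> kl [x z] [/= Ax]; rewrite !in_itv/= => /andP[az zk]; split => //=.
  by rewrite in_itv/= az (le_trans zk)// lerD2l ler_wpM2l// ler_nat.
suff H k : (k <= n)%N ->
    0 <= fine (mark kappa (W k)) - \sum_(l < k) (a + h * l%:R) * fine (kappa (Z l)) /\
    fine (mark kappa (W k)) - \sum_(l < k) (a + h * l%:R) * fine (kappa (Z l))
    <= h * fine (kappa (W k)) by exact: H.
elim: k => [_|k IH kn].
  rewrite big_ord0 subr0 /W mulr0 addr0 /slab set_itv_ge ?bnd_simp ?ltxx// setX0.
  by rewrite /mark integral_set0 measure0/= mulr0 lexx; split.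
have finW : (kappa (W k.+1) < +oo)%E.
  exact: (le_lt_trans (le_measureS kappa (mW k.+1) (mW n) (WW _ _ kn))).
have [WE W0] := WS k.
have fZ : kappa (Z k) \is a fin_num.
  rewrite ge0_fin_numE// (le_lt_trans _ finW)// le_measureS// WE; exact: subsetUr.
have fW : kappa (W k) \is a fin_num.
  rewrite ge0_fin_numE// (le_lt_trans _ finW)// le_measureS// WE; exact: subsetUl.
have fmW : mark kappa (W k) \is a fin_num.
  by rewrite ge0_fin_numE ?mark_ge0// mark_slab_finite// -/(W k) -ge0_fin_numE.
have fmZ : mark kappa (Z k) \is a fin_num.
  by rewrite ge0_fin_numE ?mark_ge0// mark_slab_finite// -/(Z k) -ge0_fin_numE.
rewrite big_ord_recr/= WE mark_setU// measureU// (fineD fW fZ) (fineD fmW fmZ).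
have [IH1 IH2] := IH (ltnW kn).
have lo : (a + h * k%:R) * fine (kappa (Z k)) <= fine (mark kappa (Z k)).
  rewrite -lee_fin EFinM !fineK//; apply: mark_ge => //.
  by move=> y [_ /=]; rewrite in_itv/= => /andP[/ltW].
have hi : fine (mark kappa (Z k)) <= (a + h * k%:R + h) * fine (kappa (Z k)).
  rewrite -lee_fin EFinM !fineK//; apply: mark_le => //.
    by rewrite addr_ge0.
  move=> y [_ /=]; rewrite in_itv/= => /andP[_ /le_trans]; apply.
  by rewrite -natr1; lra.
move: IH1 IH2 lo hi; set s := \sum_(l < k) _.
by move=> IH1 IH2 lo hi; split; lra.
Qed.

End marks.

(** Pairs (i, l) with l < p are numbered by i * p + l, which turns the cells of
    a partition into a single sequence. *)
Lemma sum_divn_modn (V : nmodType) (n p : nat) (F : nat -> nat -> V) : (0 < p)%N ->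
  \sum_(j < n * p) F (j %/ p)%N (j %% p)%N = \sum_(i < n) \sum_(l < p) F i l.
Proof.
move=> p0; elim: n => [|n IH]; first by rewrite !big_ord0.
rewrite mulSn addnC big_split_ord big_ord_recr/= IH; congr (_ + _).
by apply: eq_bigr => l _; rewrite divnMDl// divn_small// addn0 modnMDl modn_small.
Qed.

Section levy.
Context {R : realType}.
Local Notation mR := (measurableTypeR R).
Variable lambda : {measure set mR -> \bar R}.
Hypothesis Hlevy : levy_measure lambda.

Let mmin (D : set mR) : measurable_fun D (fun z : mR => (Num.min 1 ((z : R) ^+ 2))%:E).
Proof.
apply/measurable_EFinP; apply: measurable_minr => //; exact: exprn_measurable.
Qed.

(** The function min (1, z ^ 2) is bounded below by a positive constant on
    ]a, +oo[. *)
Lemma levy_tail (a : R) : 0 < a -> (lambda `]a, +oo[%classic < +oo)%E.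
Proof.
move=> a0; have [_ fin] := Hlevy.
have c0 : 0 < Num.min 1 (a ^+ 2) by rewrite lt_min ltr01 exprn_gt0.
have : ((Num.min 1 (a ^+ 2))%:E * lambda `]a, +oo[%classic < +oo)%E.
  apply: le_lt_trans fin; rewrite -integral_cst//.
  apply: (@le_trans _ _ (\int[lambda]_(z in `]a, +oo[%classic) (Num.min 1 (z ^+ 2))%:E)%E).
    apply: ge0_le_integral => //.
    - by move=> z _; rewrite lee_fin ltW.
    - move=> z /=; rewrite in_itv/= andbT => az; rewrite lee_fin.
      by rewrite le_min2// lerXn2r// ?nnegrE ltW// (lt_trans a0).
  apply: ge0_subset_integral => //.
  - by move=> z _; rewrite lee_fin le_min ler01 sqr_ge0.
  - by move=> z /=; rewrite !in_itv/= !andbT; exact: lt_trans.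
case: (lambda _) (measure_ge0 lambda `]a, +oo[%classic) => [r _ _|_|//].
  by rewrite ltry.
by rewrite gt0_muley// ltxx.
Qed.

Definition square_mark (a b : R) : R := fine (\int[lambda]_(z in `]a, b]%classic) (z ^+ 2)%:E)%E.

Lemma square_mark_finite (a b : R) : 0 <= a -> b <= 1 ->
  (\int[lambda]_(z in `]a, b]%classic) (z ^+ 2)%:E < +oo)%E.
Proof.
move=> a0 b1; have [_ fin] := Hlevy; apply: le_lt_trans fin.
rewrite (eq_integral (fun z : mR => (Num.min 1 ((z : R) ^+ 2))%:E)); last first.
  move=> z; rewrite inE/= in_itv/= => /andP[az zb]; congr EFin.
  apply/esym/min_r; rewrite expr_le1//; first exact: le_trans zb b1.
  by rewrite ltW// (le_lt_trans a0).
apply: ge0_subset_integral => //.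
- by move=> z _; rewrite lee_fin le_min ler01 sqr_ge0.
- by move=> z /=; rewrite !in_itv/= andbT => /andP[az _]; exact: le_lt_trans az.
Qed.

Lemma square_mark_ge0 a b : 0 <= square_mark a b.
Proof. by apply: fine_ge0; apply: integral_ge0 => z _; rewrite lee_fin sqr_ge0. Qed.

Lemma square_mark_le (a b c : R) : 0 <= a -> b <= c -> c <= 1 ->
  square_mark a b <= square_mark 0 c.
Proof.
move=> a0 bc c1; have a10 : b <= 1 := le_trans bc c1.
have f1 := square_mark_finite a0 a10.
have f2 := square_mark_finite (lexx 0) c1.
have g0 (x y : R) : (0 <= \int[lambda]_(z in `]x, y]%classic) (z ^+ 2)%:E)%E.
  by apply: integral_ge0 => z _; rewrite lee_fin sqr_ge0.
rewrite /square_mark fine_le ?ge0_fin_numE//.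
apply: ge0_subset_integral => //.
- apply/measurable_EFinP; exact: measurable_funX.
- by move=> z _; rewrite lee_fin sqr_ge0.
- by apply: subset_itv; rewrite bnd_simp.
Qed.

Lemma levy_sigma_finite : sigma_finite setT lambda.
Proof.
exists (fun n => `]-oo, 0%R]%classic `|` `]n.+1%:R^-1, +oo[%classic).
  apply/seteqP; split => // z _.
  have [z0|z0] := leP z 0; first by exists 0%N => //; left; rewrite /= in_itv.
  pose n := Num.truncn z^-1.
  exists n => //; right; rewrite /= in_itv/= andbT.
  rewrite invf_plt ?posrE//.
  by have := truncnS_gt z^-1.
move=> n; split; first exact: measurableU.
rewrite (le_lt_trans (measureU2 _ _ _))//.
apply: lte_add_pinfty; last by rewrite levy_tail// invr_gt0.
have [h _] := Hlevy.
exact: (eq_ind_r (fun x => x < +oo)%E (ltry 0) h).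
Qed.

(** A Levy measure is sigma-finite, hence the intensity, defined as a set
    function, is the product of two sigma-finite measures. *)
Lemma intensity_measure :
  exists nu : {measure set (mR * mR * mR) -> \bar R}, (nu : set _ -> \bar R) = intensity lambda.
Proof.
pose lambda_sf : {sigma_finite_measure set mR -> \bar R} :=
  sigma_finite_copy levy_sigma_finite.
exists ((@lebesgue_measure R \x @lebesgue_measure R) \x lambda_sf)%E.
by [].
Qed.

Lemma intensity_setX (A : set (mR * mR)) (Z : set mR) : measurable A -> measurable Z ->
  intensity lambda (A `*` Z) = (leb2 A * lambda Z)%E.
Proof.
move=> mA mZ.
pose lambda_sf : {sigma_finite_measure set mR -> \bar R} :=
  sigma_finite_copy levy_sigma_finite.
by rewrite -(product_measure1E (@lebesgue_measure R \x @lebesgue_measure R)%E lambda_sf mA mZ).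
Qed.

End levy.

(** * A maximal inequality for compensated jump sums *)

Lemma integral_probability_cst {d} {Omega : measurableType d} {R : realType}
    (P : probability Omega R) (r : R) : (\int[P]_w r%:E = r%:E)%E.
Proof.
transitivity (r%:E * P setT)%E; last by rewrite probability_setT mule1.
by rewrite -integral_cst.
Qed.

Section almost_sure_comparison.
Context {d : measure_display} {Omega : measurableType d} {R : realType}.
Variable P : {measure set Omega -> \bar R}.

Lemma le_measure_ae (A B : set Omega) : measurable A -> measurable B ->
  {ae P, forall w, A w -> B w} -> (P A <= P B)%E.
Proof.
move=> mA mB [N [mN N0 NAB]].
rewrite -[P B]adde0 -N0; apply: le_trans (measureU2 _ mB mN).
apply: le_measureS => //; first exact: measurableU.
move=> w Aw; have [Bw|nBw] := pselect (B w); first by left.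
by right; apply: NAB => /(_ Aw).
Qed.

End almost_sure_comparison.

Section jumps.
Context {d : measure_display} {Omega : measurableType d} {R : realType}.
Local Notation mR := (measurableTypeR R).
Variables (P : probability Omega R) (lambda : {measure set mR -> \bar R})
  (mu : R.-ker Omega ~> (mR * mR * mR)%type)
  (nu : {measure set (mR * mR * mR) -> \bar R}).
Hypothesis Hlevy : levy_measure lambda.
Hypothesis nuE : (nu : set _ -> \bar R) = intensity lambda.
Hypothesis Hmu : poisson_random_measure P marked_half_plane nu mu.
Implicit Types (A : set (mR * mR)) (a b e : R).

Definition area A : R := fine (leb2 A).

Lemma leb2_ge0 A : (0 <= leb2 A)%E.
Proof. exact: (measure_ge0 (@lebesgue_measure R \x @lebesgue_measure R)%E). Qed.

Lemma area_ge0 A : 0 <= area A.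
Proof. by apply: fine_ge0; exact: leb2_ge0. Qed.

Lemma finite_areaE A : finite_area A -> leb2 A = (area A)%:E.
Proof. by move=> [_ _ fA]; rewrite /area fineK// ge0_fin_numE// leb2_ge0. Qed.

Lemma levy_itv a b : 0 < a -> (lambda `]a, b]%classic < +oo)%E.
Proof.
move=> a0; apply: le_lt_trans (levy_tail Hlevy a0); apply: le_measureS => //.
by move=> z /=; rewrite !in_itv/= andbT => /andP[].
Qed.

Lemma nu_slab A a b : measurable A ->
  nu (slab A a b) = (leb2 A * lambda `]a, b]%classic)%E.
Proof. by move=> mA; rewrite nuE intensity_setX. Qed.

Lemma nu_big_slab A a : measurable A ->
  nu (big_slab A a) = (leb2 A * lambda `]a, +oo[%classic)%E.
Proof. by move=> mA; rewrite nuE intensity_setX. Qed.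

Lemma slab_thin A a b : finite_area A -> 0 < a ->
  thin marked_half_plane nu (slab A a b).
Proof.
move=> fA a0; have [mA AH lA] := fA; split.
- exact: measurable_slab.
- move=> y [/= /AH Hy]; rewrite in_itv/= => /andP[ay _]; split => //=.
  by rewrite in_itv/= andbT (lt_trans a0).
- rewrite nu_slab// finite_areaE// lte_mul_pinfty ?lee_fin ?area_ge0//.
  exact: levy_itv.
Qed.

Lemma big_slab_thin A a : finite_area A -> 0 < a ->
  thin marked_half_plane nu (big_slab A a).
Proof.
move=> fA a0; have [mA AH lA] := fA; split.
- exact: measurable_big_slab.
- move=> y [/= /AH Hy]; rewrite in_itv/= andbT => ay; split => //=.
  by rewrite in_itv/= andbT (lt_trans a0).
- rewrite nu_big_slab// finite_areaE// lte_mul_pinfty ?lee_fin ?area_ge0//.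
  exact: levy_tail.
Qed.

(** The compensated sum of the jumps of size in ]a, b] over A. *)
Definition jump_sum A a b (w : Omega) : R :=
  fine (mark (mu w) (slab A a b)) - fine (mark nu (slab A a b)).

Lemma measurable_jump_sum A a b : measurable A -> 0 <= a ->
  measurable_fun setT (jump_sum A a b).
Proof.
move=> mA a0; apply: measurable_funB => //.
by apply: measurableT_comp => //; apply: measurable_mark; exact: marked_slab.
Qed.

(** A lower Darboux sum of z ^ 2 with respect to lambda. *)
Lemma square_mark_riemann a h (n : nat) : 0 < a -> 0 <= h -> a + h * n%:R <= 1 ->
  \sum_(l < n) (a + h * l%:R) ^+ 2 * fine (lambda `]a + h * l%:R, a + h * l.+1%:R]%classic)
    <= square_mark lambda a (a + h * n%:R).
Proof.
move=> a0 h0 h1.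
pose t l := a + h * l%:R.
have t0 l : 0 < t l by rewrite ltr_pwDl// mulr_ge0.
have mf (D : set mR) : measurable_fun D (fun z : mR => ((z : R) ^+ 2)%:E).
  by apply/measurable_EFinP; exact: exprn_measurable.
rewrite /square_mark -lee_fin fineK; last first.
  rewrite ge0_fin_numE; last by apply: integral_ge0 => z _; rewrite lee_fin sqr_ge0.
  by apply: square_mark_finite => //; exact: ltW.
rewrite -/(t n).
elim: n {h1} => [|n IH].
  by rewrite big_ord0; apply: integral_ge0 => z _; rewrite lee_fin sqr_ge0.
rewrite big_ord_recr/= EFinD -/(t n) -/(t n.+1).
have tn : t n <= t n.+1 by rewrite lerD2l ler_wpM2l// ler_nat.
have atn : a <= t n by rewrite lerDl mulr_ge0.
rewrite (_ : `]a, t n.+1]%classic = `]a, t n]%classic `|` `]t n, t n.+1]%classic); last first.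
  by rewrite -itv_bndbnd_setU// bnd_simp.
rewrite ge0_integral_setU//; last 2 first.
- by move=> z _; rewrite lee_fin sqr_ge0.
- rewrite disj_set2E; apply/eqP/seteqP; split => // z [/=].
  rewrite !in_itv/= => /andP[_ zt] /andP[tz _].
  by rewrite ltNge zt in tz.
apply: leeD; first exact: IH.
rewrite EFinM fineK; last by rewrite ge0_fin_numE// levy_itv.
rewrite -integral_cst//; apply: ge0_le_integral => //.
- by move=> z _; rewrite lee_fin sqr_ge0.
- by move=> z /=; rewrite in_itv/= => /andP[tz _]; rewrite lee_fin lerXn2r ?nnegrE ?ltW// (lt_trans (t0 n)).
Qed.

Lemma mean_mass_slab A a b : finite_area A -> 0 < a ->
  (\int[P]_w (mass mu (slab A a b) w)%:E = nu (slab A a b))%E.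
Proof. by move=> fA a0; apply: (prm_mean Hmu); exact: slab_thin. Qed.

Section maximal_jumps.
Variables (C : nat -> set (mR * mR)) (r : nat -> R) (n : nat) (a b e : R).
Hypothesis fC : forall i, finite_area (C i).
Hypothesis tC : trivIset setT C.
Hypotheses (a0 : 0 < a) (ab : a <= b) (b1 : b <= 1) (e0 : 0 < e).

Let mC i : measurable (C i). Proof. by case: (fC i). Qed.

Let S k w := \sum_(i < k) r i * jump_sum (C i) a b w.

Let V := \sum_(i < n) r i ^+ 2 * area (C i) * square_mark lambda a b.

(* The interval ]a, b] is cut into p.+1 equal parts; the cell with number
   i * p.+1 + l is the part l over the set C i, and the marks in it are replaced
   by its left end. *)
Let mesh p : R := (b - a) / p.+1%:R.
Let t p l : R := a + mesh p * l%:R.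
Let D p (j : nat) := slab (C (j %/ p.+1)) (t p (j %% p.+1)) (t p (j %% p.+1).+1).
Let c p (j : nat) := r (j %/ p.+1) * t p (j %% p.+1).

Let mesh_ge0 p : 0 <= mesh p.
Proof. by rewrite divr_ge0// subr_ge0. Qed.

Let t_gt0 p l : 0 < t p l.
Proof. by rewrite ltr_pwDl// mulr_ge0. Qed.

Let t_last p : t p p.+1 = b.
Proof. by rewrite /t /mesh divfK ?pnatr_eq0// addrC subrK. Qed.

Let le_t p l l' : (l <= l')%N -> t p l <= t p l'.
Proof. by move=> ll; rewrite lerD2l ler_wpM2l// ler_nat. Qed.

Let thinD p j : thin marked_half_plane nu (D p j).
Proof. by apply: slab_thin. Qed.

Let trivD p : trivIset setT (fun j : 'I_(n * p.+1) => D p j).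
Proof.
move=> i j _ _ [y [[Ci ti] [Cj tj]]].
have qe : (i %/ p.+1 = j %/ p.+1)%N by apply: (tC I I); exists y.1.
have re : (i %% p.+1 = j %% p.+1)%N.
  move: ti tj; rewrite /= !in_itv/= => /andP[ti1 ti2] /andP[tj1 tj2].
  case: (ltngtP (i %% p.+1) (j %% p.+1))%N => // ij.
    have := le_lt_trans (le_t p ij) tj1; by rewrite ltNge ti2.
  have := le_lt_trans (le_t p ij) ti1; by rewrite ltNge tj2.
by apply/val_inj; rewrite /= (divn_eq i p.+1) (divn_eq j p.+1) qe re.
Qed.

Let variance_cells p :
  \sum_(j < n * p.+1) c p j ^+ 2 * fine (nu (D p j)) <= V.
Proof.
pose F i l := (r i * t p l) ^+ 2 * fine (nu (slab (C i) (t p l) (t p l.+1))).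
rewrite (@sum_divn_modn _ n p.+1 F)//; apply: ler_sum => i _.
rewrite -mulrA.
rewrite (eq_bigr (fun l : 'I_p.+1 => (r i ^+ 2 * area (C i)) *
    (t p l ^+ 2 * fine (lambda `]t p l, t p l.+1]%classic)))); last first.
  move=> l _; rewrite /F nu_slab// finite_areaE// fineM//=.
    by ring.
  by rewrite ge0_fin_numE// levy_itv.
rewrite -mulr_sumr mulrA ler_wpM2l//; first exact: mulr_ge0 (sqr_ge0 _) (area_ge0 _).
rewrite -[in leRHS](t_last p); apply: square_mark_riemann => //.
by rewrite -/(t p p.+1) t_last.
Qed.

(* Stopping the sequence of cells at k * p.+1 is stopping the sequence of sets
   at k. *)
Let SD p k w : (k <= n)%N ->
  partial_sum nu mu (fun j : 'I_(n * p.+1) => D p j) (fun j => c p j) (k * p.+1) w =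
  \sum_(i < k) r i * \sum_(l < p.+1) t p l *
    (mass mu (slab (C i) (t p l) (t p l.+1)) w - fine (nu (slab (C i) (t p l) (t p l.+1)))).
Proof.
move=> kn; pose F i l := r i * t p l *
    (mass mu (slab (C i) (t p l) (t p l.+1)) w - fine (nu (slab (C i) (t p l) (t p l.+1)))).
rewrite /partial_sum /centred_mass.
rewrite -(big_ord_widen (n * p.+1) (fun j => F (j %/ p.+1)%N (j %% p.+1)%N)) ?leq_mul//.
rewrite sum_divn_modn//; apply: eq_bigr => i _; rewrite mulr_sumr.
by apply: eq_bigr => l _; rewrite /F mulrA.
Qed.

Let total w := \sum_(i < n) `|r i| * (mass mu (slab (C i) a b) w + fine (nu (slab (C i) a b))).

Let jump_sum_riemann p i w : (mu w (slab (C i) a b) < +oo)%E ->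
  `|jump_sum (C i) a b w - \sum_(l < p.+1) t p l *
    (mass mu (slab (C i) (t p l) (t p l.+1)) w - fine (nu (slab (C i) (t p l) (t p l.+1))))|
  <= mesh p * (mass mu (slab (C i) a b) w + fine (nu (slab (C i) a b))).
Proof.
move=> fin.
have fin' : (nu (slab (C i) a b) < +oo)%E by case: (slab_thin b (fC i) a0).
have h1 := @mark_riemann _ _ _ (mu w) (C i) a (mesh p) p.+1 (mC i) (ltW a0) (mesh_ge0 p).
have h2 := @mark_riemann _ _ _ nu (C i) a (mesh p) p.+1 (mC i) (ltW a0) (mesh_ge0 p).
rewrite /= -/(t p p.+1) t_last in h1 h2.
have [h1l h1r] := h1 fin; have [h2l h2r] := h2 fin'.
rewrite (eq_bigr (fun l : 'I_p.+1 => t p l * mass mu (slab (C i) (t p l) (t p l.+1)) w -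
    t p l * fine (nu (slab (C i) (t p l) (t p l.+1))))); last first.
  by move=> l _; rewrite mulrBr.
rewrite sumrB /jump_sum ler_norml mulrDr.
move: h1l h1r h2l h2r; rewrite /mass /t.
set s1 := \sum_(l < p.+1) _; set s2 := \sum_(l < p.+1) _.
move=> h1l h1r h2l h2r; apply/andP; split; lra.
Qed.

Let mean_total : (\int[P]_w (total w)%:E = (\sum_(i < n) `|r i| * (2 * fine (nu (slab (C i) a b))))%:E)%E.
Proof.
have fn i : nu (slab (C i) a b) \is a fin_num.
  by apply: thin_fin; exact: slab_thin.
have mm i : measurable_fun setT (mass mu (slab (C i) a b)).
  by apply: measurable_mass; exact: measurable_slab.
under eq_integral do rewrite /total -sumEFin.
rewrite ge0_integral_sum//; last 2 first.
- move=> i; apply/measurable_EFinP; apply: measurable_funM => //.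
  exact: measurable_funD.
- by move=> i w _; rewrite lee_fin mulr_ge0// addr_ge0 ?mass_ge0 ?fine_ge0.
rewrite -sumEFin; apply: eq_bigr => i _.
under eq_integral do rewrite EFinM.
rewrite ge0_integralZl//; last 2 first.
- by apply/measurable_EFinP; exact: measurable_funD.
- by move=> w _; rewrite lee_fin addr_ge0 ?mass_ge0 ?fine_ge0.
under eq_integral do rewrite EFinD.
rewrite ge0_integralD//; last 2 first.
- by move=> w _; rewrite lee_fin mass_ge0.
- exact/measurable_EFinP.
rewrite mean_mass_slab// integral_probability_cst fineK//.
by rewrite EFinM EFinM fineK// mule_natl mule2n.
Qed.

(** [ottaviani_inequality] holds for the Riemann sums of the jump sums, with a
    variance that the mesh does not increase beyond V. They differ from the jump
    sums by at most the mesh times the integrable variable [total], which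
    Markov's inequality removes as the mesh tends to 0. Half of e is left to
    this error; the other half is 2 * (e / 4), whence 2 / (1 / 4) ^ 2 = 32. *)
Lemma maximal_jumps :
  (P [set w | exists2 k, (k <= n)%N & (e <= `|S k w|)%R] <= (32 * V / e ^+ 2)%:E)%E.
Proof.
have mS k : measurable_fun setT (S k).
  by apply: measurable_sum => i; apply: measurable_funM => //;
    apply: measurable_jump_sum => //; exact: ltW.
have mtot : measurable_fun setT total.
  apply: measurable_sum => i; apply: measurable_funM => //; apply: measurable_funD => //.
  by apply: measurable_mass; exact: measurable_slab.
have mex (f : nat -> Omega -> R) N x : (forall k, measurable_fun setT (f k)) ->
    measurable [set w | exists2 k, (k <= N)%N & x <= `|f k w|].
  move=> mf; rewrite (_ : [set w | _] = \bigcup_(k in [set k | (k <= N)%N]) [set w | x <= `|f k w|]).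
    by apply: bigcup_measurable => k _; apply: measurable_level_ge; exact: measurableT_comp.
  by apply/seteqP; split.
pose PS p k := partial_sum nu mu (fun j : 'I_(n * p.+1) => D p j) (fun j => c p j) k.
have mPS p k : measurable_fun setT (PS p k).
  rewrite /PS /partial_sum (_ : (fun w => _) = (fun w => \sum_(j < n * p.+1)
     if (j < k)%N then c p j * centred_mass nu mu (fun j : 'I_(n * p.+1) => D p j) j w else 0)).
    apply: measurable_sum => j; case: (ltnP j k) => _; last exact: measurable_cst.
    apply: measurable_funM => //; apply: measurable_funB => //.
    by apply: measurable_mass; case: (thinD p j).
  by apply/funext => w; rewrite big_mkcond.
pose K := \sum_(i < n) `|r i| * (2 * fine (nu (slab (C i) a b))).
have K0 : 0 <= K by apply: sumr_ge0 => i _; rewrite mulr_ge0// mulr_ge0// fine_ge0.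
apply/lee_addgt0Pr => x x0.
pose p := Num.truncn (2 * K * (b - a) / (e * x)).
have mp : 2 * mesh p * K / e <= x.
  rewrite ler_pdivrMr// /mesh.
  rewrite (_ : 2 * ((b - a) / p.+1%:R) * K = (2 * K * (b - a)) / p.+1%:R); last by ring.
  rewrite ler_pdivrMr//.
  have := truncnS_gt (2 * K * (b - a) / (e * x)); rewrite -/p.
  rewrite ltr_pdivrMr ?mulr_gt0// => /ltW /le_trans; apply.
  by rewrite le_eqVlt; apply/orP; left; apply/eqP; ring.
pose A1 := [set w | exists2 k, (k <= n * p.+1)%N & (2 * (e / 4)%R <= `|PS p k w|)%R].
pose A2 := [set w | e / 2 <= mesh p * total w].
have mA1 : measurable A1 by exact: mex.
have mA2 : measurable A2 by apply: measurable_level_ge; exact: measurable_funM.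
have tot0 w : 0 <= total w.
  by apply: sumr_ge0 => i _; rewrite mulr_ge0// addr_ge0 ?mass_ge0 ?fine_ge0.
apply: (@le_trans _ _ (P (A1 `|` A2))).
  apply: le_measure_ae; [exact: mex|exact: measurableU|].
  have : {ae P, forall w, forall i, (mu w (slab (C i) a b) < +oo)%E}.
    by apply: ae_foralln => i; apply: (prm_finite Hmu); exact: slab_thin.
  apply: filterS => w fin [k kn Sk].
  have [A2w|A2w] := leP (e / 2) (mesh p * total w); first by right.
  left; exists (k * p.+1)%N; first by rewrite leq_mul.
  have diff : `|S k w - PS p (k * p.+1)%N w| <= mesh p * total w.
    rewrite /PS SD// /S -sumrB; apply: (le_trans (ler_norm_sum _ _ _)).
    rewrite /total mulr_sumr.
    rewrite (big_ord_widen n (fun i => `|r i * jump_sum (C i) a b w - r i * (\sum_(l < p.+1) t p l *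
      (mass mu (slab (C i) (t p l) (t p l.+1)) w - fine (nu (slab (C i) (t p l) (t p l.+1)))))|))//.
    rewrite big_mkcond/=; apply: ler_sum => i _.
    have pos : 0 <= mesh p * (`|r i| * (mass mu (slab (C i) a b) w + fine (nu (slab (C i) a b)))).
      by rewrite mulr_ge0// mulr_ge0// addr_ge0 ?mass_ge0 ?fine_ge0.
    case: ifP => // _; rewrite -mulrBr normrM mulrCA ler_wpM2l//.
    exact: jump_sum_riemann.
  have := ler_normD (PS p (k * p.+1)%N w) (S k w - PS p (k * p.+1)%N w).
  rewrite addrCA subrr addr0 => tri.
  by move: Sk diff A2w tri; lra.
apply: (le_trans (measureU2 _ mA1 mA2)); apply: leeD.
  have e4 : 0 < e / 4 by rewrite divr_gt0.
  have := @ottaviani_inequality _ _ _ _ _ P marked_half_plane nu mu Hmu (n * p.+1)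
    (fun j : 'I_(n * p.+1) => D p j) (fun j => thinD p j) (@trivD p) (fun j => c p j) _ e4.
  move=> /le_trans; apply.
  rewrite lee_fin ler_pdivrMr ?exprn_gt0//.
  apply: (@le_trans _ _ (2 * V)); first by rewrite ler_pM2l// variance_cells.
  rewrite le_eqVlt; apply/orP; left; apply/eqP; field.
  by rewrite lt0r_neq0.
have e2 : 0 < e / 2 by rewrite divr_gt0.
have := markov_ge P e2 (measurable_funM (measurable_cst (mesh p)) mtot) (fun w => mulr_ge0 (mesh_ge0 p) (tot0 w)).
rewrite /= -/A2; under eq_integral do rewrite EFinM.
rewrite ge0_integralZl//;
  [|exact/measurable_EFinP|by move=> w _; rewrite lee_fin|by rewrite lee_fin].
rewrite mean_total -/K -lee_pdivlMl// => /le_trans; apply.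
rewrite -!EFinM lee_fin; apply: le_trans mp.
by rewrite le_eqVlt; apply/orP; left; apply/eqP; field; rewrite lt0r_neq0.
Qed.

End maximal_jumps.

End jumps.

(** * Convergence in probability *)

Lemma cvge0P {R : realType} {I : Type} (F : set_system I) {FF : Filter F}
    (p : I -> \bar R) : (forall i, 0 <= p i)%E ->
  p i @[i --> F] --> 0%E <->
  forall x : R, 0 < x -> \forall i \near F, (p i <= x%:E)%E.
Proof.
move=> p0; split => [h x x0|h U].
  have U0 : nbhs (0%E : \bar R) [set y : \bar R | (y <= x%:E)%E].
    exists x => //= r; rewrite /ball_ /= sub0r normrN => rx.
    by rewrite lee_fin (le_trans (ler_norm r))// ltW.
  by have := h _ U0.
move=> [e /= e0 eU]; have e20 : 0 < e / 2 by rewrite divr_gt0.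
have := h _ e20; apply: filterS => i.
rewrite /preimage/=; case: (p i) (p0 i) => [r|//|//]; rewrite !lee_fin => r0 re.
by have := eU r; rewrite /= sub0r normrN ger0_norm//; apply; lra.
Qed.

Section convergence_in_probability.
Context {d : measure_display} {Omega : measurableType d} {R : realType}.
Variable P : probability Omega R.
Implicit Types (Y Z : Omega -> R) (x e : R).

Lemma measurable_norm_ge Z e : measurable_fun setT Z -> measurable [set w | e <= `|Z w|].
Proof. by move=> mZ; apply: measurable_level_ge; exact: measurableT_comp. Qed.

Lemma measurable_norm_gt Z e : measurable_fun setT Z -> measurable [set w | e < `|Z w|].
Proof. by move=> mZ; apply: measurable_level_gt; exact: measurableT_comp. Qed.

Lemma probability_normD Y Z e1 e2 :
  measurable_fun setT Y -> measurable_fun setT Z ->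
  (P [set w | (e1 + e2 <= `|Y w + Z w|)%R] <=
   P [set w | (e1 <= `|Y w|)%R] + P [set w | (e2 <= `|Z w|)%R])%E.
Proof.
move=> mY mZ.
apply: (@le_trans _ _ (P ([set w | e1 <= `|Y w|] `|` [set w | e2 <= `|Z w|]))).
  apply: le_measureS.
  - by apply: measurable_norm_ge; exact: measurable_funD.
  - by apply: measurableU; exact: measurable_norm_ge.
  move=> w /= h; have [h1|h1] := leP e1 `|Y w|; [by left|right].
  by have := ler_normD (Y w) (Z w); lra.
by apply: measureU2; exact: measurable_norm_ge.
Qed.

Lemma ae_eq0P Y : measurable_fun setT Y ->
  (forall e, 0 < e -> P [set w | e <= `|Y w|] = 0%E) -> {ae P, forall w, Y w = 0}.
Proof.
move=> mY h.
have : {ae P, forall w, forall n : nat, ~ n.+1%:R^-1 <= `|Y w|}.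
  apply: ae_foralln => n; exists [set w | n.+1%:R^-1 <= `|Y w|]; split.
  - exact: measurable_norm_ge.
  - by apply: h; rewrite invr_gt0.
  - by move=> w /= /contrapT.
apply: filterS => w hw; apply/eqP; rewrite -normr_eq0; apply/negPn/negP => Y0.
have Yp : 0 < `|Y w| by rewrite lt_neqAle eq_sym Y0 normr_ge0.
apply: (hw (Num.truncn `|Y w|^-1)).
by rewrite invf_ple ?posrE//; have /ltW := truncnS_gt `|Y w|^-1.
Qed.

Section filter.
Context {I : Type} (F : set_system I) {FF : ProperFilter F}.
Implicit Types (U V : I -> Omega -> R).

Let filterF : Filter F.
Proof. exact: _. Qed.

Lemma cvg_in_probP U Y : cvg_in_prob P F U Y <->
  forall e x, 0 < e -> 0 < x ->
    \forall i \near F, (P [set w | e <= `|U i w - Y w|]%R <= x%:E)%E.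
Proof.
split => [h e x e0 x0|h e e0].
  by have /cvge0P := h e e0; apply.
by apply/cvge0P => // x x0; exact: h.
Qed.

Lemma cvg_in_prob_unique U Y Z : (forall i, measurable_fun setT (U i)) ->
  measurable_fun setT Y -> measurable_fun setT Z ->
  cvg_in_prob P F U Y -> cvg_in_prob P F U Z -> {ae P, forall w, Y w = Z w}.
Proof.
move=> mU mY mZ /cvg_in_probP UY /cvg_in_probP UZ.
suff : {ae P, forall w, Y w - Z w = 0} by apply: filterS => w /eqP; rewrite subr_eq0 => /eqP.
apply: ae_eq0P; first exact: measurable_funB.
move=> e e0; apply/eqP; rewrite eq_le measure_ge0 andbT.
apply/lee_addgt0Pr => x x0; rewrite add0e.
have e20 : 0 < e / 2 by rewrite divr_gt0.
have x20 : 0 < x / 2 by rewrite divr_gt0.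
have /filter_ex[i [h1 h2]] := @filterI _ F filterF _ _ (UY _ _ e20 x20) (UZ _ _ e20 x20).
have -> : [set w | e <= `|Y w - Z w|] =
    [set w | e / 2 + e / 2 <= `|(Y w - U i w) + (U i w - Z w)|].
  by apply/seteqP; split => w /=; rewrite -splitr addrA subrK.
apply: (le_trans (probability_normD _ _ _ _)); [exact: measurable_funB|exact: measurable_funB|].
rewrite (_ : [set w | e / 2 <= `|Y w - U i w|] = [set w | e / 2 <= `|U i w - Y w|]); last first.
  by apply/seteqP; split => w /=; rewrite distrC.
by apply: (le_trans (leeD h1 h2)); rewrite -EFinD -splitr.
Qed.

Lemma cvg_in_probD U V Y Z : (forall i, measurable_fun setT (U i)) ->
  (forall i, measurable_fun setT (V i)) ->
  measurable_fun setT Y -> measurable_fun setT Z ->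
  cvg_in_prob P F U Y -> cvg_in_prob P F V Z ->
  cvg_in_prob P F (fun i w => U i w + V i w) (fun w => Y w + Z w).
Proof.
move=> mU mV mY mZ /cvg_in_probP UY /cvg_in_probP VZ; apply/cvg_in_probP => e x e0 x0.
have e20 : 0 < e / 2 by rewrite divr_gt0.
have x20 : 0 < x / 2 by rewrite divr_gt0.
have := @filterI _ F filterF _ _ (UY _ _ e20 x20) (VZ _ _ e20 x20); apply: filterS => i [h1 h2].
have -> : [set w | e <= `|U i w + V i w - (Y w + Z w)|] =
    [set w | e / 2 + e / 2 <= `|(U i w - Y w) + (V i w - Z w)|].
  by apply/seteqP; split => w /=; rewrite -splitr opprD addrACA.
apply: (le_trans (probability_normD _ _ _ _)); [exact: measurable_funB|exact: measurable_funB|].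
by apply: (le_trans (leeD h1 h2)); rewrite -EFinD -splitr.
Qed.

Lemma cvg_in_probZ (c : R) U Y : cvg_in_prob P F U Y ->
  cvg_in_prob P F (fun i w => c * U i w) (fun w => c * Y w).
Proof.
move=> /cvg_in_probP UY; apply/cvg_in_probP => e x e0 x0.
have [->|c0] := eqVneq c 0.
  apply: nearW => i; rewrite (_ : [set w | _] = set0) ?measure0 ?lee_fin ?ltW//.
  apply/seteqP; split => // w /=; rewrite !mul0r subrr normr0 => ?; lra.
have cp : 0 < `|c| by rewrite normr_gt0.
have ec0 : 0 < e / `|c| by rewrite divr_gt0.
have := UY _ _ ec0 x0; apply: filterS => i.
congr (P _ <= _)%E; apply/seteqP; split => w /=.
  by rewrite -mulrBr normrM ler_pdivrMr// mulrC.
by rewrite -mulrBr normrM ler_pdivrMr// mulrC.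
Qed.

Lemma cvg_in_prob_cst Y : cvg_in_prob P F (fun=> Y) Y.
Proof.
apply/cvg_in_probP => e x e0 x0; apply: nearW => i.
rewrite (_ : [set w | _] = set0) ?measure0 ?lee_fin ?ltW//.
by apply/seteqP; split => // w /=; rewrite subrr normr0 => ?; lra.
Qed.

Lemma cvg_in_prob_sum (n : nat) (U : nat -> I -> Omega -> R) (Y : nat -> Omega -> R) :
  (forall k i, measurable_fun setT (U k i)) -> (forall k, measurable_fun setT (Y k)) ->
  (forall k, (k < n)%N -> cvg_in_prob P F (U k) (Y k)) ->
  cvg_in_prob P F (fun i w => \sum_(k < n) U k i w) (fun w => \sum_(k < n) Y k w).
Proof.
move=> mU mY; elim: n => [|n IH] h.
  rewrite (_ : (fun w => _) = cst 0); last by apply/funext => w; rewrite big_ord0.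
  rewrite (_ : (fun i w => _) = fun=> cst 0); first exact: cvg_in_prob_cst.
  by apply/funext => i; apply/funext => w; rewrite big_ord0.
rewrite (_ : (fun w => _) = (fun w => \sum_(k < n) Y k w + Y n w)); last first.
  by apply/funext => w; rewrite big_ord_recr.
rewrite (_ : (fun i w => _) = (fun i w => \sum_(k < n) U k i w + U n i w)); last first.
  by apply/funext => i; apply/funext => w; rewrite big_ord_recr.
apply: cvg_in_probD => //.
- by move=> i; exact: measurable_sum.
- exact: measurable_sum.
- by apply: IH => k kn; apply: h; exact: ltnW.
- exact: h.
Qed.

Lemma cvg_in_prob_ae U V Y Z : (forall i, measurable_fun setT (U i)) ->
  (forall i, measurable_fun setT (V i)) ->
  measurable_fun setT Y -> measurable_fun setT Z ->
  (\forall i \near F, {ae P, forall w, U i w = V i w}) ->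
  {ae P, forall w, Y w = Z w} ->
  cvg_in_prob P F U Y -> cvg_in_prob P F V Z.
Proof.
move=> mU mV mY mZ UV YZ /cvg_in_probP UY; apply/cvg_in_probP => e x e0 x0.
have := @filterI _ F filterF _ _ UV (UY _ _ e0 x0); apply: filterS => i [h1 h2].
apply: le_trans h2; apply: le_measure_ae.
- by apply: measurable_norm_ge; exact: measurable_funB.
- by apply: measurable_norm_ge; exact: measurable_funB.
by move: h1 YZ; apply: filterS2 => w e1 e2; rewrite /= e1 e2.
Qed.

(** Tail bounds pass to the limit at the cost of a margin e2. *)
Lemma cvg_in_prob_bound U Y e1 e2 (M : \bar R) : (forall i, measurable_fun setT (U i)) ->
  measurable_fun setT Y -> 0 < e2 -> cvg_in_prob P F U Y ->
  (\forall i \near F, P [set w | e1 <= `|U i w|]%R <= M)%E ->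
  (P [set w | e1 + e2 <= `|Y w|]%R <= M)%E.
Proof.
move=> mU mY e20 /cvg_in_probP UY UM; apply/lee_addgt0Pr => x x0.
have /filter_ex[i [h1 h2]] := @filterI _ F filterF _ _ UM (UY _ _ e20 x0).
have -> : [set w | e1 + e2 <= `|Y w|] = [set w | e1 + e2 <= `|U i w + (Y w - U i w)|].
  by apply/seteqP; split => w /=; rewrite addrCA subrr addr0.
apply: (le_trans (probability_normD _ _ _ _)) => //; first exact: measurable_funB.
apply: leeD => //.
by rewrite (_ : [set w | e2 <= `|Y w - U i w|] = [set w | e2 <= `|U i w - Y w|])//;
  apply/seteqP; split => w /=; rewrite distrC.
Qed.

End filter.

End convergence_in_probability.

(** * Additivity and continuity of the Levy basis *)

Section levy_basis.
Context {d : measure_display} {Omega : measurableType d} {R : realType}.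
Local Notation mR := (measurableTypeR R).
Variables (P : probability Omega R) (m : R) (lambda : {measure set mR -> \bar R})
  (mu : R.-ker Omega ~> (mR * mR * mR)%type)
  (nu : {measure set (mR * mR * mR) -> \bar R})
  (Lambda : set (mR * mR) -> {RV P >-> mR}).
Hypothesis Hlevy : levy_measure lambda.
Hypothesis nuE : (nu : set _ -> \bar R) = intensity lambda.
Hypothesis Hmu : poisson_random_measure P marked_half_plane nu mu.
Hypothesis HL : is_levy_basis m lambda mu Lambda.
Implicit Types (A B : set (mR * mR)).

Lemma finite_areaU A B : finite_area A -> finite_area B -> finite_area (A `|` B).
Proof.
move=> [mA AH lA] [mB BH lB]; split; [exact: measurableU|by rewrite subUset|].
apply: (le_lt_trans (measureU2 (@lebesgue_measure R \x @lebesgue_measure R)%E mA mB)).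
exact: lte_add_pinfty.
Qed.

Lemma finite_areaS A B : finite_area B -> measurable A -> A `<=` B -> finite_area A.
Proof.
move=> [mB BH lB] mA AB; split => //; first exact: subset_trans BH.
by apply: le_lt_trans lB;
  exact: (le_measureS (@lebesgue_measure R \x @lebesgue_measure R)%E).
Qed.

Lemma areaU A B : finite_area A -> finite_area B -> A `&` B = set0 ->
  area (A `|` B) = area A + area B.
Proof.
move=> fA fB AB0; have [mA AH lA] := fA; have [mB BH lB] := fB.
rewrite /area -fineD ?ge0_fin_numE ?leb2_ge0//.
by congr fine; apply: (measureU (@lebesgue_measure R \x @lebesgue_measure R)%E).
Qed.

Lemma prm_null (D : set (mR * mR * mR)) : thin marked_half_plane nu D -> nu D = 0%E ->
  {ae P, forall w, mu w D = 0%E}.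
Proof.
move=> tD D0; exists [set w | mu w D != 0%R%:E]; split.
- have [mD _ _] := tD; rewrite -[X in measurable X]setTI.
  by apply: emeasurable_neq => //; exact: measurable_kernel.
- apply/eqP; rewrite eq_le measure_ge0 andbT -D0; exact: (prm_neq0 Hmu).
- by move=> w /= /eqP.
Qed.

Lemma levy_tail_small (x : R) : 0 < x ->
  exists K : nat, (lambda `]K.+1%:R, +oo[%classic <= x%:E)%E.
Proof.
move=> x0; pose F K : set mR := `]K.+1%:R, +oo[%classic.
have F0 : \bigcap_K F K = set0.
  apply/seteqP; split => // z /= h.
  have := h (Num.truncn z) I; rewrite /F/= in_itv/= andbT ltNge.
  by have /ltW -> := truncnS_gt (z : R).
have /cvge0P : (lambda \o F) K @[K --> \oo] --> 0%E.
  rewrite -(measure0 lambda) -F0; apply: nonincreasing_cvg_mu.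
  - exact: levy_tail.
  - by move=> i; exact: measurable_itv.
  - by rewrite F0.
  - move=> i j ij; apply/subsetPset => z; rewrite /F/= !in_itv/= !andbT.
    by apply: le_lt_trans; rewrite ler_nat.
move=> /(_ (fun K => measure_ge0 _ _) x x0) /filter_ex[K KP].
by exists K.
Qed.

Lemma big_slab_split A (K : nat) :
  big_slab A (1 : R) = slab A 1 K.+1%:R `|` big_slab A K.+1%:R /\
  slab A (1 : R) K.+1%:R `&` big_slab A K.+1%:R = set0.
Proof.
have sE a b y : slab A a b y <-> A y.1 /\ a < y.2 <= b :> Prop by rewrite /slab /= in_itv.
have bE (a : R) y : big_slab A a y <-> A y.1 /\ a < y.2 by rewrite /big_slab /= in_itv/= andbT.
split; apply/seteqP; split => // y.
- move=> /bE[Ay y1]; have [yK|yK] := leP y.2 K.+1%:R.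
    by left; apply/sE; rewrite y1 yK.
  by right; apply/bE.
- move=> [/sE[Ay /andP[y1 _]]|/bE[Ay yK]]; apply/bE; split => //.
  by apply: le_lt_trans yK; rewrite ler1n.
- move=> [/sE[_ /andP[_ yK]] /bE[_ yK']].
  by rewrite ltNge yK in yK'.
Qed.

Lemma mark_big_slab_le A (K : nat) w : measurable A ->
  mu w (big_slab A K.+1%:R) = 0%E ->
  (mark (mu w) (big_slab A 1) <= K.+1%:R%:E * mu w (big_slab A 1))%E.
Proof.
move=> mA K0; have [e1 e2] := big_slab_split A K.
rewrite {1}e1 mark_setU//; [|exact: marked_slab|exact: marked_big_slab].
rewrite (mark_null (measurable_big_slab _ mA) K0) adde0.
apply: (@le_trans _ _ (K.+1%:R%:E * mu w (slab A 1 K.+1%:R))%E).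
  apply: mark_le => //; first exact: marked_slab.
  by move=> y [_ /=]; rewrite in_itv/= => /andP[].
rewrite lee_wpmul2l//; apply: le_measureS.
- exact: measurable_slab.
- exact: measurable_big_slab.
- by rewrite e1; exact: subsetUl.
Qed.

(** The expected number of points over A with a mark above K tends to 0 as K
    grows. Hence almost surely some K is above all marks, and the integral is at
    most K times the finite number of points with a mark above 1. *)
Lemma big_mark_finite A : finite_area A ->
  {ae P, forall w, (mark (mu w) (big_slab A 1) < +oo)%E}.
Proof.
move=> fA; have [mA _ _] := fA.
have ltK : {ae P, forall w, exists K : nat, mu w (big_slab A K.+1%:R) = 0%E}.
  pose N K := [set w | mu w (big_slab A K.+1%:R) != 0%R%:E].
  have mN K : measurable (N K).
    rewrite -[X in measurable X]setTI.
    by apply: emeasurable_neq => //; apply: measurable_kernel; exact: measurable_big_slab.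
  exists (\bigcap_K N K); split.
  - exact: bigcapT_measurable.
  - apply/eqP; rewrite eq_le measure_ge0 andbT; apply/lee_addgt0Pr => x x0; rewrite add0e.
    have x1 : 0 < x / (area A + 1) by rewrite divr_gt0// ltr_wpDl ?area_ge0.
    have [K KP] := levy_tail_small x1.
    apply: (@le_trans _ _ (P (N K))).
      by apply: le_measureS => //; [exact: bigcapT_measurable|exact: bigcap_inf].
    apply: (le_trans (prm_neq0 Hmu (big_slab_thin Hlevy nuE fA _))) => //.
    rewrite (nu_big_slab Hlevy nuE)// finite_areaE//.
    apply: (le_trans (lee_wpmul2l _ KP)); first by rewrite lee_fin area_ge0.
    have aA := area_ge0 A.
    rewrite -EFinM lee_fin mulrA ler_pdivrMr ?ltr_wpDl//; nra.
  - by move=> w /= h K _; apply/eqP => K0; apply: h; exists K.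
have fin := prm_finite Hmu (big_slab_thin Hlevy nuE fA ltr01).
move: ltK fin; apply: filterS2 => w [K K0] fin.
apply: (le_lt_trans (mark_big_slab_le mA K0)).
by rewrite lte_mul_pinfty.
Qed.

Definition big_sum A (w : Omega) : R := fine (mark (mu w) (big_slab A 1)).

Lemma measurable_big_sum A : measurable A -> measurable_fun setT (big_sum A).
Proof.
by move=> mA; apply: measurableT_comp => //; apply: measurable_mark; exact: marked_big_slab.
Qed.

(** The Levy-Ito decomposition, with the truncation levels taken along the
    sequence 1 / (k + 1). *)
Lemma levy_ito : exists Y : set (mR * mR) -> {RV P >-> mR}, forall A, finite_area A ->
  cvg_in_prob P \oo (fun k => jump_sum mu nu A k.+1%:R^-1 1) (Y A) /\
  {ae P, forall w, Lambda A w = m * area A + Y A w + big_sum A w}.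
Proof.
suff H A : exists Y : {RV P >-> mR}, finite_area A ->
    cvg_in_prob P \oo (fun k => jump_sum mu nu A k.+1%:R^-1 1) Y /\
    {ae P, forall w, Lambda A w = m * area A + Y w + big_sum A w}.
  by have [f Hf] := choice H; exists f.
have [fA|nfA] := pselect (finite_area A); last by exists (Lambda A).
have [Y cY LY] := HL fA; exists Y => _; split => // e e0.
have h2 : k.+1%:R^-1 @[k --> \oo] --> (0 : R)^'+.
  move=> U [x /= x0 xU]; have := near_infty_natSinv_lt (PosNum x0).
  apply: filterS => k /= kx; apply: xU; rewrite /= ?invr_gt0//.
  by rewrite sub0r normrN ger0_norm ?invr_ge0.
move: (cY e e0); rewrite -nuE => h1.
exact: (cvg_comp _ _ h2 h1).
Qed.

Lemma slabU A B (a b : R) : slab (A `|` B) a b = slab A a b `|` slab B a b.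
Proof.
apply/seteqP; split => y; first by move=> [[Ay|By] yb]; [left|right].
by move=> [[Ay yb]|[By yb]]; split => //; [left|right].
Qed.

Lemma big_slabU A B (a : R) : big_slab (A `|` B) a = big_slab A a `|` big_slab B a.
Proof.
apply/seteqP; split => y; first by move=> [[Ay|By] yb]; [left|right].
by move=> [[Ay yb]|[By yb]]; split => //; [left|right].
Qed.

Lemma disjoint_slab A B (Z : set mR) : A `&` B = set0 ->
  (A `*` Z) `&` (B `*` Z) = set0.
Proof.
move=> AB0; apply/seteqP; split => // y [[Ay _] [By _]].
have : (A `&` B) y.1 by [].
by rewrite AB0.
Qed.

Let measurableRV (Z : {RV P >-> mR}) : measurable_fun setT (Z : Omega -> R).
Proof. exact: (@measurable_funP _ _ _ _ setT Z). Qed.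

Lemma natSinv_in01 k : 0 < k.+1%:R^-1 :> R /\ k.+1%:R^-1 <= 1 :> R.
Proof. by rewrite invr_gt0 ltr0n invf_le1 ?ltr0n// ler1n. Qed.

Lemma jump_sumU A B a b : finite_area A -> finite_area B -> A `&` B = set0 -> 0 < a ->
  {ae P, forall w, jump_sum mu nu (A `|` B) a b w = jump_sum mu nu A a b w + jump_sum mu nu B a b w}.
Proof.
move=> fA fB AB0 a0; have [mA _ _] := fA; have [mB _ _] := fB.
have tA := slab_thin Hlevy nuE b fA a0; have tB := slab_thin Hlevy nuE b fB a0.
have mkA := marked_slab b mA (ltW a0); have mkB := marked_slab b mB (ltW a0).
have AB0' : slab A a b `&` slab B a b = set0.
  exact: disjoint_slab.
have markD (kappa : {measure set (mR * mR * mR) -> \bar R}) :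
    (kappa (slab A a b) < +oo)%E -> (kappa (slab B a b) < +oo)%E ->
    fine (mark kappa (slab (A `|` B) a b)) =
    fine (mark kappa (slab A a b)) + fine (mark kappa (slab B a b)).
  move=> kA kB; rewrite slabU mark_setU// fineD// ge0_fin_numE ?mark_ge0//.
    exact: mark_slab_finite (ltW a0) kA.
  exact: mark_slab_finite (ltW a0) kB.
move: (prm_finite Hmu tA) (prm_finite Hmu tB); apply: filterS2 => w wA wB.
have [_ _ nA] := tA; have [_ _ nB] := tB.
by rewrite /jump_sum !markD//; ring.
Qed.

Lemma big_sumU A B : finite_area A -> finite_area B -> A `&` B = set0 ->
  {ae P, forall w, big_sum (A `|` B) w = big_sum A w + big_sum B w}.
Proof.
move=> fA fB AB0; have [mA _ _] := fA; have [mB _ _] := fB.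
move: (big_mark_finite fA) (big_mark_finite fB); apply: filterS2 => w wA wB.
rewrite /big_sum big_slabU mark_setU//; last 3 first.
- exact: marked_big_slab.
- exact: marked_big_slab.
- exact: disjoint_slab.
by rewrite fineD// ge0_fin_numE// mark_ge0//; exact: marked_big_slab.
Qed.

Lemma Lambda_setU A B : finite_area A -> finite_area B -> A `&` B = set0 ->
  {ae P, forall w, Lambda (A `|` B) w = Lambda A w + Lambda B w}.
Proof.
move=> fA fB AB0; have [mA _ _] := fA; have [mB _ _] := fB.
have fAB := finite_areaU fA fB.
have [Y HY] := levy_ito.
have [cA LA] := HY _ fA; have [cB LB] := HY _ fB; have [cAB LAB] := HY _ fAB.
have mJ D k : measurable D -> measurable_fun setT (jump_sum mu nu D k.+1%:R^-1 1).
  by move=> mD; apply: measurable_jump_sum.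
have YE : {ae P, forall w, Y (A `|` B) w = Y A w + Y B w}.
  have mU k : measurable_fun setT (jump_sum mu nu (A `|` B) k.+1%:R^-1 1).
    by apply: mJ; exact: measurableU.
  have mAB : measurable_fun setT (fun w => Y A w + Y B w).
    by apply: measurable_funD; exact: measurableRV.
  apply: (cvg_in_prob_unique mU (measurableRV _) mAB cAB).
  apply: (@cvg_in_prob_ae _ _ _ P _ \oo _
     (fun k w => jump_sum mu nu A k.+1%:R^-1 1 w + jump_sum mu nu B k.+1%:R^-1 1 w)
     (fun k => jump_sum mu nu (A `|` B) k.+1%:R^-1 1)
     (fun w => Y A w + Y B w)) => //.
  - by move=> k; apply: measurable_funD; exact: mJ.
  - apply: nearW => k; have [k0 _] := natSinv_in01 k.
    by have := jump_sumU 1 fA fB AB0 k0; apply: filterS => w ->.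
  - by apply: nearW.
  - by apply: cvg_in_probD => //; move=> k; exact: mJ.
have bE := big_sumU fA fB AB0.
have LE : {ae P, forall w, Lambda A w + Lambda B w =
    m * area (A `|` B) + (Y A w + Y B w) + (big_sum A w + big_sum B w)}.
  by move: LA LB; apply: filterS2 => w -> ->; rewrite areaU//; ring.
move: LE LAB => LE LAB.
have YbE : {ae P, forall w, m * area (A `|` B) + Y (A `|` B) w + big_sum (A `|` B) w =
    m * area (A `|` B) + (Y A w + Y B w) + (big_sum A w + big_sum B w)}.
  by move: YE bE; apply: filterS2 => w -> ->.
by move: LE LAB YbE; apply: filterS3 => w -> -> ->.
Qed.

Lemma Lambda_null A : finite_area A -> leb2 A = 0%E -> {ae P, forall w, Lambda A w = 0}.
Proof.
move=> fA A0; have [mA _ _] := fA.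
have [Y HY] := levy_ito; have [cA LA] := HY _ fA.
have aA : area A = 0 by rewrite /area A0.
have big0 : {ae P, forall w, big_sum A w = 0}.
  have := prm_null (big_slab_thin Hlevy nuE fA ltr01).
  rewrite (nu_big_slab Hlevy nuE)// A0 mul0e => /(_ erefl).
  apply: filterS => w w0; rewrite /big_sum mark_null//.
  exact: measurable_big_slab.
have J0 k : {ae P, forall w, jump_sum mu nu A k.+1%:R^-1 1 w = 0}.
  have [k0 _] := natSinv_in01 k.
  have n0 : nu (slab A k.+1%:R^-1 1) = 0%E by rewrite (nu_slab Hlevy nuE)// A0 mul0e.
  have := prm_null (slab_thin Hlevy nuE 1 fA k0) n0.
  apply: filterS => w w0; rewrite /jump_sum !mark_null ?subr0//; exact: measurable_slab.
have mJ k : measurable_fun setT (jump_sum mu nu A k.+1%:R^-1 1).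
  by apply: measurable_jump_sum.
have Y0 : {ae P, forall w, Y A w = 0}.
  apply: (cvg_in_prob_unique mJ (measurableRV _) (measurable_cst (0 : R)) cA).
  apply: (@cvg_in_prob_ae _ _ _ P _ \oo _ (fun k => cst (0 : R))
     (fun k => jump_sum mu nu A k.+1%:R^-1 1) (cst (0 : R)) (cst (0 : R))) => //.
  - by apply: nearW => k; have := J0 k; apply: filterS => w ->.
  - by apply: nearW.
  - exact: cvg_in_prob_cst.
by move: LA big0 Y0; apply: filterS3 => w -> -> ->; rewrite aA; ring.
Qed.

Lemma Lambda_eq_null A B : finite_area B -> measurable A -> A `<=` B ->
  leb2 (B `\` A) = 0%E -> {ae P, forall w, Lambda A w = Lambda B w}.
Proof.
move=> fB mA AB D0; have [mB _ _] := fB.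
have fA := finite_areaS fB mA AB.
have fD : finite_area (B `\` A).
  by apply: finite_areaS fB _ _; [exact: measurableD|exact: subDsetl].
have := Lambda_setU fA fD (setDIK _ _); rewrite setDUK//.
by move: (Lambda_null fD D0); apply: filterS2 => w D ->; rewrite D addr0.
Qed.

Section combinations.
Variables (B : set (mR * mR)) (C : nat -> set (mR * mR)) (r : nat -> R) (n : nat).
Hypothesis fB : finite_area B.
Hypothesis mC : forall i, measurable (C i).
Hypothesis CB : forall i, C i `<=` B.
Hypothesis tC : trivIset setT C.

Let fC i : finite_area (C i). Proof. exact: finite_areaS fB (mC i) (@CB i). Qed.

(** [maximal_jumps] bounds the truncated sums uniformly in the truncation level,
    and the bound passes to the limit. *)
Lemma small_combination (Y : set (mR * mR) -> {RV P >-> mR}) (e : R) :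
  (forall i, cvg_in_prob P \oo (fun k => jump_sum mu nu (C i) k.+1%:R^-1 1) (Y (C i))) ->
  0 < e ->
  (P [set w | 2 * e <= `|\sum_(i < n) r i * Y (C i) w|]%R <=
    (32 * (\sum_(i < n) r i ^+ 2 * area (C i)) * square_mark lambda 0 1 / e ^+ 2)%:E)%E.
Proof.
move=> cY e0; rewrite mulr2n mulrDl mul1r.
have mJ k i : measurable_fun setT (fun w => r i * jump_sum mu nu (C i) k.+1%:R^-1 1 w).
  by apply: measurable_funM => //; apply: measurable_jump_sum.
have mY i : measurable_fun setT (fun w => r i * Y (C i) w).
  by apply: measurable_funM => //; exact: measurableRV.
apply: (@cvg_in_prob_bound _ _ _ P _ \oo _
  (fun k w => \sum_(i < n) r i * jump_sum mu nu (C i) k.+1%:R^-1 1 w)) => //.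
- by move=> k; exact: measurable_sum.
- exact: measurable_sum.
- apply: (@cvg_in_prob_sum _ _ _ P _ \oo _ n
    (fun i k w => r i * jump_sum mu nu (C i) k.+1%:R^-1 1 w) (fun i w => r i * Y (C i) w)) => //.
  by move=> i _; apply: cvg_in_probZ.
apply: nearW => k; have [k0 k1] := natSinv_in01 k.
have := @maximal_jumps _ _ _ P lambda mu nu Hlevy nuE Hmu C r n k.+1%:R^-1 1 e fC tC k0 k1 (lexx 1) e0.
move=> h; apply: (@le_trans _ _ _ _ _ (le_trans _ h)).
  apply: le_measureS.
  - by apply: measurable_norm_ge; exact: measurable_sum.
  - rewrite (_ : [set w | _] = \bigcup_(j in [set j | (j <= n)%N])
        [set w | e <= `|\sum_(i < j) r i * jump_sum mu nu (C i) k.+1%:R^-1 1 w|]).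
      by apply: bigcup_measurable => j _; apply: measurable_norm_ge; exact: measurable_sum.
    by apply/seteqP; split.
  - by move=> w /= ew; exists n.
rewrite lee_fin ler_pM2r ?invr_gt0 ?exprn_gt0// -mulrA ler_pM2l//.
rewrite mulr_suml; apply: ler_sum => i _; rewrite ler_wpM2l//.
  exact: mulr_ge0 (sqr_ge0 _) (area_ge0 _).
exact: square_mark_le (ltW k0) _ _.
Qed.

(** Unless B carries a mark above K, every jump is at most K, and the number of
    jumps above 1 has a finite mean. *)
Lemma big_combination (K : nat) (e : R) : 0 < e ->
  (P [set w | e <= `|\sum_(i < n) r i * big_sum (C i) w|]%R <=
   (K.+1%:R * (\sum_(i < n) `|r i| * area (C i)) *
       fine (lambda `]1%R, +oo[%classic) / e)%:E +
   (area B)%:E * lambda `]K.+1%:R, +oo[%classic)%E.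
Proof.
move=> e0.
pose N := [set w | mu w (big_slab B K.+1%:R) != 0%R%:E].
have [mB _ _] := fB.
have mN : measurable N.
  rewrite -[X in measurable X]setTI.
  by apply: emeasurable_neq => //; apply: measurable_kernel; exact: measurable_big_slab.
pose f w := K.+1%:R * \sum_(i < n) `|r i| * mass mu (big_slab (C i) 1) w.
have mm i : measurable_fun setT (mass mu (big_slab (C i) 1)).
  by apply: measurable_mass; exact: measurable_big_slab.
have mf : measurable_fun setT f.
  by apply: measurable_funM => //; apply: measurable_sum => i; exact: measurable_funM.
have f0 w : 0 <= f w.
  by rewrite mulr_ge0//; apply: sumr_ge0 => i _; rewrite mulr_ge0// mass_ge0.
have mb i : measurable_fun setT (fun w => r i * big_sum (C i) w).
  by apply: measurable_funM => //; exact: measurable_big_sum.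
pose A := [set w | e <= f w].
have mA : measurable A by exact: measurable_level_ge.
apply: (@le_trans _ _ (P (A `|` N))).
  apply: le_measure_ae.
  - by apply: measurable_norm_ge; exact: measurable_sum.
  - exact: measurableU.
  have : {ae P, forall w, forall i, (mu w (big_slab (C i) 1) < +oo)%E}.
    by apply: ae_foralln => i; exact: (prm_finite Hmu (big_slab_thin Hlevy nuE (fC i) ltr01)).
  apply: filterS => w fin ew.
  have [Nw|/negP/negPn/eqP BK] := pselect (N w); first by right.
  left; rewrite /A /=; apply: (le_trans ew).
  apply: (le_trans (ler_norm_sum _ _ _)); rewrite /f mulr_sumr.
  apply: ler_sum => i _; rewrite normrM mulrCA ler_wpM2l//.
  have CK : mu w (big_slab (C i) K.+1%:R) = 0%E.
    apply/eqP; rewrite eq_le measure_ge0 andbT -[leRHS]BK; apply: le_measureS.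
    - exact: measurable_big_slab.
    - exact: measurable_big_slab.
    - by move=> y [/CB By yK].
  have h := mark_big_slab_le (mC i) CK.
  have m0 : (0 <= mark (mu w) (big_slab (C i) 1))%E.
    by apply: mark_ge0; exact: marked_big_slab.
  rewrite /big_sum ger0_norm ?fine_ge0// /mass -lee_fin EFinM !fineK//.
  - by rewrite ge0_fin_numE.
  - by rewrite ge0_fin_numE// (le_lt_trans h)// lte_mul_pinfty.
apply: (le_trans (measureU2 _ mA mN)); apply: leeD; last first.
  apply: (le_trans (prm_neq0 Hmu (big_slab_thin Hlevy nuE fB _))) => //.
  by rewrite (nu_big_slab Hlevy nuE)// finite_areaE.
have l1 : lambda `]1%R, +oo[%classic \is a fin_num.
  by rewrite ge0_fin_numE// levy_tail.
have := markov_ge P e0 mf f0; rewrite -lee_pdivlMl// => /le_trans; apply.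
under eq_integral do rewrite EFinM -sumEFin.
rewrite ge0_integralZl//; first last.
- by move=> w _; apply: sume_ge0 => i _; rewrite lee_fin mulr_ge0// mass_ge0.
- apply: emeasurable_sum => i; apply/measurable_EFinP; exact: measurable_funM.
rewrite ge0_integral_sum//; first last.
- by move=> i w _; rewrite lee_fin mulr_ge0// mass_ge0.
- by move=> i; apply/measurable_EFinP; exact: measurable_funM.
rewrite (eq_bigr (fun i : 'I_n => (`|r i| * area (C i) *
    fine (lambda `]1%R, +oo[%classic))%:E)); last first.
  move=> i _; under eq_integral do rewrite EFinM.
  rewrite ge0_integralZl//; [|exact/measurable_EFinP|by move=> w _; rewrite lee_fin mass_ge0].
  rewrite (prm_mean Hmu (big_slab_thin Hlevy nuE (fC i) ltr01)).
  by rewrite (nu_big_slab Hlevy nuE)// finite_areaE// -[in LHS](fineK l1) -!EFinM mulrA.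
rewrite sumEFin -!EFinM lee_fin -mulr_suml le_eqVlt; apply/orP; left; apply/eqP.
by rewrite mulrC !mulrA.
Qed.

End combinations.

(** The weight r ^ 2 controls the small jumps, through their variance, and the
    weight |r| controls the drift and the big jumps. The size K of the jumps to
    be neglected is fixed first, in terms of B and e; then eta can be chosen. *)
Lemma Lambda_small B (e : R) : finite_area B -> 0 < e ->
  exists2 eta : R, 0 < eta & forall n (C : nat -> set (mR * mR)) (r : nat -> R),
    (forall i, measurable (C i)) -> (forall i, C i `<=` B) -> trivIset setT C ->
    \sum_(i < n) (r i ^+ 2 + `|r i|) * area (C i) <= eta ->
    (P [set w | e <= `|\sum_(i < n) r i * Lambda (C i) w|]%R <= e%:E)%E.
Proof.
move=> fB e0.
have [Y HY] := levy_ito.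
pose x := e / 4.
have x0 : 0 < x by rewrite divr_gt0.
have ab := area_ge0 B.
have y0 : 0 < e / (4 * (area B + 1)) by rewrite divr_gt0// mulr_gt0// ltr_wpDl.
have [K KP] := levy_tail_small y0.
pose l1 := fine (lambda `]1%R, +oo[%classic).
have l10 : 0 <= l1 by exact: fine_ge0.
pose v := square_mark lambda 0 1.
have v0 : 0 <= v by exact: square_mark_ge0.
pose c1 := `|m| / x; pose c2 := 32 * v / x ^+ 2 / x; pose c3 := K.+1%:R * l1 / x / x.
have c10 : 0 <= c1 by rewrite divr_ge0// ltW.
have c20 : 0 <= c2 by apply: divr_ge0; [apply: divr_ge0; [exact: mulr_ge0|exact: sqr_ge0]|exact: ltW].
have c30 : 0 <= c3 by apply: divr_ge0; [apply: divr_ge0; [exact: mulr_ge0|exact: ltW]|exact: ltW].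
pose eta := (1 + c1 + c2 + c3)^-1.
have D0 : 0 < 1 + c1 + c2 + c3 by lra.
exists eta; first by rewrite invr_gt0.
move=> n C r mC CB tC Hs.
have fC i : finite_area (C i) := finite_areaS fB (mC i) (CB i).
pose s2 := \sum_(i < n) r i ^+ 2 * area (C i).
pose s1 := \sum_(i < n) `|r i| * area (C i).
have s20 : 0 <= s2 by apply: sumr_ge0 => i _; exact: mulr_ge0 (sqr_ge0 _) (area_ge0 _).
have s10 : 0 <= s1 by apply: sumr_ge0 => i _; rewrite mulr_ge0// area_ge0.
have s12 : s2 + s1 <= eta.
  apply: le_trans Hs; rewrite -big_split/= le_eqVlt; apply/orP; left; apply/eqP.
  by apply: eq_bigr => i _; rewrite mulrDl.
have sc : (s2 + s1) * (1 + c1 + c2 + c3) <= 1.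
  by rewrite -ler_pdivlMr// mul1r.
have sc1 : c1 * s1 <= 1 by nra.
have sc2 : c2 * s2 <= 1 by nra.
have sc3 : c3 * s1 <= 1 by nra.
have drift : `|m * \sum_(i < n) r i * area (C i)| <= x.
  rewrite normrM; apply: (@le_trans _ _ (`|m| * s1)).
    rewrite ler_wpM2l// (le_trans (ler_norm_sum _ _ _))//.
    by apply: ler_sum => i _; rewrite normrM (ger0_norm (area_ge0 _)).
  by move: sc1; rewrite /c1 mulrAC ler_pdivrMr// mul1r.
have mY i : measurable_fun setT (fun w => r i * Y (C i) w).
  by apply: measurable_funM => //; exact: measurableRV.
have mb i : measurable_fun setT (fun w => r i * big_sum (C i) w).
  by apply: measurable_funM => //; exact: measurable_big_sum.
have mL i : measurable_fun setT (fun w => r i * Lambda (C i) w).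
  by apply: measurable_funM => //; exact: measurableRV.
pose A1 := [set w | 2 * x <= `|\sum_(i < n) r i * Y (C i) w|].
pose A2 := [set w | x <= `|\sum_(i < n) r i * big_sum (C i) w|].
have mA1 : measurable A1 by apply: measurable_norm_ge; exact: measurable_sum.
have mA2 : measurable A2 by apply: measurable_norm_ge; exact: measurable_sum.
apply: (@le_trans _ _ (P (A1 `|` A2))).
  apply: le_measure_ae; [by apply: measurable_norm_ge; exact: measurable_sum|exact: measurableU|].
  have : {ae P, forall w, forall i, Lambda (C i) w = m * area (C i) + Y (C i) w + big_sum (C i) w}.
    by apply: ae_foralln => i; have [] := HY _ (fC i).
  apply: filterS => w LE /=.
  rewrite (eq_bigr (fun i : 'I_n => m * (r i * area (C i)) + r i * Y (C i) w +
      r i * big_sum (C i) w)); last by move=> i _; rewrite LE; ring.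
  rewrite !big_split/= -mulr_sumr => ew.
  rewrite /A1 /A2 /=; move: drift ew.
  set a := m * _; set b := \sum_(i < n) _; set c := \sum_(i < n) _ => drift ew.
  have [h|h] := leP (2 * x) `|b|; [by left|right].
  have := ler_normD (a + b) c; have := ler_normD a b; move: drift ew h.
  by rewrite /x; lra.
apply: (le_trans (measureU2 _ mA1 mA2)).
have h1 := @small_combination B C r n fB mC CB tC Y x (fun i => proj1 (HY _ (fC i))) x0.
have h2 := @big_combination B C r n fB mC CB K x x0.
apply: (le_trans (leeD h1 h2)).
have hK : ((area B)%:E * lambda `]K.+1%:R, +oo[%classic <= x%:E)%E.
  apply: (le_trans (lee_wpmul2l _ KP)); first by rewrite lee_fin.
  rewrite -EFinM lee_fin mulrA ler_pdivrMr ?mulr_gt0 ?ltr_wpDl// /x.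
  rewrite (_ : e / 4 * (4 * (area B + 1)) = e * area B + e); last by field.
  by rewrite mulrC lerDl ltW.
apply: (le_trans (leeD (lexx _) (leeD (lexx _) hK))).
rewrite -!EFinD lee_fin -/s2 -/s1 -/l1 -/v.
have q2 : 32 * s2 * v / x ^+ 2 <= x.
  move: sc2; rewrite /c2 mulrAC ler_pdivrMr// mul1r => h.
  by apply: le_trans h; rewrite le_eqVlt; apply/orP; left; apply/eqP; ring.
have q3 : K.+1%:R * s1 * l1 / x <= x.
  move: sc3; rewrite /c3 mulrAC ler_pdivrMr// mul1r => h.
  by apply: le_trans h; rewrite le_eqVlt; apply/orP; left; apply/eqP; ring.
by move: q2 q3; rewrite {2 4}/x; move: x0; rewrite /x; lra.
Qed.

End levy_basis.

(** * Integrals of simple functions close to an indicator *)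

Section simple_enumeration.
Context {d : measure_display} {T : measurableType d} {R : realType}.
Local Notation mR := (measurableTypeR R).
Variable f : {sfun T >-> mR}.

Lemma sfun_enumeration : exists (n : nat) (v : nat -> R),
  [/\ forall i j, (i < n)%N -> (j < n)%N -> v i = v j -> i = j,
      forall F : R -> R, \sum_(r \in range f) F r = \sum_(i < n) F (v i)
    & forall y, exists2 i, (i < n)%N & f y = v i].
Proof.
pose s : seq mR := fset_set (range f).
have us : uniq s by exact: fset_uniq.
exists (size s), (fun i => nth (0 : R) s i); split.
- by move=> i j si sj /eqP; rewrite nth_uniq// => /eqP.
- move=> F; rewrite fsbig_finite//=.
  by rewrite (big_nth (0 : R)) big_mkord.
- move=> y; have ys : f y \in s.
    have : f y \in fset_set (range f) by rewrite in_fset_set//; apply/mem_set; exists y.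
    by [].
  by exists (index (f y) s); rewrite ?index_mem// nth_index.
Qed.

Lemma measurable_sfun_level (r : R) : measurable (f @^-1` [set r]).
Proof. by rewrite -[X in measurable X]setTI; exact: (@measurable_funP _ _ _ _ setT f). Qed.

End simple_enumeration.

Section integral_uniqueness.
Context {d : measure_display} {Omega : measurableType d} {R : realType}.
Local Notation mR := (measurableTypeR R).
Local Notation L2 := (@lebesgue_measure R \x @lebesgue_measure R)%E.
Variables (P : probability Omega R) (m : R) (lambda : {measure set mR -> \bar R})
  (mu : R.-ker Omega ~> (mR * mR * mR)%type)
  (nu : {measure set (mR * mR * mR) -> \bar R})
  (Lambda : set (mR * mR) -> {RV P >-> mR}).
Hypothesis Hlevy : levy_measure lambda.
Hypothesis nuE : (nu : set _ -> \bar R) = intensity lambda.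
Hypothesis Hmu : poisson_random_measure P marked_half_plane nu mu.
Hypothesis HL : is_levy_basis m lambda mu Lambda.
Implicit Types (A B : set (mR * mR)).

Let measurableRV (Z : {RV P >-> mR}) : measurable_fun setT (Z : Omega -> R).
Proof. exact: (@measurable_funP _ _ _ _ setT Z). Qed.

Variable G : set (mR * mR).
Hypothesis fG : finite_area G.

Let mG : measurable G. Proof. by case: fG. Qed.

Section one_function.
Variable f : {sfun (mR * mR)%type >-> mR}.
Hypothesis ff : finite_area (f @^-1` [set~ 0]).

(** The error made over A when f replaces the indicator of G. *)
Definition discrepancy A (w : Omega) : R :=
  simple_integral Lambda A f w - Lambda (A `&` G) w.

(** The modulus of continuity in [Lambda_small]. *)
Definition weight (r : R) : R := r ^+ 2 + `|r|.

Definition gap (y : mR * mR) : R := (f y : R) - \1_G y.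

Lemma measurable_simple_integral A :
  measurable_fun setT (simple_integral Lambda A f).
Proof.
have [n [v [_ sumE _]]] := sfun_enumeration f.
rewrite (_ : simple_integral Lambda A f = (fun w => \sum_(i < n) v i * Lambda (A `&` f @^-1` [set v i]) w)).
  by apply: measurable_sum => i; apply: measurable_funM.
by apply/funext => w; rewrite /simple_integral (sumE (fun r => r * Lambda (A `&` f @^-1` [set r]) w)).
Qed.

Lemma measurable_discrepancy A : measurable_fun setT (discrepancy A).
Proof. by apply: measurable_funB => //; exact: measurable_simple_integral. Qed.

Lemma finite_area_level A (r : R) : measurable A -> r != 0 ->
  finite_area (A `&` f @^-1` [set r]).
Proof.
move=> mA r0; apply: (finite_areaS ff); first exact: measurableI (measurable_sfun_level f r).
by move=> y [_ /= ->]; apply/eqP.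
Qed.

Lemma discrepancyU A B : measurable A -> measurable B -> A `&` B = set0 ->
  {ae P, forall w, discrepancy (A `|` B) w = discrepancy A w + discrepancy B w}.
Proof.
move=> mA mB AB0.
have [n [v [_ sumE _]]] := sfun_enumeration f.
have dis Z : (A `&` Z) `&` (B `&` Z) = set0 by rewrite setIACA AB0 set0I.
have LG : {ae P, forall w, Lambda ((A `|` B) `&` G) w = Lambda (A `&` G) w + Lambda (B `&` G) w}.
  rewrite setIUl; apply: (Lambda_setU Hlevy nuE Hmu HL) => //.
  - by apply: (finite_areaS fG); [exact: measurableI|exact: subIsetr].
  - by apply: (finite_areaS fG); [exact: measurableI|exact: subIsetr].
have Lv : {ae P, forall w, forall i, v i * Lambda ((A `|` B) `&` f @^-1` [set v i]) w =
    v i * Lambda (A `&` f @^-1` [set v i]) w + v i * Lambda (B `&` f @^-1` [set v i]) w}.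
  apply: ae_foralln => i; have [->|v0] := eqVneq (v i) 0.
    by apply: nearW => w; rewrite !mul0r addr0.
  have := Lambda_setU Hlevy nuE Hmu HL (finite_area_level mA v0) (finite_area_level mB v0) (dis _).
  by rewrite -setIUl; apply: filterS => w ->; rewrite mulrDr.
move: LG Lv; apply: filterS2 => w LG Lv.
rewrite /discrepancy /simple_integral.
rewrite !(sumE (fun r => r * Lambda (_ `&` f @^-1` [set r]) w)) LG.
under eq_bigr do rewrite Lv.
by rewrite big_split/=; ring.
Qed.

Lemma discrepancy_support A w :
  discrepancy A w = discrepancy (A `&` (f @^-1` [set~ 0] `|` G)) w.
Proof.
have [n [v [_ sumE _]]] := sfun_enumeration f.
rewrite /discrepancy /simple_integral.
rewrite !(sumE (fun r => r * Lambda (_ `&` f @^-1` [set r]) w)).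
congr (_ - _); last first.
  congr (Lambda _ w); apply/seteqP; split => y; first by move=> [? ?]; split => //; split => //; right.
  by move=> [[]].
apply: eq_bigr => i _; have [->|v0] := eqVneq (v i) 0; first by rewrite !mul0r.
congr (_ * Lambda _ w); apply/seteqP; split => y.
  by move=> [Ay /= fy]; split => //; split => //; left; rewrite /= fy; apply/eqP.
by move=> [[]].
Qed.

Lemma weight_ge0 r : 0 <= weight r.
Proof. by rewrite addr_ge0 ?sqr_ge0. Qed.

Lemma measurable_gap : measurable_fun setT gap.
Proof.
apply: measurable_funB; first exact: (@measurable_funP _ _ _ _ setT f).
exact: measurable_indic.
Qed.

Lemma measurable_weight_gap A : measurable_fun A (fun y => (weight (gap y))%:E).
Proof.
apply/measurable_EFinP; apply: measurable_funTS; apply: measurable_funD.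
  by apply: measurable_funX; exact: measurable_gap.
by apply: measurableT_comp => //; exact: measurable_gap.
Qed.

Lemma weight_sum A (c : R) n (v : nat -> R) : finite_area A ->
  (forall i j, (i < n)%N -> (j < n)%N -> v i = v j -> i = j) ->
  (forall y, A y -> gap y = (f y : R) - c) ->
  ((\sum_(i < n) weight (v i - c) * area (A `&` f @^-1` [set v i]))%:E <=
   \int[L2]_(y in A) (weight (gap y))%:E)%E.
Proof.
move=> fA vinj gE; have [mA _ _] := fA.
pose F i := A `&` f @^-1` [set v i].
have mF i : measurable (F i) by exact: measurableI (measurable_sfun_level f _).
have FA : \big[setU/set0]_(i <- iota 0 n) F i `<=` A.
  by rewrite -bigcup_seq => y [i _ []].
apply: (@le_trans _ _ (\int[L2]_(y in \big[setU/set0]_(i <- iota 0 n) F i) (weight (gap y))%:E)%E); last first.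
  apply: ge0_subset_integral => //.
  - by apply: bigsetU_measurable.
  - exact: measurable_weight_gap.
  - by move=> y _; rewrite lee_fin weight_ge0.
rewrite ge0_integral_bigsetU//.
- rewrite -sumEFin -(big_mkord xpredT (fun i => (weight (v i - c) * area (F i))%:E)).
  rewrite /index_iota subn0; apply: lee_sum => i _.
  have fFi : finite_area (F i) by apply: (finite_areaS fA) => //; exact: subIsetl.
  rewrite EFinM -finite_areaE//.
  rewrite -[leLHS](integral_cst L2 (mF i) (weight (v i - c))%:E).
  apply: ge0_le_integral => //.
  + by move=> y _; rewrite lee_fin weight_ge0.
  + exact: measurable_weight_gap.
  + by move=> y [Ay /= fy]; rewrite gE// fy.
- exact: iota_uniq.
- move=> i j /=; rewrite !mem_iota !add0n/= => ni nj [y [[_ /= fi] [_ /= fj]]].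
  by apply: vinj => //; rewrite -fi -fj.
- exact: measurable_weight_gap.
- by move=> y _; rewrite lee_fin weight_ge0.
Qed.

End one_function.

(** Over A `&` G the discrepancy is the integral of f - 1, and over A `\` G it is
    that of f. Both are combinations of the values of Lambda on level sets of f,
    so [Lambda_small] applies. *)
Lemma discrepancy_small B (e : R) : finite_area B -> 0 < e ->
  exists2 eta : R, 0 < eta & forall (f : {sfun (mR * mR)%type >-> mR}) A,
    finite_area (f @^-1` [set~ 0]) -> measurable A -> A `<=` B ->
    (\int[L2]_(y in A) (weight (gap f y))%:E <= eta%:E)%E ->
    (P [set w | e <= `|discrepancy f A w|]%R <= e%:E)%E.
Proof.
move=> fB e0; have e20 : 0 < e / 2 by rewrite divr_gt0.
have [eta eta0 Heta] := Lambda_small Hlevy nuE Hmu HL fB e20.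
exists eta => // f A ff mA AB wA.
have [n [v [vinj sumE fv]]] := sfun_enumeration f.
have est A' (c : R) : measurable A' -> A' `<=` A ->
    (forall y, A' y -> gap f y = (f y : R) - c) ->
    (P [set w | e / 2 <= `|\sum_(i < n) (v i - c) * Lambda (A' `&` f @^-1` [set v i]) w|]%R <= (e / 2)%:E)%E.
  move=> mA' A'A gE.
  have fA' : finite_area A' by apply: (finite_areaS fB) => //; exact: subset_trans AB.
  pose C i := if (i < n)%N then A' `&` f @^-1` [set v i] else set0.
  have CE (i : 'I_n) : C i = A' `&` f @^-1` [set v i] by rewrite /C ltn_ord.
  have mC i : measurable (C i).
    rewrite /C; case: ifP => // _; exact: measurableI (measurable_sfun_level f _).
  have CB i : C i `<=` B.
    by rewrite /C; case: ifP => _ y //; move=> [/A'A/AB].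
  have tC : trivIset setT C.
    move=> i j _ _ [y []]; rewrite /C; case: ifPn => // ni [_ /= fi].
    by case: ifPn => // nj [_ /= fj]; apply: vinj => //; rewrite -fi -fj.
  have := Heta n C (fun i => v i - c) mC CB tC.
  under eq_bigr do rewrite CE.
  have SE w : \sum_(i < n) (v i - c) * Lambda (A' `&` f @^-1` [set v i]) w =
      \sum_(i < n) (v i - c) * Lambda (C i) w.
    by apply: eq_bigr => i _; rewrite CE.
  rewrite (_ : [set w | e / 2 <= `|\sum_(i < n) (v i - c) * Lambda (A' `&` f @^-1` [set v i]) w|] =
      [set w | e / 2 <= `|\sum_(i < n) (v i - c) * Lambda (C i) w|]); last first.
    by apply/seteqP; split => w /=; rewrite SE.
  apply; rewrite -lee_fin; apply: le_trans (le_trans (weight_sum fA' vinj gE) _).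
    by [].
  apply: le_trans wA; apply: ge0_subset_integral => //.
  - exact: measurable_weight_gap.
  - by move=> y _; rewrite lee_fin weight_ge0.
have mAG : measurable (A `&` G) by exact: measurableI.
have mAD : measurable (A `\` G) by exact: measurableD.
have fAG : finite_area (A `&` G) by apply: (finite_areaS fG) => //; exact: subIsetr.
have gG y : (A `&` G) y -> gap f y = (f y : R) - 1.
  by move=> [_ Gy]; rewrite /gap indicE mem_set.
have gD y : (A `\` G) y -> gap f y = (f y : R) - 0.
  by move=> [_ Gy]; rewrite /gap indicE memNset.
have h1 := est _ _ mAG (@subIsetl _ _ _) gG.
have h2 := est _ _ mAD (@subDsetl _ _ _) gD.
pose S1 w := \sum_(i < n) (v i - 1) * Lambda ((A `&` G) `&` f @^-1` [set v i]) w.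
pose S2 w := \sum_(i < n) (v i - 0) * Lambda ((A `\` G) `&` f @^-1` [set v i]) w.
have mS1 : measurable_fun setT S1.
  by apply: measurable_sum => i; apply: measurable_funM.
have mS2 : measurable_fun setT S2.
  by apply: measurable_sum => i; apply: measurable_funM.
have LG : {ae P, forall w, Lambda (A `&` G) w =
    \sum_(i < n) Lambda ((A `&` G) `&` f @^-1` [set v i]) w}.
  pose F i := (A `&` G) `&` f @^-1` [set v i].
  have fF i : finite_area (F i).
    by apply: (finite_areaS fAG); [exact: measurableI (measurable_sfun_level f _)|exact: subIsetl].
  have part k : (k <= n)%N -> finite_area (\big[setU/set0]_(i < k) F i) /\
      {ae P, forall w, Lambda (\big[setU/set0]_(i < k) F i) w = \sum_(i < k) Lambda (F i) w}.
    elim: k => [_|k IH kn].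
      rewrite big_ord0; have f0 : finite_area (set0 : set (mR * mR)).
        by apply: (finite_areaS fG) => //; exact: sub0set.
      split => //; have := Lambda_null Hlevy nuE Hmu HL f0.
      rewrite /leb2 measure0 => /(_ erefl).
      by apply: filterS => w ->; rewrite big_ord0.
    have [IH1 IH2] := IH (ltnW kn); rewrite big_ord_recr/=.
    split; first exact: finite_areaU.
    have dis : \big[setU/set0]_(i < k) F i `&` F k = set0.
      rewrite -(bigcup_mkord k F); apply/seteqP; split => // y [[i /= ik [_ /= fi]] [_ /= fk]].
      have ek : i = k by apply: vinj; rewrite -?fi -?fk// (ltn_trans ik).
      by rewrite ek ltnn in ik.
    have := Lambda_setU Hlevy nuE Hmu HL IH1 (fF k) dis.
    by move: IH2; apply: filterS2 => w IH2 ->; rewrite big_ord_recr/= IH2.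
  have [_ +] := part n (leqnn n).
  rewrite (_ : \big[setU/set0]_(i < n) F i = A `&` G)//.
  rewrite -(bigcup_mkord n F); apply/seteqP; split => y; first by move=> [i _ []].
  by move=> AGy; have [i ni fi] := fv y; exists i.
have L0 : {ae P, forall w, Lambda ((A `\` G) `&` G) w = 0}.
  have f0 : finite_area (set0 : set (mR * mR)).
    by apply: (finite_areaS fG) => //; exact: sub0set.
  have := Lambda_null Hlevy nuE Hmu HL f0.
  have -> : (A `\` G) `&` G = set0 by rewrite setIC setDIK.
  by rewrite /leb2 measure0 => /(_ erefl).
have dE : {ae P, forall w, discrepancy f A w = S1 w + S2 w}.
  have := discrepancyU ff mAG mAD; rewrite setDE setIACA setICr setI0 -setDE => /(_ erefl).
  rewrite setUIDK.
  move: LG L0; apply: filterS3 => w LG L0 ->; rewrite /discrepancy /simple_integral.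
  rewrite !(sumE (fun r => r * Lambda (_ `&` f @^-1` [set r]) w)) L0 subr0.
  rewrite -setIA setIid LG -sumrB; congr (_ + _); apply: eq_bigr => i _.
    by rewrite mulrBl mul1r.
  by rewrite subr0.
apply: (@le_trans _ _ (P [set w | e / 2 + e / 2 <= `|S1 w + S2 w|])).
  apply: le_measure_ae.
  - by apply: measurable_norm_ge; exact: measurable_discrepancy.
  - by apply: measurable_norm_ge; exact: measurable_funD.
  - by move: dE; apply: filterS => w /= ->; rewrite -splitr.
apply: (le_trans (probability_normD P _ _ mS1 mS2)).
by apply: (le_trans (leeD h1 h2)); rewrite -EFinD -splitr.
Qed.

End integral_uniqueness.

(** * The integral of an indicator is the value of the basis *)

Lemma lebesgue_measure_itvoc {R : realType} (i j : bool) (a b : R) : a <= b ->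
  lebesgue_measure ([set` Interval (BSide i a) (BSide j b)] : set (measurableTypeR R)) = (b - a)%:E.
Proof.
move=> ab; rewrite lebesgue_measure_itv/= lte_fin; case: ltP => [//|ba].
have -> : a = b by apply/eqP; rewrite eq_le ab ba.
by rewrite subrr.
Qed.

Lemma leb2_rectangle {R : realType} (i j k l : bool) (a b c d : R) : a <= b -> c <= d ->
  leb2 ([set` Interval (BSide i a) (BSide j b)] `*` [set` Interval (BSide k c) (BSide l d)]
     : set (measurableTypeR R * measurableTypeR R)) = ((b - a) * (d - c))%:E.
Proof.
move=> ab cd; rewrite /leb2 product_measure1E//.
rewrite EFinM; congr (_ * _)%E; exact: lebesgue_measure_itvoc.
Qed.

Section gliding_hump.
Context {d : measure_display} {Omega : measurableType d} {R : realType}.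
Local Notation mR := (measurableTypeR R).
Local Notation L2 := (@lebesgue_measure R \x @lebesgue_measure R)%E.
Variables (P : probability Omega R) (m : R) (lambda : {measure set mR -> \bar R})
  (mu : R.-ker Omega ~> (mR * mR * mR)%type)
  (nu : {measure set (mR * mR * mR) -> \bar R})
  (Lambda : set (mR * mR) -> {RV P >-> mR}).
Hypothesis Hlevy : levy_measure lambda.
Hypothesis nuE : (nu : set _ -> \bar R) = intensity lambda.
Hypothesis Hmu : poisson_random_measure P marked_half_plane nu mu.
Hypothesis HL : is_levy_basis m lambda mu Lambda.
Implicit Types (A B : set (mR * mR)).

Let measurableRV (Z : {RV P >-> mR}) : measurable_fun setT (Z : Omega -> R).
Proof. exact: (@measurable_funP _ _ _ _ setT Z). Qed.

Variables (D G : set (mR * mR)) (f_ : nat -> {sfun (mR * mR)%type >-> mR}).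
Hypothesis mD : measurable D.
Hypothesis DH : D `<=` half_plane.
Hypothesis GD : G `<=` D.
Hypothesis fG : finite_area G.
Hypothesis ff : forall n, finite_area (f_ n @^-1` [set~ 0]).
Hypothesis fcvg : {ae L2, forall y, D y -> (f_ n y : R) @[n --> \oo] --> (\1_G y : R)}.

Let mG : measurable G. Proof. by case: fG. Qed.

Local Notation h := (fun n => gap G (f_ n)).
Local Notation I := (fun n => discrepancy Lambda G (f_ n)).

(** Dominated convergence holds on these sets, which exhaust D up to a null set;
    the cut-off by a square makes their area finite. *)
Definition uniform_part (k : nat) : set (mR * mR) :=
  D `&` ([set y | (`|y.1 : R| <= k%:R) && (`|y.2 : R| <= k%:R)] `&`
    \bigcap_n [set y | `|h n y| <= k%:R]).

Definition remainder (k : nat) : set (mR * mR) := D `\` uniform_part k.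

Lemma measurable_uniform_part k : measurable (uniform_part k).
Proof.
have mle (g : mR * mR -> R) : measurable_fun setT g -> measurable [set y | `|g y| <= k%:R].
  move=> mg; rewrite (_ : [set y | _] = ~` [set y | k%:R < `|g y|]).
    by apply: measurableC; exact: measurable_norm_gt.
  by apply/seteqP; split => y /=; rewrite leNgt; move=> /negP.
apply: measurableI => //; apply: measurableI.
  rewrite (_ : [set y | _] = [set y : mR * mR | `|y.1 : R| <= k%:R] `&` [set y : mR * mR | `|y.2 : R| <= k%:R]).
    by apply: measurableI; apply: mle; [exact: measurable_fst|exact: measurable_snd].
  by apply/seteqP; split => y /=; [move/andP|move=> [-> ->]].
by apply: bigcapT_measurable => n; apply: mle; exact: measurable_gap.
Qed.

Lemma measurable_remainder k : measurable (remainder k).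
Proof. by apply: measurableD => //; exact: measurable_uniform_part. Qed.

Lemma uniform_partS k l : (k <= l)%N -> uniform_part k `<=` uniform_part l.
Proof.
move=> kl y [Dy [/andP[y1 y2] hy]]; have kl' : k%:R <= l%:R :> R by rewrite ler_nat.
split => //; split; first by rewrite /= (le_trans y1)// (le_trans y2).
by move=> n _ /=; apply: le_trans (hy n Logic.I) kl'.
Qed.

Lemma remainderS k l : (k <= l)%N -> remainder l `<=` remainder k.
Proof. by move=> kl; apply: setDS; exact: uniform_partS. Qed.

Lemma finite_area_uniform_part k : finite_area (uniform_part k).
Proof.
have mI (i : interval R) : measurable ([set` i] : set mR) by exact: measurable_itv.
have fbox : finite_area (`[0%R, k%:R]%classic `*` `[- k%:R, k%:R]%classic : set (mR * mR)).
  split; first exact: measurableX.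
  - move=> y [/=]; rewrite in_itv/= => /andP[y0 _] _; split => //=.
    by rewrite in_itv/= y0.
  - by rewrite leb2_rectangle ?ltry// (le_trans _ (ler0n _ _))// oppr_le0.
apply: (finite_areaS fbox); first exact: measurable_uniform_part.
move=> y [Dy [/andP[y1 y2] _]]; split => /=; rewrite in_itv/=.
  have [/= + _] := DH Dy; rewrite in_itv/= andbT => y0.
  by rewrite y0 (le_trans (ler_norm _) y1).
by rewrite -ler_norml.
Qed.

Lemma gap_cvg : {ae L2, forall y, D y -> h n y @[n --> \oo] --> (0 : R)}.
Proof.
move: fcvg; apply: filterS => y fy Dy.
have := cvgB (fy Dy) (cvg_cst (\1_G y : R)); rewrite subrr.
by apply.
Qed.

Lemma bigcap_remainder_null : L2 (\bigcap_k remainder k) = 0%E.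
Proof.
have [N [mN N0 DN]] := gap_cvg.
apply/eqP; rewrite eq_le measure_ge0 andbT -N0; apply: le_measureS => //.
  by apply: bigcapT_measurable => k; exact: measurable_remainder.
move=> y yk; apply: DN => /= hy.
have [Dy _] := yk 0%N Logic.I.
have cv := hy Dy.
have [M [_ HM]] := cvg_seq_bounded (cvgP _ cv).
pose k := maxn (Num.truncn (M + 1)).+1 (maxn (Num.truncn `|y.1 : R|).+1 (Num.truncn `|y.2 : R|).+1).
have [_] := yk k Logic.I; apply; split => //.
have kM : M + 1 <= k%:R.
  by apply: (le_trans (ltW (truncnS_gt _))); rewrite ler_nat leq_maxl.
have k1 : `|y.1 : R| <= k%:R.
  by apply: (le_trans (ltW (truncnS_gt _))); rewrite ler_nat /k !leq_max leqnn orbT.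
have k2 : `|y.2 : R| <= k%:R.
  by apply: (le_trans (ltW (truncnS_gt _))); rewrite ler_nat /k !leq_max leqnn !orbT.
split; first by rewrite /= k1 k2.
move=> n _ /=; apply: le_trans kM.
by apply: (HM (M + 1)) => //; rewrite ltrDl.
Qed.

Lemma discrepancy_uniform_part k (e : R) : 0 < e ->
  exists N, forall n, (N <= n)%N -> forall A, measurable A -> A `<=` uniform_part k ->
    (P [set w | e <= `|I n A w|]%R <= e%:E)%E.
Proof.
move=> e0; have fU := finite_area_uniform_part k.
have mU := measurable_uniform_part k.
have [eta eta0 Heta] := discrepancy_small Hlevy nuE Hmu HL fG fU e0.
have [_ _ cv] : [/\ L2.-integrable (uniform_part k) (cst 0%E : mR * mR -> \bar R),
    (\int[L2]_(y in uniform_part k) `|(weight (h n y))%:E - cst 0%E y|)%E @[n --> \oo] --> 0%E &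
    (\int[L2]_(y in uniform_part k) (weight (h n y))%:E)%E @[n --> \oo] -->
      (\int[L2]_(y in uniform_part k) cst 0%E y)%E].
  apply: (@dominated_convergence _ _ _ L2 (uniform_part k) mU
    (fun n y => (weight (h n y))%:E) (cst 0%E) (cst (weight k%:R)%:E)).
  - by move=> n; exact: measurable_weight_gap.
  - exact: measurable_cst.
  - move: gap_cvg; apply: filterS => y hy [Dy _]; apply/cvg_EFin.
      by apply: nearW.
    have c0 := hy Dy.
    have := cvgD (cvgM c0 c0) (cvg_norm c0); rewrite mulr0 normr0 addr0.
    by apply.
  - apply/integrableP; split; first exact: measurable_cst.
    rewrite (_ : (fun x => _) = cst (weight k%:R)%:E); last first.
      by apply/funext => y /=; rewrite ger0_norm// weight_ge0.
    rewrite integral_cst// lte_mul_pinfty ?lee_fin ?weight_ge0//.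
    by case: fU.
  - apply: nearW => y n [_ [_ /(_ n Logic.I) hy]].
    rewrite /= lee_fin ger0_norm ?weight_ge0//.
    rewrite /weight [leRHS]/(_ + _) (ger0_norm (ler0n _ k)); apply: lerD => //.
    by rewrite -(real_normK (num_real (h n y))) lerXn2r ?nnegrE.
rewrite integral0 in cv.
have W0 n : (0 <= \int[L2]_(y in uniform_part k) (weight (h n y))%:E)%E.
  by apply: integral_ge0 => y _; rewrite lee_fin weight_ge0.
have [N _ HN] := (iffLR (cvge0P W0) cv) eta eta0.
exists N => n Nn A mA AU; apply: Heta => //.
apply: le_trans (HN n Nn); apply: ge0_subset_integral => //.
- exact: measurable_weight_gap.
- by move=> y _; rewrite lee_fin weight_ge0.
Qed.

Lemma gap_bounded n : exists2 M : R, 0 <= M & forall y, weight (h n y) <= M.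
Proof.
have [N [v [_ _ fv]]] := sfun_enumeration (f_ n).
exists (\sum_(i < N) (weight (v i) + weight (v i - 1))).
  by apply: sumr_ge0 => i _; rewrite addr_ge0 ?weight_ge0.
move=> y; have [i iN fi] := fv y.
rewrite (bigD1 (Ordinal iN))//=.
have w1 := weight_ge0 (v i); have w2 := weight_ge0 (v i - 1).
have S0 : 0 <= \sum_(j < N | j != Ordinal iN) (weight (v j) + weight (v j - 1)).
  by apply: sumr_ge0 => j _; rewrite addr_ge0 ?weight_ge0.
rewrite /gap fi indicE; case: (y \in G); rewrite /= ?subr0.
  by rewrite -[leLHS]add0r -[leLHS]addr0; apply: lerD => //; exact: lerD.
by rewrite -[leLHS]addr0; apply: lerD => //; rewrite -[leLHS]addr0; exact: lerD.
Qed.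

(** For a given n the discrepancy lives on the finite-area set where f_ n or the
    indicator of G is not zero, and the part of it in the remainder shrinks to a
    null set. *)
Lemma discrepancy_remainder n (e : R) : 0 < e ->
  exists K, forall k, (K <= k)%N -> forall A, measurable A -> A `<=` remainder k ->
    (P [set w | e <= `|I n A w|]%R <= e%:E)%E.
Proof.
move=> e0; pose F := f_ n @^-1` [set~ 0] `|` G.
have fF : finite_area F by exact: finite_areaU.
have [mF _ lF] := fF.
have [eta eta0 Heta] := discrepancy_small Hlevy nuE Hmu HL fG fF e0.
have [M M0 hM] := gap_bounded n.
pose r k := remainder k `&` F.
have mr k : measurable (r k) by apply: measurableI => //; exact: measurable_remainder.
have cv : (L2 \o r) k @[k --> \oo] --> 0%E.
  have <- : L2 (\bigcap_k r k) = 0%E.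
    apply/eqP; rewrite eq_le measure_ge0 andbT -bigcap_remainder_null.
    apply: le_measureS.
    - exact: bigcapT_measurable.
    - by apply: bigcapT_measurable => k; exact: measurable_remainder.
    - by move=> y yr k _; have [] := yr k Logic.I.
  apply: nonincreasing_cvg_mu => //.
  - by apply: le_lt_trans lF; apply: le_measureS => //; exact: subIsetr.
  - exact: bigcapT_measurable.
  - by move=> k l kl; apply/subsetPset; apply: setSI; exact: remainderS.
have e1 : 0 < eta / (M + 1) by rewrite divr_gt0// ltr_wpDl.
have [K _ HK] := (iffLR (cvge0P (fun k => measure_ge0 L2 (r k))) cv) _ e1.
exists K => k Kk A mA Ar.
rewrite (_ : [set w | _] = [set w | e <= `|I n (A `&` F) w|]); last first.
  by apply/seteqP; split => w /=; rewrite -discrepancy_support.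
have mAF : measurable (A `&` F) by exact: measurableI.
apply: Heta => //.
apply: (@le_trans _ _ (M%:E * L2 (A `&` F))%E).
  rewrite -integral_cst//; apply: ge0_le_integral => //.
  - by move=> y _; rewrite lee_fin weight_ge0.
  - exact: measurable_weight_gap.
  - by move=> y _; rewrite lee_fin.
apply: (@le_trans _ _ (M%:E * (eta / (M + 1))%:E)%E).
  rewrite lee_wpmul2l ?lee_fin//; apply: le_trans (HK k Kk).
  by apply: le_measureS => //; exact: setSI.
rewrite -EFinM lee_fin mulrA ler_pdivrMr ?ltr_wpDl//.
by rewrite mulrC ler_wpM2l ?(ltW eta0)// lerDl.
Qed.

(** The bounds inside a uniform part (k given, n large) and on a remainder (n
    given, k large) are used in turn: n_ j is chosen after k_ j and before
    k_ j.+1. What is not controlled at the stage j is the layer between the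
    uniform parts k_ j and k_ j.+1. *)
Lemma gliding_sequences : exists k_ n_ : nat -> nat,
  [/\ forall i j, (i <= j)%N -> (k_ i <= k_ j)%N,
      forall j, (j <= n_ j)%N,
      forall j A, measurable A -> A `<=` uniform_part (k_ j) ->
        (P [set w | j.+1%:R^-1 <= `|I (n_ j) A w|]%R <= j.+1%:R^-1%:E)%E
    & forall j A, measurable A -> A `<=` remainder (k_ j.+1) ->
        (P [set w | j.+1%:R^-1 <= `|I (n_ j) A w|]%R <= j.+1%:R^-1%:E)%E].
Proof.
have [Nf HN] : exists Nf : nat * nat -> nat, forall q n, (Nf q <= n)%N ->
    forall A, measurable A -> A `<=` uniform_part q.1 ->
    (P [set w | q.2.+1%:R^-1 <= `|I n A w|]%R <= q.2.+1%:R^-1%:E)%E.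
  have H (q : nat * nat) : exists N, forall n, (N <= n)%N ->
      forall A, measurable A -> A `<=` uniform_part q.1 ->
      (P [set w | q.2.+1%:R^-1 <= `|I n A w|]%R <= q.2.+1%:R^-1%:E)%E.
    by apply: discrepancy_uniform_part; rewrite invr_gt0.
  by have [Nf HNf] := choice H; exists Nf.
have [Kf HK] : exists Kf : nat * nat -> nat, forall q k, (Kf q <= k)%N ->
    forall A, measurable A -> A `<=` remainder k ->
    (P [set w | q.2.+1%:R^-1 <= `|I q.1 A w|]%R <= q.2.+1%:R^-1%:E)%E.
  have H (q : nat * nat) : exists K, forall k, (K <= k)%N ->
      forall A, measurable A -> A `<=` remainder k ->
      (P [set w | q.2.+1%:R^-1 <= `|I q.1 A w|]%R <= q.2.+1%:R^-1%:E)%E.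
    by apply: discrepancy_remainder; rewrite invr_gt0.
  by have [Kf HKf] := choice H; exists Kf.
pose step j (s : nat * nat) :=
  let k := maxn s.1 (Kf (s.2, j)) in (k, maxn j.+1 (Nf (k, j.+1))).
pose st := fix st j := if j is j'.+1 then step j' (st j') else (0%N, Nf (0, 0)%N).
exists (fun j => (st j).1), (fun j => (st j).2); split.
- move=> i j; elim: j => [|j IH]; first by rewrite leqn0 => /eqP ->.
  rewrite leq_eqVlt => /predU1P[->//|]; rewrite ltnS => /IH /leq_trans; apply.
  by rewrite /= leq_maxl.
- by case=> [//|j]; rewrite /= leq_maxl.
- case=> [|j] A mA AU; first exact: (HN (0, 0)%N).
  by apply: (HN (_, j.+1)) AU => //; rewrite /= leq_maxr.
- move=> j A mA AR; apply: (HK ((st j).2, j)) AR => //.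
  by rewrite /= leq_maxr.
Qed.

(** If A avoids the layers of parity b, the simple integrals over A converge to
    Lambda (A `&` G) along the stages of that parity. As the whole sequence
    converges, this identifies its limit. *)
Lemma discrepancy_limit0 (b : bool) (k_ n_ : nat -> nat) A (Z : {RV P >-> mR}) :
  (forall j, (j <= n_ j)%N) ->
  (forall j A, measurable A -> A `<=` uniform_part (k_ j) ->
    (P [set w | j.+1%:R^-1 <= `|I (n_ j) A w|]%R <= j.+1%:R^-1%:E)%E) ->
  (forall j A, measurable A -> A `<=` remainder (k_ j.+1) ->
    (P [set w | j.+1%:R^-1 <= `|I (n_ j) A w|]%R <= j.+1%:R^-1%:E)%E) ->
  (forall j, (k_ j <= k_ j.+1)%N) ->
  measurable A -> A `<=` D ->
  (forall j y, odd j = b -> A y -> remainder (k_ j) y -> remainder (k_ j.+1) y) ->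
  cvg_in_prob P \oo (fun n => simple_integral Lambda A (f_ n)) Z ->
  {ae P, forall w, Z w = Lambda (A `&` G) w}.
Proof.
move=> nj HU HR kS mA AD hole cZ.
have mI n A' : measurable_fun setT (I n A') by exact: measurable_discrepancy.
have cI : cvg_in_prob P \oo (fun n => I n A) (fun w => Z w - Lambda (A `&` G) w).
  apply/cvg_in_probP => e x e0 x0.
  have /cvg_in_probP cZ' := cZ; have := cZ' e x e0 x0.
  apply: filterS => n; rewrite (_ : [set w | _ <= `|_ - Z w|] = [set w | e <= `|I n A w - (Z w - Lambda (A `&` G) w)|])//.
  by apply/seteqP; split => w /=; rewrite /discrepancy opprB addrA subrK.
have mW : measurable_fun setT (fun w => Z w - Lambda (A `&` G) w).
  by apply: measurable_funB; exact: measurableRV.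
suff : {ae P, forall w, Z w - Lambda (A `&` G) w = 0}.
  by apply: filterS => w /eqP; rewrite subr_eq0 => /eqP.
apply: ae_eq0P => // e e0; apply/eqP; rewrite eq_le measure_ge0 andbT.
apply/lee_addgt0Pr => x x0; rewrite add0e.
have e20 : 0 < e / 2 by rewrite divr_gt0.
have x20 : 0 < x / 2 by rewrite divr_gt0.
have /cvg_in_probP cI' := cI; have [N _ HN] := cI' (e / 2) (x / 2) e20 x20.
pose j0 := maxn N (maxn (Num.truncn (4 / e)) (Num.truncn (4 / x))).
pose j := (j0.*2 + b)%N.
have jb : odd j = b by rewrite oddD odd_double oddb.
have j0j : (j0 <= j)%N by rewrite /j -addnn -addnA leq_addr.
have small (c : R) : 0 < c -> (Num.truncn (4 / c) <= j0)%N -> j.+1%:R^-1 <= c / 4.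
  move=> c0 cj; have -> : c / 4 = (4 / c)^-1 by rewrite invfM invrK mulrC.
  rewrite lef_pV2 ?posrE ?divr_gt0//.
  by apply: (le_trans (ltW (truncnS_gt _))); rewrite ler_nat ltnS (leq_trans cj).
have je : j.+1%:R^-1 <= e / 4 by apply: small => //; rewrite /j0 !leq_max leqnn orbT.
have jx : j.+1%:R^-1 <= x / 4 by apply: small => //; rewrite /j0 !leq_max leqnn !orbT.
have nN : (N <= n_ j)%N by rewrite (leq_trans _ (nj j))// (leq_trans _ j0j)// leq_maxl.
pose A1 := A `&` uniform_part (k_ j); pose A2 := A `&` remainder (k_ j.+1).
have mA1 : measurable A1 by apply: measurableI => //; exact: measurable_uniform_part.
have mA2 : measurable A2 by apply: measurableI => //; exact: measurable_remainder.
have A12 : A1 `&` A2 = set0.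
  apply/seteqP; split => // y [[_ yU] [_ [_ nU]]]; apply: nU.
  exact: uniform_partS (kS j) _ yU.
have AE : A = A1 `|` A2.
  apply/seteqP; split => y; last by move=> [[]|[]].
  move=> Ay; have [yU|nU] := pselect (uniform_part (k_ j) y); first by left.
  by right; split => //; apply: hole => //; split => //; exact: AD.
have IE := discrepancyU Hlevy nuE Hmu HL fG (ff (n_ j)) mA1 mA2 A12.
rewrite -AE in IE.
have hI : (P [set w | e / 2 <= `|I (n_ j) A w|]%R <= (x / 2)%:E)%E.
  apply: (@le_trans _ _ (P [set w | j.+1%:R^-1 + j.+1%:R^-1 <= `|I (n_ j) A1 w + I (n_ j) A2 w|]%R)).
    apply: le_measure_ae.
    - exact: measurable_norm_ge.
    - by apply: measurable_norm_ge; exact: measurable_funD.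
    - by move: IE; apply: filterS => w /= ->; apply: le_trans; move: (j.+1%:R^-1) je => q; lra.
  apply: (le_trans (probability_normD P _ _ (mI _ _) (mI _ _))).
  apply: (le_trans (leeD (HU j _ mA1 _) (HR j _ mA2 _))); [exact: subIsetr|exact: subIsetr|].
  by rewrite -EFinD lee_fin; move: (j.+1%:R^-1) jx => q; lra.
have hW := HN (n_ j) nN.
rewrite (_ : [set w | e <= _] = [set w | e / 2 + e / 2 <= `|I (n_ j) A w + ((Z w - Lambda (A `&` G) w) - I (n_ j) A w)|]); last first.
  by apply/seteqP; split => w /=; rewrite -splitr addrCA subrr addr0.
apply: (le_trans (probability_normD P _ _ (mI _ _) (measurable_funB mW (mI _ _)))).
rewrite (_ : [set w | e / 2 <= `|Z w - Lambda (A `&` G) w - I (n_ j) A w|] =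
    [set w | e / 2 <= `|I (n_ j) A w - (Z w - Lambda (A `&` G) w)|]); last first.
  by apply/seteqP; split => w /=; rewrite distrC.
by apply: (le_trans (leeD hI hW)); rewrite -EFinD -splitr.
Qed.

(** A gliding hump: D is the union of A, which consists of the layers of odd
    index, and of its complement. Each of the two sets avoids the layers of one
    parity, so the limits over both are known, and they add up to the limit over
    D. The definition of the integral is used in full here: it requires
    convergence over every measurable subset of D. *)
Lemma integral_indicator (X : {RV P >-> mR}) :
  (forall A, measurable A -> A `<=` D -> exists Z : {RV P >-> mR},
    cvg_in_prob P \oo (fun n => simple_integral Lambda A (f_ n)) Z) ->
  cvg_in_prob P \oo (fun n => simple_integral Lambda D (f_ n)) X ->
  {ae P, forall w, X w = Lambda G w}.
Proof.
move=> HZ cX.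
have [k_ [n_ [kS nj HU HR]]] := gliding_sequences.
have kS1 j : (k_ j <= k_ j.+1)%N by exact: kS.
pose A := \bigcup_(j in [set j | odd j]) (remainder (k_ j) `\` remainder (k_ j.+1)).
have mA : measurable A.
  by apply: bigcup_measurable => j _; apply: measurableD; exact: measurable_remainder.
have AD : A `<=` D by move=> y [j _ [[]]].
have mDA : measurable (D `\` A) by exact: measurableD.
have [Z1 cZ1] := HZ A mA AD.
have [Z2 cZ2] := HZ _ mDA (@subDsetl _ _ _).
have E1 : {ae P, forall w, Z1 w = Lambda (A `&` G) w}.
  apply: (@discrepancy_limit0 false k_ n_) => // j y oj [i /= oi [yi nyi]] yj.
  apply: contrapT => nyj.
  have ij : (i < j)%N || (j < i)%N by rewrite -neq_ltn; apply: contraTneq oi => ->; rewrite oj.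
  case/orP: ij => ij.
    by apply: nyi; apply: remainderS yj; exact: kS.
  by apply: nyj; apply: remainderS yi; exact: kS.
have E2 : {ae P, forall w, Z2 w = Lambda ((D `\` A) `&` G) w}.
  apply: (@discrepancy_limit0 true k_ n_) => //.
  move=> j y oj [Dy nAy] yj; apply: contrapT => nyj; apply: nAy.
  by exists j.
have LE : {ae P, forall w, Lambda G w = Lambda (A `&` G) w + Lambda ((D `\` A) `&` G) w}.
  have GE : G = (A `&` G) `|` ((D `\` A) `&` G).
    by rewrite -setIUl setDUK// setIidr.
  have : {ae P, forall w, Lambda ((A `&` G) `|` ((D `\` A) `&` G)) w =
      Lambda (A `&` G) w + Lambda ((D `\` A) `&` G) w}; last by rewrite -GE.
  apply: (Lambda_setU Hlevy nuE Hmu HL).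
  - by apply: (finite_areaS fG); [exact: measurableI|exact: subIsetr].
  - by apply: (finite_areaS fG); [exact: measurableI|exact: subIsetr].
  - by rewrite setIACA setDIK set0I.
have mS B n : measurable_fun setT (simple_integral Lambda B (f_ n)) by exact: measurable_simple_integral.
have mZ : measurable_fun setT (fun w => Z1 w + Z2 w).
  by apply: measurable_funD; exact: measurableRV.
have XE : {ae P, forall w, X w = Z1 w + Z2 w}.
  apply: (cvg_in_prob_unique (mS D) (measurableRV X) mZ cX).
  apply: (@cvg_in_prob_ae _ _ _ P _ \oo _
    (fun n w => simple_integral Lambda A (f_ n) w + simple_integral Lambda (D `\` A) (f_ n) w)
    _ (fun w => Z1 w + Z2 w)) => //.
  - by move=> n; exact: measurable_funD.
  - apply: nearW => n.
    have := discrepancyU Hlevy nuE Hmu HL fG (ff n) mA mDA (setDIK _ _).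
    rewrite setDUK//; move: LE; apply: filterS2 => w LE; rewrite /discrepancy.
    by rewrite (setIidr GD) LE; lra.
  - by apply: nearW.
  - by apply: cvg_in_probD => //; exact: measurableRV.
by move: XE E1 E2 LE => XE E1 E2 LE; apply: filterS3 (filterI XE LE) E1 E2 => w [-> ->] -> ->.
Qed.

End gliding_hump.

(** * Cadlag paths on an interval *)

Section integral_on_decreasing_sets.
Context {d : measure_display} {T : measurableType d} {R : realType}.
Variable m : {measure set T -> \bar R}.

(** Monotone convergence on the complements. *)
Lemma integral_bigcap (f : T -> \bar R) (D : nat -> set T) :
  (forall n, measurable (D n)) -> nonincreasing_seq D ->
  measurable_fun (D 0%N) f -> (forall x, D 0%N x -> 0 <= f x)%E ->
  (\int[m]_(x in D 0%N) f x < +oo)%E ->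
  (\int[m]_(x in D n) f x)%E @[n --> \oo] --> (\int[m]_(x in \bigcap_n D n) f x)%E.
Proof.
move=> mD dD mf f0 fin.
have D0 n : D n `<=` D 0%N by apply/subsetPset; exact: dD.
have mI : measurable (\bigcap_n D n) by exact: bigcapT_measurable.
have ID0 : \bigcap_n D n `<=` D 0%N by move=> x /(_ 0%N); apply.
have fS B : B `<=` D 0%N -> measurable B -> measurable_fun B f.
  by move=> BD mB; exact: measurable_funS mf.
have splitE B : measurable B -> B `<=` D 0%N ->
    (\int[m]_(x in B) f x)%E =
    (\int[m]_(x in D 0%N) f x - \int[m]_(x in D 0%N `\` B) f x)%E.
  move=> mB BD.
  have E : (\int[m]_(x in D 0%N) f x =
      \int[m]_(x in B) f x + \int[m]_(x in D 0%N `\` B) f x)%E.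
    rewrite -[in LHS](setDUK BD) ge0_integral_setU//.
    - exact: measurableD.
    - by rewrite setDUK.
    - by rewrite setDUK.
    - by apply/eqP; rewrite setDIK.
  have fC : (\int[m]_(x in D 0%N `\` B) f x)%E \is a fin_num.
    rewrite ge0_fin_numE; last by apply: integral_ge0 => x [/f0].
    apply: le_lt_trans fin; apply: ge0_subset_integral => //.
    exact: measurableD.
  by rewrite E addeK.
have C : (\int[m]_(x in D 0%N `\` D n) f x)%E @[n --> \oo] -->
    (\int[m]_(x in D 0%N `\` \bigcap_n D n) f x)%E.
  rewrite setDE setC_bigcap setI_bigcupr.
  apply: ge0_nondecreasing_set_cvg_integral.
  - move=> i j ij; apply/subsetPset => x [Dx nx]; split => // jx; apply: nx.
    by have /subsetPset := dD _ _ ij; apply.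
  - by move=> n; exact: measurableD.
  - by move=> n; apply: fS; [exact: subDsetl|exact: measurableD].
  - by move=> n x [/f0].
rewrite (splitE _ mI ID0) (_ : (fun n => _) = (fun n => (\int[m]_(x in D 0%N) f x -
   \int[m]_(x in D 0%N `\` D n) f x)%E)); last by apply/funext => n; exact: splitE.
have f0D : (\int[m]_(x in D 0%N) f x)%E \is a fin_num.
  by rewrite ge0_fin_numE//; exact: integral_ge0.
apply: cvgeB => //; last exact: cvg_cst.
by rewrite fin_num_adde_defr.
Qed.

End integral_on_decreasing_sets.

Section cadlag_on_interval.
Context {R : realType}.
Implicit Types (f g : R -> R) (S T : R).

(** A left limit, but no right limit, is asked for at the end T: this is what a
    piece on [S, T] of a path that continues after T has to satisfy. *)
Definition cadlag_on S T g :=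
  (forall t, S <= t < T -> g x @[x --> t^'+] --> g t) /\
  (forall t, S < t <= T -> cvg (g x @[x --> t^'-])).

Lemma cadlag_onD S T f g : cadlag_on S T f -> cadlag_on S T g ->
  cadlag_on S T (fun t => f t + g t).
Proof.
move=> [fr fl] [gr gl]; split => t tT; first exact: cvgD (fr _ tT) (gr _ tT).
exact: is_cvgD (fl _ tT) (gl _ tT).
Qed.

Lemma cadlag_onZ S T (c : R) g : cadlag_on S T g -> cadlag_on S T (fun t => c * g t).
Proof.
move=> [gr gl]; split => t tT; first exact: cvgMr (gr _ tT).
exact: is_cvgMr (gl _ tT).
Qed.

Lemma cadlag_onB S T f g : cadlag_on S T f -> cadlag_on S T g ->
  cadlag_on S T (fun t => f t - g t).
Proof.
move=> cf cg; have := cadlag_onD cf (cadlag_onZ (-1) cg).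
by congr cadlag_on; apply/funext => t; rewrite mulN1r.
Qed.

Lemma near_right_itv (t u : R) : t < u -> \forall x \near t^'+, t < x < u.
Proof.
move=> tu; apply: filterS2 (nbhs_right_gt t) (nbhs_right_lt tu).
by move=> x -> ->.
Qed.

Lemma near_left_itv (t u : R) : u < t -> \forall x \near t^'-, u < x < t.
Proof.
move=> tu; apply: filterS2 (nbhs_left_lt t) (nbhs_left_gt tu).
by move=> x -> ->.
Qed.

Lemma cadlag_on_monotone S T g :
  (forall s t, S <= s -> s <= t -> t <= T -> g s <= g t) ->
  (forall t (e : R), S <= t < T -> 0 < e -> exists u, [/\ t < u, u <= T & g u <= g t + e]) ->
  cadlag_on S T g.
Proof.
move=> ng rg; split => t /andP[St tT].
  apply/cvgrPdist_le => /= e e0.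
  have [u [tu uT gu]] := rg t e (introT andP (conj St tT)) e0.
  apply: filterS (near_right_itv tu) => x /andP[tx xu].
  have gx : g t <= g x by apply: ng => //; [exact: ltW|rewrite (le_trans (ltW xu))].
  rewrite distrC ger0_norm ?subr_ge0// lerBlDl.
  by apply: le_trans gu; apply: ng => //; [rewrite (le_trans St)// ltW|exact: ltW].
apply: nondecreasing_at_left_is_cvgr.
  apply: filterS (near_left_itv St) => x /andP[Sx xt] y z.
  rewrite !in_itv/= => /andP[xy yt] /andP[xz zt] yz.
  by apply: ng => //; [rewrite (le_trans (ltW Sx))// ltW|rewrite (le_trans (ltW zt))].
apply: filterS (near_left_itv St) => x /andP[Sx xt]; exists (g t) => _ [y + <-].
rewrite /= in_itv/= => /andP[xy yt].
by apply: ng => //; [rewrite (le_trans (ltW Sx))// ltW|exact: ltW].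
Qed.

Lemma cadlag_on_uniform_limit S T g :
  (forall e : R, 0 < e -> exists2 f, cadlag_on S T f &
    forall t, S <= t <= T -> `|g t - f t| <= e) ->
  cadlag_on S T g.
Proof.
move=> H; split => t /andP[St tT].
  apply/cvgrPdist_le => /= e e0.
  have e30 : 0 < e / 3 by rewrite divr_gt0.
  have [f [fr _] fg] := H _ e30.
  have /cvgrPdist_le/(_ _ e30) ft := fr t (introT andP (conj St tT)).
  apply: filterS2 ft (near_right_itv tT) => x fx /andP[tx xT].
  have h1 := fg t (introT andP (conj St (ltW tT))).
  have h2 := fg x (introT andP (conj (le_trans St (ltW tx)) (ltW xT))).
  by move: fx h1 h2; rewrite !ler_norml => /andP[? ?] /andP[? ?] /andP[? ?]; apply/andP; split; lra.
apply: R_complete; apply: cauchy_exP => e e0.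
have e30 : 0 < e / 3 by rewrite divr_gt0.
have [f [_ fl] fg] := H _ e30.
have /cvg_ex[l fl'] := fl t (introT andP (conj St tT)).
have /cvgrPdist_le/(_ _ e30) ft := fl'.
exists l; apply: filterS2 ft (near_left_itv St) => x fx /andP[Sx xt].
have h := fg x (introT andP (conj (ltW Sx) (le_trans (ltW xt) tT))).
rewrite /ball/= ltr_norml; move: fx h; rewrite !ler_norml => /andP[? ?] /andP[? ?].
by apply/andP; split; lra.
Qed.

End cadlag_on_interval.

Lemma cadlag_on_eq {R : realType} (S T : R) (f g : R -> R) :
  (forall t, S <= t <= T -> f t = g t) -> cadlag_on S T f -> cadlag_on S T g.
Proof.
move=> fg [fr fl]; split => t /andP[St tT].
  rewrite -fg ?St ?ltW//; apply: cvg_trans (fr t (introT andP (conj St tT))).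
  apply: near_eq_cvg; apply: filterS (near_right_itv tT) => x /andP[tx xT].
  by rewrite fg// (le_trans St)/= ltW.
have /cvg_ex[l fl'] := fl t (introT andP (conj St tT)).
apply/cvg_ex; exists l; apply: cvg_trans fl'.
apply: near_eq_cvg; apply: filterS (near_left_itv St) => x /andP[Sx xt].
by rewrite fg// (ltW Sx)/= (le_trans (ltW xt)).
Qed.

(** The margin between T and T + 1 keeps t + 1 / (n + 1) in the range where G is
    finite. *)
Lemma cadlag_on_fine {R : realType} (S T : R) (G : R -> \bar R) :
  (forall t, t <= T + 1 -> G t \is a fin_num) ->
  (forall s t, s <= t -> t <= T + 1 -> (G s <= G t)%E) ->
  (forall t, t < T -> G (t + n.+1%:R^-1) @[n --> \oo] --> G t) ->
  cadlag_on S T (fun t => fine (G t)).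
Proof.
move=> fG nG rG.
have T1 : T <= T + 1 by rewrite lerDl.
apply: cadlag_on_monotone => [s t _ st tT|t e /andP[_ tT] e0].
  have tT1 := le_trans tT T1.
  by rewrite fine_le ?fG ?nG//; exact: le_trans st tT1.
have /fine_cvg : G (t + n.+1%:R^-1) @[n --> \oo] --> (fine (G t))%:E.
  by rewrite fineK; [exact: rG|apply: fG; exact: le_trans (ltW tT) T1].
move=> /cvgrPdist_le/(_ _ e0) near1.
have tT0 : 0 < T - t by rewrite subr_gt0.
have /(_ _)[n _ Hn] := filterI near1 (near_infty_natSinv_lt (PosNum tT0)).
have [/= h1 h2] := Hn n (leqnn n).
exists (t + n.+1%:R^-1); split; first by rewrite ltrDl invr_gt0.
- by move: h2; rewrite ltrBrDl => /ltW.
- by move: h1; rewrite ler_norml => /andP[+ _]; lra.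
Qed.

Lemma cvg_in_prob_as {d} {Omega : measurableType d} {R : realType}
    (P : probability Omega R) (U : nat -> Omega -> R) (Y : Omega -> R) :
  (forall i, measurable_fun setT (U i)) -> measurable_fun setT Y ->
  {ae P, forall w, U i w @[i --> \oo] --> Y w} ->
  cvg_in_prob P \oo U Y.
Proof.
move=> mU mY UY e e0.
pose E i := [set w | e <= `|U i w - Y w|].
have mE i : measurable (E i) by apply: measurable_norm_ge; exact: measurable_funB.
have mEU n : measurable (\bigcup_(j >= n) E j) by apply: bigcup_measurable.
have limE : P (lim_sup_set E) = 0%E.
  have [N [mN N0 UN]] := UY.
  apply/eqP; rewrite eq_le measure_ge0 andbT -N0; apply: le_measureS => //.
    by apply: bigcapT_measurable.
  move=> w wE; apply: UN => /= /cvgrPdist_lt/(_ _ e0)[n _ Hn].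
  have [j /= nj] := wE n Logic.I.
  by rewrite /E/= distrC leNgt Hn.
have cv : P (\bigcup_(j >= n) E j) @[n --> \oo] --> 0%E.
  rewrite -limE; apply: lim_sup_set_cvg => //.
  by apply: le_lt_trans (probability_le1 _ _) _; [exact: bigcup_measurable|exact: ltry].
apply: (squeeze_cvge _ (cvg_cst 0%E) cv); apply: nearW => n.
rewrite measure_ge0/=; apply: le_measureS => //; first exact: mE.
by move=> w hw; exists n => /=.
Qed.

(** * Cadlag versions along nondecreasing families of sets *)

Section levy_paths.
Context {d : measure_display} {Omega : measurableType d} {R : realType}.
Local Notation mR := (measurableTypeR R).
Variables (P : probability Omega R) (m : R) (lambda : {measure set mR -> \bar R})
  (mu : R.-ker Omega ~> (mR * mR * mR)%type)
  (nu : {measure set (mR * mR * mR) -> \bar R})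
  (Lambda : set (mR * mR) -> {RV P >-> mR}).
Hypothesis Hlevy : levy_measure lambda.
Hypothesis nuE : (nu : set _ -> \bar R) = intensity lambda.
Hypothesis Hmu : poisson_random_measure P marked_half_plane nu mu.
Hypothesis HL : is_levy_basis m lambda mu Lambda.

Let measurableRV (Z : {RV P >-> mR}) : measurable_fun setT (Z : Omega -> R).
Proof. exact: (@measurable_funP _ _ _ _ setT Z). Qed.

Lemma square_mark_small (x : R) : 0 < x ->
  exists N : nat, forall n, (N <= n)%N -> square_mark lambda 0 n.+1%:R^-1 <= x.
Proof.
move=> x0; pose D (n : nat) : set mR := `]0%R, n.+1%:R^-1]%classic.
have D0 : \bigcap_n D n = set0.
  apply/seteqP; split => // z Dz; have := Dz 0%N Logic.I.
  rewrite /D/= in_itv/= => /andP[z0 _].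
  have [n _ Hn] := near_infty_natSinv_lt (PosNum z0).
  have := Dz n Logic.I; rewrite /D/= in_itv/= => /andP[_].
  by rewrite leNgt (Hn n (leqnn n)).
have : (\int[lambda]_(z in D n) ((z : R) ^+ 2)%:E)%E @[n --> \oo] --> 0%:E.
  have <- : (\int[lambda]_(z in \bigcap_n D n) ((z : R) ^+ 2)%:E)%E = 0%:E.
    by rewrite D0 integral_set0.
  apply: integral_bigcap.
  - by move=> n; exact: measurable_itv.
  - move=> i j ij; apply/subsetPset => z; rewrite /D/= !in_itv/= => /andP[-> /=] /le_trans; apply.
    by rewrite lef_pV2 ?posrE// ler_nat ltnS.
  - apply/measurable_EFinP; exact: measurable_funX.
  - by move=> z _; rewrite lee_fin sqr_ge0.
  - by apply: square_mark_finite => //; rewrite invr1.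
move=> /fine_cvg /cvgrPdist_le/(_ _ x0)[N _ HN]; exists N => n /HN.
by rewrite sub0r normrN => /(le_trans (ler_norm _)).
Qed.

Variables (F : R -> set (mR * mR)) (K : R).
Hypothesis nF : forall s t, s <= t -> F s `<=` F t.
Hypothesis fF : forall t, finite_area (F t).
Hypothesis rF : forall t, \bigcap_n F (t + n.+1%:R^-1) `<=` F t.

Let mF t : measurable (F t). Proof. by case: (fF t). Qed.

Let bigcapF t : \bigcap_n F (t + n.+1%:R^-1) = F t.
Proof.
apply/seteqP; split; first exact: rF.
by move=> y Fy n _; apply: nF Fy; rewrite lerDl invr_ge0.
Qed.

Let decreasingF t : nonincreasing_seq (fun n => F (t + n.+1%:R^-1)).
Proof.
by move=> i j ij; apply/subsetPset; apply: nF; rewrite lerD2l lef_pV2 ?posrE// ler_nat ltnS.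
Qed.

Lemma mark_path (kappa : {measure set (mR * mR * mR) -> \bar R}) (Z : set mR) (S T : R) :
  measurable Z -> (forall z, Z z -> 0 <= (z : R)) ->
  (mark kappa (F (T + 1) `*` Z) < +oo)%E ->
  cadlag_on S T (fun t => fine (mark kappa (F t `*` Z))).
Proof.
move=> mZ Z0 fin.
have mk t : marked (F t `*` Z) by split; [exact: measurableX|move=> y [_ /Z0]].
have G0 t : (0 <= mark kappa (F t `*` Z))%E by exact: mark_ge0.
have le s t : s <= t -> (mark kappa (F s `*` Z) <= mark kappa (F t `*` Z))%E.
  by move=> st; apply: le_mark; [exact: mk|exact: (mk _).1|by move=> y [/(nF st)]].
apply: cadlag_on_fine => [t tT|s t st _|t tT].
- by rewrite ge0_fin_numE// (le_lt_trans (le _ _ tT)).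
- exact: le.
- rewrite -[in X in _ --> X](bigcapF t).
  have XE : (\bigcap_n F (t + n.+1%:R^-1)) `*` Z = \bigcap_n (F (t + n.+1%:R^-1) `*` Z).
    apply/seteqP; split => y; first by move=> [y1 y2] n _; split => //; exact: y1.
    by move=> yn; split; [move=> n _; exact: (yn n Logic.I).1|exact: (yn 0%N Logic.I).2].
  rewrite XE; apply: integral_bigcap.
  + by move=> n; exact: (mk _).1.
  + move=> i j ij; apply/subsetPset; apply: setSX => //.
    by apply/subsetPset; exact: decreasingF.
  + exact: measurable_mark_fun.
  + by move=> y [_ /Z0]; rewrite lee_fin.
  + by apply: (le_lt_trans (le _ _ _) fin); rewrite invr1 lerD2r ltW.
Qed.

Lemma area_path (S T : R) : cadlag_on S T (fun t => area (F t)).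
Proof.
apply: cadlag_on_fine => [t tT|s t st _|t tT].
- by rewrite (finite_areaE (fF t)).
- by apply: le_measureS => //; exact: nF.
- rewrite -[in X in _ --> X](bigcapF t); apply: nonincreasing_cvg_mu => //.
  + by case: (fF (t + 1%:R^-1)).
  + exact: bigcapT_measurable.
Qed.

Let mark_slab_fin (A : set (mR * mR)) (a b : R) w : measurable A -> 0 <= a ->
  (mu w (slab A a b) < +oo)%E -> (mark (mu w) (slab A a b) < +oo)%E.
Proof. by move=> mA a0; exact: mark_slab_finite. Qed.

Let mark_nu_fin (A : set (mR * mR)) (a b : R) : finite_area A -> 0 < a ->
  (mark nu (slab A a b) < +oo)%E.
Proof.
move=> fA a0; have [mA _ lA] := fA.
apply: mark_slab_finite => //; first exact: ltW.
rewrite (nu_slab Hlevy nuE)// (finite_areaE fA).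
by rewrite lte_mul_pinfty ?lee_fin ?area_ge0// levy_itv.
Qed.

Let slabS s t (a b a' b' : R) : s <= t -> a' <= a -> b <= b' ->
  slab (F s) a b `<=` slab (F t) a' b'.
Proof.
move=> st aa bb y [/(nF st) Fy]; rewrite /= in_itv/= => /andP[ay yb]; split => //=.
by rewrite in_itv/= (le_lt_trans aa ay) (le_trans yb).
Qed.

(** A difference of two nondecreasing right-continuous functions. *)
Lemma jump_path (a b : R) w (S T : R) : 0 < a -> (mu w (slab (F (T + 1)) a b) < +oo)%E ->
  cadlag_on S T (fun t => jump_sum mu nu (F t) a b w).
Proof.
move=> a0 fin; apply: cadlag_onB; apply: mark_path => //.
- by move=> z /=; rewrite in_itv/= => /andP[/ltW + _]; apply: le_trans; exact: ltW.
- by apply: mark_slab_fin => //; exact: ltW.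
- by move=> z /=; rewrite in_itv/= => /andP[/ltW + _]; apply: le_trans; exact: ltW.
- exact: mark_nu_fin.
Qed.

Lemma big_path w (S T : R) : (mark (mu w) (big_slab (F (T + 1)) 1) < +oo)%E ->
  cadlag_on S T (fun t => big_sum mu (F t) w).
Proof.
move=> fin; apply: mark_path => // z /=.
by rewrite in_itv/= andbT => /ltW; apply: le_trans.
Qed.

Let grid (p k : nat) : R := K + k%:R / 2 ^+ p.

Lemma grid_dense (t u : R) : K <= t -> t < u -> u <= K + 1 ->
  exists p k, [/\ (k <= 2 ^ p)%N, t < grid p k & grid p k < u].
Proof.
move=> Kt tu uK; have tu0 : 0 < u - t by rewrite subr_gt0.
pose p := Num.truncn (u - t)^-1.
have p20 : 0 < 2 ^+ p.+1 :> R by rewrite exprn_gt0.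
have tp : 1 < (u - t) * 2 ^+ p.+1.
  rewrite -ltr_pdivrMl// mulr1; apply: (lt_le_trans (truncnS_gt _)).
  by rewrite -natrX ler_nat ltnW// ltn_expl.
pose k := (Num.truncn ((t - K) * 2 ^+ p.+1)).+1.
have k1 : (t - K) * 2 ^+ p.+1 < k%:R by exact: truncnS_gt.
have k2 : k%:R <= (t - K) * 2 ^+ p.+1 + 1.
  by rewrite /k -natr1 lerD2r truncn_le// mulr_ge0 ?subr_ge0// ltW.
have h1 : t < grid p.+1 k by rewrite /grid -ltrBlDl ltr_pdivlMr.
have h2 : grid p.+1 k < u.
  rewrite /grid -ltrBrDl ltr_pdivrMr//; apply: (le_lt_trans k2).
  by move: tp; rewrite !mulrBl; lra.
exists p.+1, k; split => //.
have : grid p.+1 k < K + 1 by exact: lt_le_trans uK.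
rewrite /grid ltrD2l ltr_pdivrMr// mul1r -natrX ltr_nat; exact: ltnW.
Qed.

Lemma grid_double p k : grid p.+1 k.*2 = grid p k.
Proof.
rewrite /grid -muln2 natrM exprS invfM mulrA; congr (_ + _).
by rewrite mulfK.
Qed.

(** Along a dyadic grid the jump sums of F are the partial sums of the jump sums
    of the increments of F, which are disjoint and have total area at most that
    of F (K + 1). The bound of [maximal_jumps] is thus independent of the grid;
    the exceptional events increase as the grid is refined, and the
    right-continuity of [jump_path] carries the bound from the grid points to
    all times. *)
Lemma maximal_path (a b e : R) : 0 < a -> a <= b -> b <= 1 -> 0 < e ->
  exists E : set Omega, [/\ measurable E,
    (P E <= (32 * area (F (K + 1)) * square_mark lambda a b / e ^+ 2)%:E)%E &
    forall w, ~ E w -> (mu w (slab (F (K + 1 + 1)) a b) < +oo)%E ->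
      forall t, K <= t <= K + 1 -> `|jump_sum mu nu (F t) a b w| <= e].
Proof.
move=> a0 ab b1 e0.
pose J t w := jump_sum mu nu (F t) a b w.
have mJ t : measurable_fun setT (J t) by apply: measurable_jump_sum => //; exact: ltW.
pose E p := \bigcup_(k in [set k | (k <= 2 ^ p)%N]) [set w | e <= `|J (grid p k) w|].
have mE p : measurable (E p).
  by apply: bigcup_measurable => k _; exact: measurable_norm_ge.
have EE : nondecreasing_seq E.
  apply/nondecreasing_seqP => p; apply/subsetPset => w [k /= kp Jk].
  exists k.*2; first by rewrite /= expnS mul2n leq_double.
  by rewrite /= grid_double.
have PE p : (P (E p) <= (32 * area (F (K + 1)) * square_mark lambda a b / e ^+ 2)%:E)%E.
  pose G i := F (grid p i).
  have nG : nondecreasing_seq G.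
    move=> i j ij; apply/subsetPset; apply: nF.
    by rewrite lerD2l ler_wpM2r ?ler_nat// invr_ge0 exprn_ge0.
  have fC i : finite_area (seqD G i).
    apply: (finite_areaS (fF (grid p i))).
      by case: i => [|i] /=; [exact: mF|apply: measurableD; exact: mF].
    by case: i => [|i] //=; exact: subDsetl.
  have disj i : G i `&` seqD G i.+1 = set0 by rewrite /= setDIK.
  have areaE n : \sum_(i < n.+1) 1 ^+ 2 * area (seqD G i) * square_mark lambda a b =
      area (G n) * square_mark lambda a b.
    rewrite -mulr_suml; congr (_ * _).
    elim: n => [|n IH]; first by rewrite big_ord1 expr1n mul1r.
    rewrite big_ord_recr IH /= expr1n mul1r [in RHS](setU_seqD nG) areaU//; exact: fF.
  have jumpE : {ae P, forall w, forall n,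
      J (grid p n) w = \sum_(i < n.+1) 1 * jump_sum mu nu (seqD G i) a b w}.
    have : {ae P, forall w, forall n, jump_sum mu nu (G n.+1) a b w =
        jump_sum mu nu (G n) a b w + jump_sum mu nu (seqD G n.+1) a b w}.
      apply: ae_foralln => n; rewrite (setU_seqD nG).
      by apply: (jump_sumU Hlevy nuE Hmu) => //; exact: fF.
    apply: filterS => w Jw; elim=> [|n IH].
      by rewrite big_ord1 mul1r.
    by rewrite big_ord_recr/= -IH mul1r /J Jw.
  have tC : trivIset setT (seqD G) by exact: trivIset_seqD.
  have := @maximal_jumps _ _ _ P lambda mu nu Hlevy nuE Hmu (seqD G) (fun=> 1) (2 ^ p).+1
    a b e fC tC a0 ab b1 e0.
  rewrite areaE (_ : G (2 ^ p)%N = F (K + 1)); last first.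
    by rewrite /G /grid natrX divff// expf_neq0.
  rewrite mulrA; apply: le_trans; apply: le_measure_ae => //.
    apply: bigcup_measurable => k _; apply: measurable_norm_ge.
    apply: measurable_sum => i; apply: measurable_funM => //.
    apply: measurable_jump_sum; [by case: (fC i)|exact: ltW].
  move: jumpE; apply: filterS => w Jw [k /= kp]; rewrite Jw => ew.
  by exists k.+1.
exists (\bigcup_p E p); split.
- exact: bigcupT_measurable.
- have cv : (P \o E) p @[p --> \oo] --> P (\bigcup_p E p).
    by apply: nondecreasing_cvg_mu => //; exact: bigcupT_measurable.
  rewrite -(cvg_lim _ cv)//; apply: lime_le; first exact: cvgP cv.
  exact: nearW.
- move=> w nE fin t /andP[Kt tK].
  have gridJ p k : (k <= 2 ^ p)%N -> `|J (grid p k) w| <= e.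
    move=> kp; rewrite leNgt; apply/negP => lt; apply: nE.
    by exists p => //; exists k => //=; exact: ltW.
  move: tK; rewrite le_eqVlt => /predU1P[->|tK].
    have := gridJ 0%N 1%N isT; rewrite /grid expr0 divr1; exact.
  have [rc _] := jump_path K a0 fin.
  have /cvg_norm cv := rc t (introT andP (conj Kt tK)).
  rewrite leNgt; apply/negP => lt.
  have /(_ _)[del /= del0 Hdel] := cvgr_gt _ cv _ lt.
  pose u := Num.min (t + del) (K + 1).
  have tu : t < u by rewrite /u lt_min tK andbT ltrDl.
  have uK : u <= K + 1 by rewrite /u ge_min lexx orbT.
  have [p [k [kp tg gu]]] := grid_dense Kt tu uK.
  have := gridJ p k kp; rewrite leNgt => /negP; apply; apply: Hdel => //=.
  rewrite distrC gtr0_norm ?subr_gt0// ltrBlDl.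
  by apply: (lt_le_trans gu); rewrite ge_min lexx.
Qed.

Let jump_sum_add t (a b c : R) w : 0 < a -> a <= b -> b <= c ->
  (mu w (slab (F t) a c) < +oo)%E ->
  jump_sum mu nu (F t) a c w = jump_sum mu nu (F t) a b w + jump_sum mu nu (F t) b c w.
Proof.
move=> a0 ab bc fin; have b0 := lt_le_trans a0 ab.
have [E D] := slab_split (F t) ab bc.
have sub1 : slab (F t) a b `<=` slab (F t) a c by exact: slabS.
have sub2 : slab (F t) b c `<=` slab (F t) a c by exact: slabS.
have ms (x y : R) : 0 < x -> marked (slab (F t) x y) by move=> x0; apply: marked_slab => //; exact: ltW.
have add (kappa : {measure set (mR * mR * mR) -> \bar R}) :
    (mark kappa (slab (F t) a c) < +oo)%E ->
    fine (mark kappa (slab (F t) a c)) =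
    fine (mark kappa (slab (F t) a b)) + fine (mark kappa (slab (F t) b c)).
  move=> f; rewrite {1}E mark_setU//; [|exact: ms..].
  have f1 := le_lt_trans (le_mark kappa (ms a c a0) (ms a b a0).1 sub1) f.
  have f2 := le_lt_trans (le_mark kappa (ms a c a0) (ms b c b0).1 sub2) f.
  by rewrite fineD// ge0_fin_numE// mark_ge0//; exact: ms.
rewrite /jump_sum (add (mu w)); last by apply: mark_slab_fin => //; exact: ltW.
by rewrite (add nu) ?mark_nu_fin//; ring.
Qed.

(** Truncation levels for which the bounds of [maximal_path] at the heights
    2 ^ - k are summable. *)
Lemma levy_scales : exists n_ : nat -> nat,
  [/\ {homo n_ : i j / (i <= j)%N}, forall k, (k <= n_ k)%N &
    forall k, 32 * area (F (K + 1)) * square_mark lambda 0 (n_ k).+1%:R^-1 / (2^-1 ^+ k) ^+ 2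
      <= 2^-1 ^+ k].
Proof.
have H k : exists N : nat, forall n, (N <= n)%N ->
    32 * area (F (K + 1)) * square_mark lambda 0 n.+1%:R^-1 / (2^-1 ^+ k) ^+ 2 <= 2^-1 ^+ k.
  pose c : R := 32 * area (F (K + 1)) / (2^-1 ^+ k) ^+ 2.
  have q0 : 0 < 2^-1 ^+ k :> R by rewrite exprn_gt0.
  have c0 : 0 <= c by rewrite /c divr_ge0 ?mulr_ge0 ?area_ge0// ltW// exprn_gt0.
  have x0 : 0 < 2^-1 ^+ k / (c + 1) by rewrite divr_gt0// ltr_wpDl.
  have [N HN] := square_mark_small x0; exists N => n /HN h.
  rewrite (_ : 32 * _ * _ / _ = c * square_mark lambda 0 n.+1%:R^-1); last by rewrite /c; ring.
  apply: (@le_trans _ _ (c * (2^-1 ^+ k / (c + 1)))); first exact: ler_wpM2l.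
  rewrite mulrA ler_pdivrMr ?ltr_wpDl// mulrC ler_wpM2l ?(ltW q0)// lerDl//.
have [N_ HN] := choice H.
exists (fun k => \sum_(i < k.+1) (N_ i + 1))%N; split.
- move=> i j ij; rewrite -!(big_mkord xpredT (fun i => N_ i + 1)%N).
  by rewrite (@big_cat_nat _ _ _ i.+1 0%N j.+1)//= leq_addr.
- move=> k; apply: (@leq_trans (\sum_(i < k.+1) 1)%N).
    by rewrite sum_nat_const card_ord muln1.
  by apply: leq_sum => i _; rewrite addn1.
- by move=> k; apply: HN; rewrite big_ord_recr/= addn1; lia.
Qed.

Lemma geometric_cauchy (u : nat -> R) (k0 : nat) :
  (forall k, (k0 <= k)%N -> `|u k.+1 - u k| <= 2^-1 ^+ k) ->
  cvg (u @ \oo) /\ forall k, (k0 <= k)%N -> `|limn u - u k| <= 2 * 2^-1 ^+ k.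
Proof.
move=> h.
have step k j : (k0 <= k)%N -> `|u (k + j)%N - u k| <= 2 * 2^-1 ^+ k - 2 * 2^-1 ^+ (k + j).
  move=> kk; elim: j => [|j IH]; first by rewrite addn0 !subrr normr0.
  have := h (k + j)%N (leq_trans kk (leq_addr _ _)).
  have := ler_distD (u (k + j)%N) (u (k + j.+1)%N) (u k).
  rewrite addnS exprS => a1 a2.
  apply: (le_trans a1); apply: (le_trans (lerD a2 IH)).
  rewrite [2 * (2^-1 * _)]mulrA divff// mul1r; lra.
have bound k l : (k0 <= k)%N -> (k <= l)%N -> `|u l - u k| <= 2 * 2^-1 ^+ k.
  move=> kk kl; rewrite -(subnKC kl); apply: (le_trans (step _ _ kk)).
  by rewrite lerBlDr lerDl mulr_ge0// exprn_ge0.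
have cu : cvg (u @ \oo).
  apply: R_complete; apply: cauchy_exP => e e0.
  have e30 : 0 < e / 3 by rewrite divr_gt0.
  have half1 : `|2^-1 : R| < 1 by rewrite ger0_norm// invf_lt1// ltr1n.
  have /cvgrPdist_le/(_ _ e30)[N _ HN] := cvg_expr half1.
  pose k := maxn k0 N.
  exists (u k); exists k => // l /= kl; rewrite /ball/= distrC.
  apply: (le_lt_trans (bound _ _ (leq_maxl _ _) kl)).
  have := HN k (leq_maxr _ _); rewrite sub0r normrN => /(le_trans (ler_norm _)); lra.
split => // k kk.
have cn : `|u l - u k| @[l --> \oo] --> `|limn u - u k|.
  by apply: cvg_norm; apply: cvgB => //; exact: cvg_cst.
rewrite -(cvg_lim _ cn)//; apply: limr_le; first exact: cvgP cn.
by exists k => // l /= kl; exact: bound.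
Qed.

(** The jump sums between two consecutive levels of [levy_scales] are at most
    2 ^ - k for all times, except on an event of probability at most 2 ^ - k. By
    Borel-Cantelli the compensated small jumps converge almost surely uniformly
    in time, and a uniform limit of cadlag paths is cadlag. *)
Lemma levy_path : exists Y : R -> {RV P >-> mR},
  (forall t, K <= t <= K + 1 -> {ae P, forall w, Y t w = Lambda (F t) w}) /\
  forall w, cadlag_on K (K + 1) (fun t => Y t w).
Proof.
have [Y0 HY0] := levy_ito nuE HL.
have [n_ [nn nk hn]] := levy_scales.
pose a k : R := (n_ k).+1%:R^-1.
have a0 k : 0 < a k by rewrite invr_gt0.
have a1 k : a k <= 1 by rewrite invf_le1// ler1n.
have aS k : a k.+1 <= a k by rewrite lef_pV2 ?posrE// ler_nat ltnS nn.
have HE k : exists E : set Omega, [/\ measurable E, (P E <= (2^-1 ^+ k)%:E)%E &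
    forall w, ~ E w -> (mu w (slab (F (K + 1 + 1)) (a k.+1) (a k)) < +oo)%E ->
      forall t, K <= t <= K + 1 -> `|jump_sum mu nu (F t) (a k.+1) (a k) w| <= 2^-1 ^+ k].
  have q0 : 0 < 2^-1 ^+ k :> R by rewrite exprn_gt0.
  have [E [mE PE Ew]] := maximal_path (a0 k.+1) (aS k) (a1 k) q0.
  exists E; split => //; apply: (le_trans PE); rewrite lee_fin; apply: le_trans (hn k).
  rewrite ler_wpM2r ?invr_ge0 ?exprn_ge0// ler_wpM2l ?mulr_ge0 ?area_ge0//.
  by apply: square_mark_le => //; [exact: ltW|exact: a1].
have [E HE'] := choice HE.
have limE : P (lim_sup_set E) = 0%E.
  apply: lim_sup_set_cvg0 => [k|]; first by have [] := HE' k.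
  apply: (@le_lt_trans _ _ (\sum_(0 <= k <oo) (2^-1 ^+ k)%:E)%E).
    by apply: lee_nneseries => [k _ _|k _]; [exact: measure_ge0|have [] := HE' k].
  rewrite (eq_eseriesr (g := fun k => (2 / (2 ^ (k + 1))%:R)%:E)); last first.
    by move=> k _; rewrite natrX exprD expr1 invfM exprVn mulrCA divff// mulr1.
  by rewrite (cvg_lim _ (@cvg_geometric_eseries_half R 2 0))//; exact: ltry.
pose good w := [/\ forall k, (mu w (slab (F (K + 1 + 1)) (a k) 1) < +oo)%E,
  (mark (mu w) (big_slab (F (K + 1 + 1)) 1) < +oo)%E & ~ lim_sup_set E w].
have aegood : {ae P, forall w, good w}.
  have h1 : {ae P, forall w, forall k, (mu w (slab (F (K + 1 + 1)) (a k) 1) < +oo)%E}.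
    apply: ae_foralln => k; apply: (prm_finite Hmu).
    exact: (slab_thin Hlevy nuE).
  have h2 := big_mark_finite Hlevy nuE Hmu (fF (K + 1 + 1)).
  have h3 : {ae P, forall w, ~ lim_sup_set E w}.
    exists (lim_sup_set E); split => //; last by move=> w /= /contrapT.
    apply: bigcapT_measurable => n; apply: bigcup_measurable => k _.
    by have [] := HE' k.
  by apply: filterS3 h1 h2 h3.
have [N [mN N0 goodN]] := aegood.
have good_of w : ~ N w -> good w by move=> nN; apply: contrapT => /goodN.
pose M k t w := jump_sum mu nu (F t) (a k) 1 w.
have unif w : good w -> exists k0, forall t, K <= t <= K + 1 ->
    forall k, (k0 <= k)%N -> `|M k.+1 t w - M k t w| <= 2^-1 ^+ k.
  move=> [fin _ nE].
  have [k0 Hk0] : exists k0, forall k, (k0 <= k)%N -> ~ E k w.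
    apply: contrapT => /forallNP h; apply: nE => n _.
    have /existsNP[k /not_implyP[nk' /contrapT Ek]] := h n.
    by exists k.
  exists k0 => t tK k kk; have [_ _ HEk] := HE' k.
  have finS s (x y : R) : s <= K + 1 + 1 -> (a k.+1 <= x) -> y <= 1 ->
      (mu w (slab (F s) x y) < +oo)%E.
    move=> sK ax y1; apply: le_lt_trans (fin k.+1); apply: le_measureS.
    - exact: measurable_slab.
    - exact: measurable_slab.
    - exact: slabS.
  have tK2 : t <= K + 1 + 1 by case/andP: tK => _ /le_trans; apply; rewrite lerDl.
  rewrite /M (jump_sum_add (a0 k.+1) (aS k) (a1 k)) ?finS// addrK.
  by apply: HEk => //; [exact: Hk0|exact: finS].
pose W k t w := m * area (F t) + M k t w + big_sum mu (F t) w.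
(* All paths have to be cadlag: on the null set N they are set to 0. *)
pose h k t w := W k t w * \1_(~` N) w.
pose V t w := limn (fun k => h k t w).
have hN k t w : N w -> h k t w = 0.
  by move=> Nw; rewrite /h indicE memNset ?mulr0//=; apply.
have hW k t w : ~ N w -> h k t w = W k t w.
  by move=> Nw; rewrite /h indicE mem_set ?mulr1.
have path w : ~ N w -> exists k0, forall t, K <= t <= K + 1 ->
    cvg (h k t w @[k --> \oo]) /\ forall k, (k0 <= k)%N -> `|V t w - W k t w| <= 2 * 2^-1 ^+ k.
  move=> Nw; have [k0 Hk0] := unif w (good_of _ Nw); exists k0 => t tK.
  have := @geometric_cauchy (fun k => h k t w) k0; case.
    move=> k kk; rewrite !hW//.
    have WM : W k.+1 t w - W k t w = M k.+1 t w - M k t w 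
      by rewrite /W; move: (M k.+1 t w) (M k t w) (big_sum _ _ _) (area _) => x y z u; ring.
    by rewrite [X in `|X|]WM; exact: Hk0.
  move=> cv lim; split => // k kk.
  by rewrite -hW//; exact: lim.
have Vcvg t w : K <= t <= K + 1 -> h k t w @[k --> \oo] --> V t w.
  move=> tK; have [Nw|Nw] := pselect (N w); last by have [k0 /(_ t tK)[]] := path w Nw.
  rewrite /V (_ : (fun k => h k t w) = cst 0); first by rewrite lim_cst//; exact: cvg_cst.
  by apply/funext => k; rewrite hN.
have mW k t : measurable_fun setT (W k t).
  apply: measurable_funD; last exact: measurable_big_sum.
  apply: measurable_funD; first exact: measurable_cst.
  by apply: measurable_jump_sum => //; exact: ltW.
have mV t : K <= t <= K + 1 -> measurable_fun setT (V t).
  move=> tK; apply: (@measurable_fun_cvg _ _ _ _ (fun k => h k t)).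
    move=> k; apply: measurable_funM => //.
    by apply: measurable_indic; exact: measurableC.
  by move=> w _; exact: Vcvg.
have HY t : exists Z : {RV P >-> mR}, K <= t <= K + 1 -> forall w, Z w = V t w.
  have [tK|tK] := boolP (K <= t <= K + 1); last by exists (Lambda set0).
  by exists (mfun_Sub (mem_set (mV t tK) : (V t : Omega -> mR) \in mfun)).
have [Y HY'] := choice HY.
exists Y; split=> [t tK|w]; last first.
  have [Nw|Nw] := pselect (N w).
    apply: (@cadlag_on_eq _ _ _ (cst 0)) => [t tK|].
      rewrite HY'// /V (_ : (fun k => h k t w) = cst 0) ?lim_cst//.
      by apply/funext => k; rewrite hN.
    by split => t _; [exact: cvg_cst|exact: is_cvg_cst].
  apply: (@cadlag_on_eq _ _ _ (fun t => V t w)); first by move=> t tK; rewrite HY'.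
  have [k0 Hk0] := path w Nw; have [fin finbig _] := good_of w Nw.
  apply: cadlag_on_uniform_limit => e e0.
  have e30 : 0 < e / 3 by rewrite divr_gt0.
  have half1 : `|2^-1 : R| < 1 by rewrite ger0_norm// invf_lt1// ltr1n.
  have /cvgrPdist_le/(_ _ e30)[n _ Hn] := cvg_expr half1.
  pose k := maxn k0 n; exists (W k ^~ w).
    apply: cadlag_onD; last exact: big_path.
    apply: cadlag_onD; first by apply: cadlag_onZ; exact: area_path.
    exact: jump_path.
  move=> t tK; have [_ /(_ k (leq_maxl _ _))] := Hk0 t tK.
  have := Hn k (leq_maxr _ _); rewrite sub0r normrN => /(le_trans (ler_norm _)); lra.
have [cY LY] := HY0 _ (fF t).
have nN : {ae P, forall w, ~ N w}.
  by exists N; split => // w /= /contrapT.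
have mY : measurable_fun setT (fun w => V t w - m * area (F t) - big_sum mu (F t) w).
  apply: measurable_funB; last exact: measurable_big_sum.
  by apply: measurable_funB; [exact: mV|exact: measurable_cst].
have mM k : measurable_fun setT (M k t) by apply: measurable_jump_sum => //; exact: ltW.
have : {ae P, forall w, V t w - m * area (F t) - big_sum mu (F t) w = Y0 (F t) w}.
  apply: (@cvg_in_prob_unique _ _ _ P _ \oo _ _ _ _ mM mY (measurableRV (Y0 (F t)))).
    apply: cvg_in_prob_as => //; move: nN; apply: filterS => w Nw.
    pose c := m * area (F t) + big_sum mu (F t) w.
    have cc : h k t w - c @[k --> \oo] --> V t w - c.
      by apply: cvgB; [exact: Vcvg|exact: cvg_cst].
    rewrite -addrA -opprD; apply: cvg_trans cc; apply: near_eq_cvg; apply: nearW => k /=.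
    by rewrite hW// /W /c; ring.
  move=> e e0 U /(cY e e0)[A _ HA]; exists A => // k /= Ak.
  by apply: (HA (n_ k)); exact: leq_trans Ak (nk k).
by move: LY nN; apply: filterS3 => w LY Nw VY; rewrite LY HY'// -VY; ring.
Qed.

End levy_paths.

Section nondecreasing_families.
Context {d : measure_display} {Omega : measurableType d} {R : realType}.
Local Notation mR := (measurableTypeR R).
Variables (P : probability Omega R) (m : R) (lambda : {measure set mR -> \bar R})
  (mu : R.-ker Omega ~> (mR * mR * mR)%type)
  (nu : {measure set (mR * mR * mR) -> \bar R})
  (Lambda : set (mR * mR) -> {RV P >-> mR}).
Hypothesis Hlevy : levy_measure lambda.
Hypothesis nuE : (nu : set _ -> \bar R) = intensity lambda.
Hypothesis Hmu : poisson_random_measure P marked_half_plane nu mu.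
Hypothesis HL : is_levy_basis m lambda mu Lambda.

(** The family is replaced by its right-continuous version, which differs from it
    by null sets; freezing it before K makes it nondecreasing on the whole
    line. *)
Lemma nondecreasing_family_path (B : R -> set (mR * mR)) (K : R) :
  (forall s t, K <= s -> s <= t -> B s `<=` B t) ->
  (forall t, K <= t -> finite_area (B t)) ->
  (forall t, K <= t -> leb2 ((\bigcap_n B (t + n.+1%:R^-1)) `\` B t) = 0%E) ->
  exists Y : R -> {RV P >-> mR},
    (forall t, K <= t <= K + 1 -> {ae P, forall w, Y t w = Lambda (B t) w}) /\
    forall w, cadlag_on K (K + 1) (fun t => Y t w).
Proof.
move=> nB fB B0.
pose F t := \bigcap_n B (Num.max K t + n.+1%:R^-1).
have K1 t (n : nat) : K <= Num.max K t + n.+1%:R^-1.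
  by rewrite (@le_trans _ _ (Num.max K t)) ?le_max ?lexx// lerDl invr_ge0.
have mF t : measurable (F t).
  by apply: bigcapT_measurable => n; case: (fB _ (K1 t n)).
have nF s t : s <= t -> F s `<=` F t.
  move=> st y Fy n _; apply: nB (Fy n Logic.I); first exact: K1.
  by rewrite lerD2r ge_max !le_max lexx st orbT.
have fF t : finite_area (F t).
  by apply: (finite_areaS (fB _ (K1 t 0%N))) => // y; apply.
have rF t : \bigcap_n F (t + n.+1%:R^-1) `<=` F t.
  move=> y Fy j _; have := Fy (j.*2.+1) Logic.I (j.*2.+1) Logic.I.
  apply: nB; first exact: K1.
  (* The increment 1 / (j + 1) is shared equally by the two right limits. *)
  have -> : j.+1%:R^-1 = j.*2.+2%:R^-1 + j.*2.+2%:R^-1 :> R.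
    have -> : j.*2.+2 = (2 * j.+1)%N by rewrite -doubleS -mul2n.
    have half2 : 2^-1 + 2^-1 = 1 :> R by lra.
    by rewrite natrM invfM -mulrDl half2 mul1r.
  have q0 : 0 <= j.*2.+2%:R^-1 :> R by rewrite invr_ge0.
  rewrite addrA lerD2r ge_max lerD2r le_max lexx orbT andbT.
  exact: (K1 t j.*2.+1).
have [Y [YF Yc]] := levy_path Hlevy nuE Hmu HL K nF fF rF.
exists Y; split => // t /[dup] /andP[Kt _] /YF.
have FE : F t = \bigcap_n B (t + n.+1%:R^-1) by rewrite /F max_r.
have BF : B t `<=` F t.
  by rewrite FE => y Bty n _; apply: nB Bty => //; rewrite lerDl invr_ge0.
have [mB _ _] := fB t Kt.
have := Lambda_eq_null Hlevy nuE Hmu HL (fF t) mB BF; rewrite FE => /(_ (B0 t Kt)).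
by apply: filterS2 => w -> ->.
Qed.

End nondecreasing_families.

(** At an integer the left limit comes from the interval that ends there. *)
Lemma cadlag_glue {R : realType} (Z : int -> R -> R) :
  (forall K : int, cadlag_on K%:~R (K%:~R + 1) (Z K)) ->
  cadlag (fun t => Z (Num.floor t) t).
Proof.
move=> cZ t; pose K := Num.floor t.
have /andP[Kt tK] := floor_itv t; rewrite -/K intrD in Kt tK.
split.
  rewrite -/K; apply: cvg_trans ((cZ K).1 t (introT andP (conj Kt tK))).
  apply: near_eq_cvg; apply: filterS (near_right_itv tK) => x /andP[tx xK].
  by rewrite (@floor_def _ x K)// intrD xK andbT (le_trans Kt)// ltW.
have [L [Lt tL]] : exists L : int, L%:~R < t /\ t <= L%:~R + 1.
  move: Kt; rewrite le_eqVlt => /predU1P[Kt|Kt]; last by exists K; split => //; exact: ltW.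
  by exists (K - 1); rewrite intrB -Kt; split; lra.
have /cvg_ex[l hl] := (cZ L).2 t (introT andP (conj Lt tL)).
apply/cvg_ex; exists l; apply: cvg_trans hl.
apply: near_eq_cvg; apply: filterS (near_left_itv Lt) => x /andP[Lx xt].
by rewrite (@floor_def _ x L)// intrD (ltW Lx)/= (lt_le_trans xt).
Qed.

(** * Trawl sets and the trawl process *)

Section trawl_sets.
Context {R : realType}.
Local Notation mR := (measurableTypeR R).
Variable a : R -> R.
Hypothesis a_ge0 : forall s, 0 <= s -> 0 <= a s.
Hypothesis a_dec : nonincreasing_on_nneg a.
Hypothesis a_int : (\int[lebesgue_measure]_(s in `[0%R, +oo[) (a s)%:E < +oo)%E.

Definition trawl (t : R) : set (mR * mR) :=
  [set y | [/\ 0 <= (y.1 : R), (y.2 : R) <= t & (y.1 : R) <= a (t - y.2)]].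

Hypothesis mtrawl : forall t, measurable (trawl t).

Lemma measurable_trawl_function : measurable_fun (`[0%R, +oo[%classic : set mR) (fun s : mR => (a s : mR)).
Proof.
apply: (@eq_measurable_fun _ _ _ _ _ (fun s : mR => (a (Num.max 0 s) : mR))).
  move=> s; rewrite inE/= in_itv/= andbT => s0.
  by rewrite max_r.
apply: nonincreasing_measurable => // x y xy.
apply: a_dec; first by rewrite le_max lexx.
by rewrite ge_max !le_max lexx xy orbT.
Qed.

Lemma trawl_series : (\sum_(0 <= n <oo) (a n.+1%:R)%:E < +oo)%E.
Proof.
pose I (n : nat) : set mR := `[n%:R, n.+1%:R[%classic.
have IU : \bigcup_n I n = `[0%R, +oo[%classic.
  apply/seteqP; split => s.
    by move=> [n _]; rewrite /I/= !in_itv/= andbT => /andP[+ _]; exact: le_trans.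
  rewrite /= in_itv/= andbT => s0; exists (Num.truncn s) => //.
  by rewrite /I/= in_itv/= truncnS_gt truncn_le s0.
have I_ge0 n s : I n s -> 0 <= s.
  by rewrite /I/= in_itv/= => /andP[+ _]; exact: le_trans.
have ma : measurable_fun (\bigcup_n I n) (fun s : mR => (a s)%:E).
  by rewrite IU; apply/measurable_EFinP; exact: measurable_trawl_function.
apply: le_lt_trans a_int; rewrite -IU ge0_integral_bigcup//; last 3 first.
- by move=> n; exact: measurable_itv.
- by move=> s [n _ /I_ge0] s0; rewrite lee_fin a_ge0.
- apply/trivIsetP => i j _ _ ij; apply/seteqP; split => // s [].
  rewrite /I/= !in_itv/= => /andP[i1 i2] /andP[j1 j2].
  have h1 := le_lt_trans i1 j2; have h2 := le_lt_trans j1 i2.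
  by move: h1 h2 ij; rewrite !ltr_nat; lia.
apply: lee_nneseries => [n _ _|n _]; first by rewrite lee_fin a_ge0.
have <- : (\int[lebesgue_measure]_(s in I n) (a n.+1%:R)%:E = (a n.+1%:R)%:E)%E.
  rewrite integral_cst; last exact: measurable_itv.
  rewrite -[RHS]mule1; congr (_ * _)%E.
  have nn1 : n%:R <= n.+1%:R :> R by rewrite ler_nat.
  have := lebesgue_measure_itvoc true true nn1.
  by rewrite -natrB// subSnn.
apply: ge0_le_integral => //.
- exact: measurable_itv.
- by move=> s _; rewrite lee_fin a_ge0.
- by apply: measurable_funS ma; [apply: bigcupT_measurable => k; exact: measurable_itv|exact: bigcup_sup].
- move=> s /[dup] /I_ge0 s0; rewrite /I/= in_itv/= => /andP[_ sn].
  by rewrite lee_fin a_dec// ltW.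
Qed.

Lemma finite_area_strip (c s t : R) : 0 <= c -> s <= t ->
  finite_area (`[0%R, c]%classic `*` `[s, t]%classic : set (mR * mR)).
Proof.
move=> c0 st; split.
- by apply: measurableX; exact: measurable_itv.
- by move=> y [/= + _]; rewrite !in_itv/= => /andP[y0 _]; split => //=; rewrite in_itv/= y0.
- by rewrite leb2_rectangle// ltry.
Qed.

(** For y.2 in [t - n - 1, t - n] the height of the trawl set is at most a n, by
    monotonicity. The area of the strip n = 0 is at most a 0, and the areas of
    the others add up to at most the integral of a. *)
Lemma finite_area_trawl t : finite_area (trawl t).
Proof.
pose S n : set (mR * mR) := `[0%R, a n.+1%:R]%classic `*` `[t - n.+2%:R, t - n.+1%:R]%classic.
have Sle n : t - n.+2%:R <= t - n.+1%:R by rewrite lerD2l lerN2 ler_nat.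
have fS n : finite_area (S n) by apply: finite_area_strip => //; exact: a_ge0.
have fSU : finite_area (\bigcup_n S n).
  have mSU : measurable (\bigcup_n S n).
    by apply: bigcupT_measurable => n; case: (fS n).
  split => //; first by move=> y [n _ Sy]; have [_ + _] := fS n; apply.
  apply: le_lt_trans trawl_series.
  apply: (le_trans (measure_sigma_subadditive
    (@lebesgue_measure R \x @lebesgue_measure R)%E _ mSU (@subset_refl _ _))).
    by move=> n; case: (fS n).
  apply: lee_nneseries => [n _ _|n _]; first exact: measure_ge0.
  rewrite [leLHS](leb2_rectangle _ _ _ _ (a_ge0 (ler0n _ _)) (Sle n)) subr0 lee_fin.
  by rewrite opprB addrC subrKA -natrB// subSnn mulr1.
have f0 : finite_area (`[0%R, a 0]%classic `*` `[t - 1, t]%classic : set (mR * mR)).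
  by apply: finite_area_strip; [exact: a_ge0|rewrite gerBl].
apply: (finite_areaS (finite_areaU f0 fSU)) => // y [y0 yt ya].
have u0 : 0 <= t - y.2 by rewrite subr_ge0.
have n1 : (Num.truncn (t - y.2))%:R <= t - y.2 by rewrite truncn_le.
have n2 := truncnS_gt (t - y.2).
case E : (Num.truncn (t - y.2)) n1 n2 => [|n] n1 n2.
  left; split; rewrite /= in_itv/= ?y0 ?yt ?andbT//.
    by apply: (le_trans ya); exact: a_dec.
  by rewrite lerBlDr -lerBlDl ltW.
right; exists n => //; split; rewrite /= in_itv/=.
  by rewrite y0 (le_trans ya)// a_dec.
by apply/andP; split; [rewrite lerBlDr -lerBlDl ltW|rewrite lerBrDr -lerBrDl].
Qed.

Variable K : R.

(** As t increases from K the trawl set gains points at its front and loses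
    points elsewhere. Adding all gains to the set at time K gives [inflow], and
    the losses make up [outflow]: both sets grow with t, and the trawl set is
    their difference. The heights of the gains are bounded by a 0. *)
Definition inflow (t : R) : set (mR * mR) :=
  trawl K `|` (`[0%R, a 0]%classic `*` `]K, t]%classic).

Definition outflow (t : R) : set (mR * mR) := inflow t `\` trawl t.

Lemma finite_area_inflow t : K <= t -> finite_area (inflow t).
Proof.
move=> Kt; apply: finite_areaU; first exact: finite_area_trawl.
apply: (finite_areaS (finite_area_strip (a_ge0 (lexx 0)) Kt)).
  by apply: measurableX; exact: measurable_itv.
by apply: setSX => // s; apply: subset_itvr; rewrite bnd_simp.
Qed.

Lemma finite_area_outflow t : K <= t -> finite_area (outflow t).
Proof.
move=> Kt; have fI := finite_area_inflow Kt; have [mI _ _] := fI.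
by apply: (finite_areaS fI); [exact: measurableD|exact: subDsetl].
Qed.

Lemma trawl_inflow t : K <= t -> trawl t `<=` inflow t.
Proof.
move=> Kt y [y0 yt ya]; have [yK|Ky] := leP (y.2 : R) K.
  left; split => //; apply: (le_trans ya); apply: a_dec; first by rewrite subr_ge0.
  by rewrite lerD2r.
right; split; rewrite /= in_itv/= ?y0 ?Ky ?yt//=.
by apply: (le_trans ya); apply: a_dec => //; rewrite subr_ge0.
Qed.

Lemma inflow_le s t y : K <= s -> K <= t -> inflow t y -> (y.2 : R) <= s -> inflow s y.
Proof.
move=> Ks Kt [|[y1]]; first by left.
by rewrite /= in_itv/= => /andP[Ky _] ys; right; split => //=; rewrite in_itv/= Ky.
Qed.

Lemma inflow_time t y : K <= t -> inflow t y -> (y.2 : R) <= t.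
Proof.
move=> Kt [[_ yK _]|[_ /=]]; first exact: le_trans Kt.
by rewrite in_itv/= => /andP[].
Qed.

Lemma inflowS s t : K <= s -> s <= t -> inflow s `<=` inflow t.
Proof.
move=> Ks st; apply: setUS; apply: setSX => // x; apply: subset_itvl.
by rewrite bnd_simp.
Qed.

Lemma outflowS s t : K <= s -> s <= t -> outflow s `<=` outflow t.
Proof.
move=> Ks st y [ys nys]; split; first exact: inflowS ys.
move=> [y0 yt ya]; apply: nys; have yS := inflow_time Ks ys.
split => //; apply: (le_trans ya); apply: a_dec; first by rewrite subr_ge0.
by rewrite lerD2r.
Qed.

Lemma limit_time (t x : R) : (forall n : nat, x <= t + n.+1%:R^-1) -> x <= t.
Proof.
move=> h; rewrite leNgt; apply/negP; rewrite -subr_gt0 => x0.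
have [n _ /(_ n (leqnn n))] := near_infty_natSinv_lt (PosNum x0).
by rewrite /= ltrBrDl ltNge h.
Qed.

Lemma inflow_right_continuous t : K <= t ->
  \bigcap_n inflow (t + n.+1%:R^-1) `<=` inflow t.
Proof.
move=> Kt y ny; have Kn (n : nat) : K <= t + n.+1%:R^-1 by rewrite (le_trans Kt)// lerDl invr_ge0.
apply: inflow_le Kt (Kn 0%N) (ny _ Logic.I) _.
by apply: limit_time => n; apply: inflow_time (ny n Logic.I).
Qed.

(** A point (x, s) in the difference satisfies x <= a (t - s) and a r < x for all
    r > t - s. As a is non-increasing, only one s is possible for a given x. *)
Lemma outflow_right_null t : K <= t ->
  leb2 ((\bigcap_n outflow (t + n.+1%:R^-1)) `\` outflow t) = 0%E.
Proof.
move=> Kt; set E := _ `\` _.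
have Kn (n : nat) : K <= t + n.+1%:R^-1 by rewrite (le_trans Kt)// lerDl invr_ge0.
have mE : measurable E.
  apply: measurableD; last by case: (finite_area_outflow Kt).
  by apply: bigcapT_measurable => n; case: (finite_area_outflow (Kn n)).
have HE y : E y -> [/\ (y.2 : R) <= t, (y.1 : R) <= a (t - y.2) &
    forall n : nat, a (t + n.+1%:R^-1 - y.2) < y.1].
  move=> [yn nyt].
  have yI : inflow t y by apply: inflow_right_continuous => // n _; case: (yn n Logic.I).
  have yT : trawl t y by apply: contrapT => nT; exact: nyt.
  have [y0 yt ya] := yT; split => // n; rewrite ltNge; apply/negP => h.
  have [_] := yn n Logic.I; apply; split => //.
  by rewrite (le_trans yt)// lerDl invr_ge0.
have sep x s r : E (x, s) -> E (x, r) -> r <= s.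
  move=> /HE[/= st xs ns] /HE[/= rt xr nr]; rewrite leNgt; apply/negP => sr.
  have d0 : 0 < r - s by rewrite subr_gt0.
  have [n _ /(_ n (leqnn n)) /= hn] := near_infty_natSinv_lt (PosNum d0).
  have := nr n; rewrite ltNge => /negP; apply; apply: (le_trans xs).
  apply: a_dec; first by rewrite subr_ge0 (le_trans rt)// lerDl invr_ge0.
  by rewrite -addrA lerD2l; move: (n.+1%:R^-1) hn => q; lra.
rewrite /leb2 /product_measure1 (eq_integral (cst 0%E)) ?integral0// => x _ /=.
have [->|/set0P[s Es]] := eqVneq (xsection E x) set0; first by rewrite measure0.
have -> : xsection E x = [set s].
  move: Es; rewrite /xsection/= inE => Es.
  apply/seteqP; split => r; rewrite /= inE; last by move=> ->.
  by move=> Er; apply/eqP; rewrite eq_le (sep x s r)// (sep x r s).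
exact: lebesgue_measure_set1.
Qed.

End trawl_sets.

Section main.
Context {d : measure_display} {Omega : measurableType d} {R : realType}.
Local Notation mR := (measurableTypeR R).
Variables (P : probability Omega R) (m : R) (lambda : {measure set mR -> \bar R})
  (mu : R.-ker Omega ~> (mR * mR * mR)%type)
  (nu : {measure set (mR * mR * mR) -> \bar R})
  (Lambda : set (mR * mR) -> {RV P >-> mR}).
Hypothesis Hlevy : levy_measure lambda.
Hypothesis nuE : (nu : set _ -> \bar R) = intensity lambda.
Hypothesis Hmu : poisson_random_measure P marked_half_plane nu mu.
Hypothesis HL : is_levy_basis m lambda mu Lambda.
Variables (a : R -> R) (X : R -> {RV P >-> mR}).
Hypothesis a_ge0 : forall s, 0 <= s -> 0 <= a s.
Hypothesis a_dec : nonincreasing_on_nneg a.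
Hypothesis a_int : (\int[lebesgue_measure]_(s in `[0%R, +oo[) (a s)%:E < +oo)%E.
Hypothesis HX : trawl_process Lambda a X.

Let measurableRV (Z : {RV P >-> mR}) : measurable_fun setT (Z : Omega -> R).
Proof. exact: (@measurable_funP _ _ _ _ setT Z). Qed.

Let domain (t : R) : set (mR * mR) := `[0%R, +oo[%classic `*` `]-oo, t]%classic.

Let mdomain t : measurable (domain t).
Proof. by apply: measurableX; exact: measurable_itv. Qed.

Let trawl_domain t : trawl a t `<=` domain t.
Proof. by move=> y [y0 yt _]; split; rewrite /= in_itv/= ?andbT. Qed.

(** The measurability of the integrand is part of the definition of the
    integral. *)
Lemma measurable_trawl t : measurable (trawl a t).
Proof.
have [f_ [mf _ _ _ _]] := HX t.
have := mf (mdomain t) [set 1] (measurable_set1 _); congr measurable.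
apply/seteqP; split => y.
  move=> [[/= + +]]; rewrite !in_itv/= andbT => y0 yt.
  rewrite indicE; case: (boolP (y \in _)) => [|_ /esym/eqP]; last by rewrite oner_eq0.
  by rewrite inE => /= /andP[_ ya] _; split.
move=> yT; have [y0 yt ya] := yT; split; first exact: trawl_domain.
by rewrite /= indicE mem_set//= y0 ya.
Qed.

Lemma trawl_process_Lambda t : {ae P, forall w, X t w = Lambda (trawl a t) w}.
Proof.
have [f_ [mf ff fcvg HZ cX]] := HX t.
apply: (integral_indicator Hlevy nuE Hmu HL (D := domain t) (f_ := f_)) => //.
- by move=> y [].
- by apply: finite_area_trawl => // s; exact: measurable_trawl.
- move: fcvg; apply: filterS => y fy Dy.
  have [/= + +] := Dy; rewrite !in_itv/= ?andbT => y0 yt.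
  have E : (y \in [set y : mR * mR | 0 <= (y.1 : R) <= a (t - y.2)]) = (y \in trawl a t).
    by apply/idP/idP; rewrite !inE/=; [move=> /andP[]|move=> [-> _ ->]].
  by rewrite indicE -E -indicE; exact: fy.
Qed.

(** The trawl set at t is [inflow] minus [outflow], and [nondecreasing_family_path]
    applies to both families: the first is right-continuous, the second is so up
    to null sets. *)
Lemma trawl_path (K : R) : exists Y : R -> {RV P >-> mR},
  (forall t, K <= t <= K + 1 -> {ae P, forall w, X t w = Y t w}) /\
  forall w, cadlag_on K (K + 1) (fun t => Y t w).
Proof.
have fI t : K <= t -> finite_area (inflow a K t).
  by apply: finite_area_inflow => // s; exact: measurable_trawl.
have fO t : K <= t -> finite_area (outflow a K t).
  by apply: finite_area_outflow => // s; exact: measurable_trawl.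
have I0 t : K <= t -> leb2 ((\bigcap_n inflow a K (t + n.+1%:R^-1)) `\` inflow a K t) = 0%E.
  move=> Kt; rewrite (_ : _ `\` _ = set0); first exact: measure0.
  by rewrite setD_eq0; exact: inflow_right_continuous.
have [Y1 [Y1E Y1c]] := nondecreasing_family_path Hlevy nuE Hmu HL
  (fun s t Ks st => @inflowS R a K s t Ks st) fI I0.
have O0 t : K <= t -> leb2 ((\bigcap_n outflow a K (t + n.+1%:R^-1)) `\` outflow a K t) = 0%E.
  by apply: outflow_right_null => // s; exact: measurable_trawl.
have OS s t : K <= s -> s <= t -> outflow a K s `<=` outflow a K t by exact: outflowS.
have [Y2 [Y2E Y2c]] := nondecreasing_family_path Hlevy nuE Hmu HL OS fO O0.
have HY t : exists Z : {RV P >-> mR}, forall w, Z w = Y1 t w - Y2 t w.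
  have mY : measurable_fun setT (fun w => Y1 t w - Y2 t w).
    by apply: measurable_funB; exact: measurableRV.
  by exists (mfun_Sub (mem_set mY : ((fun w => Y1 t w - Y2 t w) : Omega -> mR) \in mfun)).
have [Y YE] := choice HY; exists Y; split => [t tK|w]; last first.
  apply: (cadlag_on_eq (f := fun t => Y1 t w - Y2 t w)) => [t _|]; first by rewrite YE.
  exact: cadlag_onB.
have /andP[Kt _] := tK.
have split_inflow : inflow a K t = trawl a t `|` outflow a K t.
  by rewrite setDUK//; exact: trawl_inflow.
have fT : finite_area (trawl a t) by apply: finite_area_trawl => // s; exact: measurable_trawl.
have LE : {ae P, forall w, Lambda (trawl a t `|` outflow a K t) w =
    Lambda (trawl a t) w + Lambda (outflow a K t) w}.
  by apply: (Lambda_setU Hlevy nuE Hmu HL fT (fO t Kt)); exact: setDIK.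
rewrite -split_inflow in LE.
move: (trawl_process_Lambda t) LE (Y1E t tK) (Y2E t tK) => h1 h2 h3 h4.
apply: filterS3 (filterI h1 h2) h3 h4 => w [-> h] h3w h4w.
by rewrite YE h3w h4w h addrK.
Qed.

Lemma trawl_modification : exists Y : R -> {RV P >-> mR},
  modification X Y /\ forall w, cadlag (fun t => Y t w).
Proof.
have [Z HZ] := choice (fun K : int => trawl_path K%:~R).
exists (fun t => Z (Num.floor t) t); split => [t|w]; last first.
  by apply: (@cadlag_glue R (fun K t => Z K t w)) => K; have [_] := HZ K; apply.
have [+ _] := HZ (Num.floor t) => /(_ t); rewrite -[X in _ + X]/(1%:~R) -intrD.
have /andP[ft tf] := floor_itv t; rewrite ft ltW//= => /(_ isT) XZ.
have mE : measurable [set w | X t w = Z (Num.floor t) t w].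
  have mD : measurable_fun setT (fun w => X t w - Z (Num.floor t) t w).
    by apply: measurable_funB; exact: measurableRV.
  have := mD measurableT [set 0] (measurable_set1 _); congr measurable.
  by apply/seteqP; split => w /=; [move=> [_ /eqP]; rewrite subr_eq0 => /eqP|
    move=> ->; rewrite subrr].
have PC : P (~` [set w | X t w = Z (Num.floor t) t w]) = 0%E.
  by apply/negligibleP => //; exact: measurableC.
by have := probability_setC P (measurableC mE); rewrite setCK PC sube0.
Qed.

End main.

Theorem corollary4 (R : realType) (d : measure_display)
    (Omega : measurableType d) (P : probability Omega R)
    (m : R) (lambda : {measure set (measurableTypeR R) -> \bar R})
    (mu : R.-ker Omega ~>
       (measurableTypeR R * measurableTypeR R * measurableTypeR R)%type)
    (Lambda : set (measurableTypeR R * measurableTypeR R) ->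
       {RV P >-> measurableTypeR R})
    (delta : R) (a : R -> R) (X : R -> {RV P >-> measurableTypeR R}) :
  levy_measure lambda ->
  poisson_random_measure P marked_half_plane (intensity lambda) mu ->
  is_levy_basis m lambda mu Lambda ->
  (forall s, 0 <= s -> 0 <= a s) ->
  nonincreasing_on_nneg a ->
  (\int[lebesgue_measure]_(s in `[0%R, +oo[) (a s)%:E < +oo)%E ->
  0 < delta ->
  holder_near0 delta a ->
  trawl_process Lambda a X ->
  exists Y : R -> {RV P >-> measurableTypeR R},
    modification X Y /\ forall w, cadlag (fun t => Y t w).
Proof.
move=> Hlevy Hmu HL a_ge0 a_dec a_int _ _ HX.
have [nu nuE] := intensity_measure Hlevy; rewrite -nuE in Hmu.
exact: (trawl_modification Hlevy nuE Hmu HL a_ge0 a_dec a_int HX).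
Qed.
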